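(* Suppose $(w,q)$ is a solution of the Navier-Stokes equations (as in the context) with $w\in L^{\infty}(0,\infty;H^3)$, $w_t,w_{tt}\in L^{\infty}(0,\infty;H^1)$, $q\in L^{\infty}(0,\infty;H^1)$, and denote $$C_w = \| w_{tt} \|^2_{L^{\infty}(0,\infty;H^{-1})}+ \| w_{t} \|_{L^{\infty}(0,\infty;L^2)}^2 \, \| w \|_{L^{\infty}(0,\infty;H^3)}^2 + \| \nabla w \|_{L^{\infty}(0,\infty;L^{\infty})}.$$ Let $\{u^n,\tilde u^n\}$, $n=1,2,3,\dots$, denote the solution of the CDA-Projection algorithm (defined in the context), with $\Delta t\le 1$, $\mu\ge \Delta t^{-2}$, $\mu\ge C_w$, and $\mu H^2\le \frac{\nu}{2C_I^2}$. Let $T>0$ be a finite end time, $M=\frac{T}{\Delta t}$ the number of time steps, and $e^n=w^n-u^n$. Then $$\left(\Delta t\sum_{n=1}^{M}\|\nabla e^{n+1}\|^2\right)^{1/2}\le C\,\Delta t,$$ where $C$ is a constant independent of $\Delta t$ and $\mu$.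
   Context: $\Omega\subset\mathbb{R}^d$, $d=2,3$, is an open bounded Lipschitz domain. $\|\cdot\|$ and $(\cdot,\cdot)$ are the $L^2(\Omega)$ norm and inner product. $X=H^1_0(\Omega)^d$, $Q=L^2_0(\Omega)$ (mean-zero $L^2$ functions), and $Y=\{u\in L^2(\Omega)^d:\nabla\cdot u=0,\ u\cdot n|_{\partial\Omega}=0\}$. $P_Y$ is the $L^2$-orthogonal projector of $L^2(\Omega)^d$ onto $Y$, and $\tilde u^{n}=P_Yu^{n}$. The constant $C$ may depend on the problem data, on $T$ and on the Navier-Stokes solution. Navier-Stokes equations: with viscosity $\nu>0$ and forcing $f\in L^\infty(0,\infty;H^{-1}(\Omega))$, $(w,q)$ satisfies $w_t+w\cdot\nabla w+\nabla q-\nu\Delta w=f$, $\nabla\cdot w=0$, $w|_{\partial\Omega}=0$, $w(0)=w^0$, where $w^0\in X$ is divergence-free. Here $\Delta t>0$ is the time step, $t^n=n\Delta t$, $w^n=w(t^n)$, $f^n=f(t^n)$. Measurement interpolant: $I_H$ is a (linear) interpolation operator on a regular conforming coarse mesh of maximum spacing $H$, into vector-valued piecewise polynomials of some fixed degree, satisfying for all $\phi\in X$: $\|I_H(\phi)-\phi\|\le C_IH\|\nabla\phi\|$ and $\|I_H(\phi)\|\le C_I\|\phi\|$. CDA-Projection algorithm (semi-discrete): let $u^0=w^0$ (so $\tilde u^0=w^0$), and let $\mu\ge0$ be a nudging parameter. For $n=0,1,2,\dots$: Step 1: find $u^{n+1}\in X$ such that for all $v\in X$ $$\tfrac1{\Delta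 t}(u^{n+1}-\tilde u^n,v)+(\tilde u^n\cdot\nabla u^{n+1},v)+\nu(\nabla u^{n+1},\nabla v)+\mu(I_H(u^{n+1}-w^{n+1}),v)=(f^{n+1},v).$$ Step 2: find $\tilde u^{n+1}\in Y$ and $p^{n+1}\in Q$ such that $\tfrac1{\Delta t}(\tilde u^{n+1}-u^{n+1},v)-(p^{n+1},\nabla\cdot v)=0$ for all $v\in Y$ and $(\nabla\cdot\tilde u^{n+1},r)=0$ for all $r\in Q$; that is, $\tilde u^{n+1}=P_Yu^{n+1}$. *)

(* Defs.v *)
From HB Require Import structures.
From mathcomp Require Import all_boot all_order all_algebra.
From mathcomp Require Import all_classical all_reals all_analysis.
From mathcomp Require Import ess_sup_inf.

Set Implicit Arguments.
Unset Strict Implicit.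
Unset Printing Implicit Defensive.

Import Order.TTheory GRing.Theory Num.Theory.
Import numFieldNormedType.Exports.

Local Open Scope classical_set_scope.
Local Open Scope ring_scope.

Definition rV_display : measure_display. Proof. exact. Qed.

Section measurable_rV.
Variables (R : realType) (n : nat).

Definition rV_coor (i : 'I_n) (x : 'rV[R]_n) : measurableTypeR R := x ord0 i.

Let rV_set0 : g_sigma_preimage rV_coor set0.
Proof. exact: sigma_algebra0. Qed.

Let rV_setC A : g_sigma_preimage rV_coor A -> g_sigma_preimage rV_coor (~` A).
Proof. exact: sigma_algebraC. Qed.

Let rV_bigcup (F : _^nat) : (forall i, g_sigma_preimage rV_coor (F i)) ->
  g_sigma_preimage rV_coor (\bigcup_i (F i)).
Proof. exact: sigma_algebra_bigcup. Qed.

HB.instance Definition _ := @isMeasurable.Build rV_display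
  'rV[R]_n (g_sigma_preimage rV_coor) rV_set0 rV_setC rV_bigcup.

Lemma measurable_rV_coor i : measurable_fun [set: 'rV[R]_n] (rV_coor i).
Proof.
move=> _ Y mY; rewrite setTI; apply: sub_sigma_algebra => /=.
rewrite -bigcup_seq/=; exists i => /=; first by rewrite mem_index_enum.
by exists Y => //; rewrite setTI.
Qed.

Lemma measurable_fun_rVP d (T : measurableType d) (f : T -> 'rV[R]_n) :
  (forall i, measurable_fun [set: T] (rV_coor i \o f)) ->
  measurable_fun [set: T] f.
Proof.
move=> mf _ A mA; rewrite setTI; move: A mA.
apply: smallest_sub; first split.
- by rewrite /= preimage_set0.
- by move=> A /= mA; rewrite setTD -preimage_setC; exact: measurableC.
- by move=> F /= mF; rewrite preimage_bigcup; exact: bigcup_measurable.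
rewrite -bigcup_seq; apply: bigcup_sub => i _ A [B mB <-] /=.
rewrite setTI -comp_preimage -[X in measurable X]setTI.
exact: mf.
Qed.

End measurable_rV.


Section measure_cons.
Variables (R : realType) (n : nat).

Definition rV_cons (p : measurableTypeR R * 'rV[R]_n) : 'rV[R]_n.+1 :=
  row_mx (p.1)%:M p.2 : 'rV[R]_(1 + n).

Definition rV_uncons (x : 'rV[R]_n.+1) : measurableTypeR R * 'rV[R]_n :=
  (x ord0 ord0, \row_i x ord0 (lift ord0 i)).

Lemma rV_cons0 p : rV_cons p ord0 ord0 = p.1.
Proof.
rewrite (_ : @ord0 n = lshift n (@ord0 0)); last exact: val_inj.
have := @row_mxEl R 1 1 n (p.1)%:M p.2 ord0 ord0.
by rewrite [in RHS]mxE eqxx mulr1n.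
Qed.

Lemma rV_consS p i : rV_cons p ord0 (lift ord0 i) = p.2 ord0 i.
Proof.
rewrite (_ : lift ord0 i = rshift 1 i); last exact: val_inj.
exact: (@row_mxEr R 1 1 n (p.1)%:M p.2 ord0 i).
Qed.

Lemma rV_consK : cancel rV_cons rV_uncons.
Proof.
move=> p; rewrite /rV_uncons rV_cons0 [RHS]surjective_pairing; congr pair.
by apply/rowP => i; rewrite mxE rV_consS.
Qed.

Lemma rV_unconsK : cancel rV_uncons rV_cons.
Proof.
move=> x; apply/rowP => i; case: (unliftP ord0 i) => [j|] ->.
  by rewrite rV_consS mxE.
by rewrite rV_cons0.
Qed.

Lemma measurable_rV_cons : measurable_fun setT rV_cons.
Proof.
apply: measurable_fun_rVP => i; case: (unliftP ord0 i) => [j|] ->.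
  apply: (eq_measurable_fun (rV_coor j \o snd)).
    by move=> p _ /=; rewrite /rV_coor rV_consS.
  by apply: measurableT_comp => //; exact: measurable_rV_coor.
apply: (eq_measurable_fun fst) => // p _ /=.
by rewrite /rV_coor rV_cons0.
Qed.

Lemma measurable_rV_uncons : measurable_fun setT rV_uncons.
Proof.
apply/measurable_fun_pairP; split; first exact: (measurable_rV_coor ord0).
apply: measurable_fun_rVP => i.
apply: (eq_measurable_fun (rV_coor (lift ord0 i))).
  by move=> x _; rewrite /rV_coor /= mxE.
exact: measurable_rV_coor.
Qed.

Variable l : {sigma_finite_measure set (measurableTypeR R) -> \bar R}.
Variable m : {sigma_finite_measure set 'rV[R]_n -> \bar R}.

Definition measure_cons : set 'rV[R]_n.+1 -> \bar R :=
  pushforward (l \x m)%E rV_cons.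

Let measure_cons0 : measure_cons set0 = 0%E.
Proof. by rewrite /measure_cons /pushforward preimage_set0 measure0. Qed.

Let measure_cons_ge0 A : (0 <= measure_cons A)%E.
Proof. exact: (measure_ge0 (l \x m)%E). Qed.

Let measure_cons_sigma_additive : semi_sigma_additive measure_cons.
Proof.
have mp A : measurable A -> measurable (rV_cons @^-1` A).
  by move=> mA; rewrite -[X in measurable X]setTI; exact: measurable_rV_cons.
move=> F mF tF mUF; rewrite /measure_cons /pushforward preimage_bigcup.
apply: measure_semi_sigma_additive.
- by move=> k; exact: mp.
- apply/trivIsetP => /= i j _ _ ij; rewrite -preimage_setI.
  by move/trivIsetP : tF => /(_ _ _ _ _ ij) ->//; rewrite preimage_set0.
- by rewrite -preimage_bigcup; exact: mp.
Qed.

HB.instance Definition _ := isMeasure.Build _ _ _ measure_cons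
  measure_cons0 measure_cons_ge0 measure_cons_sigma_additive.

Let measure_cons_sigma_finite : sigma_finite setT measure_cons.
Proof.
have /sigma_finiteP[F [TF ndF Foo]] := sigma_finiteT l.
have /sigma_finiteP[G [TG ndG Goo]] := sigma_finiteT m.
exists (fun k => rV_uncons @^-1` (F k `*` G k)).
  apply/seteqP; split=> // x _.
  have [i _ Fi] : (\bigcup_k F k) (rV_uncons x).1 by rewrite -TF.
  have [j _ Gj] : (\bigcup_k G k) (rV_uncons x).2 by rewrite -TG.
  exists (maxn i j) => //; split.
    by move: Fi; exact/subsetPset/ndF/leq_maxl.
  by move: Gj; exact/subsetPset/ndG/leq_maxr.
move=> k; have [mF Fk] := Foo k; have [mG Gk] := Goo k; split.
  rewrite -[X in measurable X]setTI; apply: measurable_rV_uncons => //.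
  exact: measurableX.
rewrite /measure_cons /pushforward -comp_preimage.
rewrite (_ : rV_uncons \o rV_cons = id); last exact/funext/rV_consK.
by rewrite preimage_id product_measure1E// lte_mul_pinfty// ge0_fin_numE.
Qed.

HB.instance Definition _ := Measure_isSigmaFinite.Build _ _ _ measure_cons
  measure_cons_sigma_finite.

End measure_cons.

Fixpoint lebesgue_rV (R : realType) (n : nat) :
    {sigma_finite_measure set 'rV[R]_n -> \bar R} :=
  if n is n'.+1 then measure_cons (@lebesgue_measure R) (lebesgue_rV R n')
  else \d_(0 : 'rV[R]_0).

(* This property characterizes lebesgue_rV as the n-dimensional Lebesgue measure
   on Borel sets. *)
Lemma lebesgue_rV_box (R : realType) (n : nat)
    (A : 'I_n -> set (measurableTypeR R)) : (forall i, measurable (A i)) ->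
  lebesgue_rV R n [set x | forall i, A i (x ord0 i)] =
  (\prod_(i < n) lebesgue_measure (A i))%E.
Proof.
elim: n A => [|n IHn] A mA.
  by rewrite big_ord0 /= diracE mem_set// => -[].
have mB : measurable [set x : 'rV[R]_n | forall i, A (lift ord0 i) (x ord0 i)].
  rewrite (_ : [set _ | _] =
      \bigcap_(i in [set: 'I_n]) (rV_coor i @^-1` A (lift ord0 i))); last first.
    by apply/seteqP; split=> [x Ax i _|x Ax i]; exact: Ax.
  apply: fin_bigcap_measurable => // i _; rewrite -[X in measurable X]setTI.
  exact: measurable_rV_coor.
rewrite big_ord_recl -(IHn (fun i => A (lift ord0 i)))//.
rewrite -product_measure1E//.
apply: (congr1 (@lebesgue_measure R \x lebesgue_rV R n)%E).
apply/seteqP; split=> [p Ap|p [A0 AS] i].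
  split; first by have := Ap ord0; rewrite rV_cons0.
  by move=> i; have := Ap (lift ord0 i); rewrite rV_consS.
by case: (unliftP ord0 i) => [j|] ->; rewrite ?rV_consS ?rV_cons0//; exact: AS.
Qed.

Definition dotm (R : realType) (m n : nat) (A B : 'M[R]_(m, n)) : R :=
  \tr (A *m B^T).

Definition fnorm (R : realType) (m n : nat) (A : 'M[R]_(m, n)) : R :=
  Num.sqrt (dotm A A).

Section lipschitz_domain.
Context {R : realType} {d : nat}.

(* Near each boundary point Omega is the strict epigraph, in the direction of
   the unit vector a, of a Lipschitz function gamma of the coordinates
   orthogonal to a, i.e. of a function invariant under translations along a. *)
Definition lipschitz_domain (Omega : set 'rV[R]_d) : Prop :=
  [/\ open Omega, connected Omega, bounded_set Omega, Omega !=set0 &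
    forall x, (closure Omega `\` Omega) x ->
    exists (a : 'rV[R]_d) (gamma : 'rV[R]_d -> R) (r : R),
      [/\ 0 < r, fnorm a = 1,
          lipschitz (gamma : 'rV[R]_d -> R^o),
          forall y s, gamma (y + s *: a) = gamma y &
          forall y, fnorm (y - x) < r -> (Omega y <-> gamma y < dotm y a)]].

End lipschitz_domain.

Section spaces.
Context {R : realType} {d : nat}.
Variable Omega : set 'rV[R]_d.

Local Notation E := 'rV[R]_d.
Local Notation sfield := (E -> R).
Local Notation vfield := (E -> E).
Local Notation mu := (lebesgue_rV R d).

Definition ip (m n : nat) (F G : E -> 'M[R]_(m, n)) : R :=
  \int[mu]_(x in Omega) dotm (F x) (G x).

Definition ips (f g : sfield) : R := \int[mu]_(x in Omega) (f x * g x).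

Definition L2norm (m n : nat) (F : E -> 'M[R]_(m, n)) : R :=
  Num.sqrt (ip F F).

Definition L2 : set sfield := [set f | f \_ Omega \in Lfun mu 2%:E].

Definition L2v : set vfield :=
  [set u | forall i, L2 (fun x => u x ord0 i)].

Definition L20 : set sfield :=
  [set q | L2 q /\ \int[mu]_(x in Omega) q x = 0].

Definition pd (i : 'I_d) (phi : sfield) : sfield :=
  fun x => derive (phi : E -> R^o) x (delta_mx ord0 i).

Definition pdm (a : 'I_d -> nat) (phi : sfield) : sfield :=
  foldr (fun i => iter (a i) (pd i)) phi (enum 'I_d).

Definition smooth (phi : sfield) : Prop :=
  forall (s : seq 'I_d) x, differentiable (foldr pd phi s : E -> R^o) x.

Definition test_fun : set sfield :=
  [set phi | [/\ smooth phi, compact (closure [set x | phi x != 0]) &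
                 closure [set x | phi x != 0] `<=` Omega]].

Definition is_wderiv (a : 'I_d -> nat) (u g : sfield) : Prop :=
  L2 g /\ forall phi, test_fun phi ->
    ips u (pdm a phi) = (-1) ^+ (\sum_i a i)%N * ips g phi.

(* A representative of the weak derivative, which is unique almost everywhere
   on Omega; a junk value when there is none in L^2. *)
Definition wderiv (a : 'I_d -> nat) (u : sfield) : sfield :=
  get [set g | is_wderiv a u g].

Definition wpd (i : 'I_d) : sfield -> sfield :=
  wderiv (fun j => (j == i) : nat).

Definition Hk (k : nat) : set sfield :=
  [set u | L2 u /\ forall a : {ffun 'I_d -> 'I_k.+1},
     (\sum_i a i <= k)%N -> exists g, is_wderiv (fun i => a i) u g].

Definition Hk_sqnorm (k : nat) (u : sfield) : R :=
  \sum_(a : {ffun 'I_d -> 'I_k.+1} | (\sum_i a i <= k)%N)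
    ips (wderiv (fun i => a i) u) (wderiv (fun i => a i) u).

Definition Hk_norm (k : nat) (u : sfield) : R := Num.sqrt (Hk_sqnorm k u).

Definition Hkv (k : nat) : set vfield :=
  [set u | forall i, Hk k (fun x => u x ord0 i)].

Definition Hkv_norm (k : nat) (u : vfield) : R :=
  Num.sqrt (\sum_i Hk_sqnorm k (fun x => u x ord0 i)).

Definition H10 : set sfield :=
  [set u | Hk 1 u /\ forall eps, 0 < eps ->
     exists2 phi, test_fun phi & Hk_norm 1 (u - phi) < eps].

Definition H10v : set vfield :=
  [set u | forall i, H10 (fun x => u x ord0 i)].

Definition grad (q : sfield) : vfield := fun x => \row_j wpd j q x.

(* (gradv u x) i j is the j-th partial derivative of u_i. *)
Definition gradv (u : vfield) : E -> 'M[R]_d :=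
  fun x => \matrix_(i, j) wpd j (fun y => u y ord0 i) x.

(* a . nabla u *)
Definition conv (a u : vfield) : vfield := fun x => a x *m (gradv u x)^T.

Definition is_wdiv (u : vfield) (g : sfield) : Prop :=
  L2 g /\ forall phi, test_fun phi ->
    ip u (fun x => \row_j pd j phi x) = - ips g phi.

Definition wdiv (u : vfield) : sfield := get [set g | is_wdiv u g].

Definition divfree (u : vfield) : Prop := is_wdiv u (cst 0).

(* The normal trace of a field with divergence in L^2 is the functional
   phi |-> (u, grad phi) + (div u, phi) on H^1 (Green's formula). *)
Definition normal_trace (u : vfield) (phi : sfield) : R :=
  ip u (grad phi) + ips (wdiv u) phi.

Definition Yspace : set vfield :=
  [set u | [/\ L2v u, divfree u &
               forall phi, Hk 1 phi -> normal_trace u phi = 0]].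

Definition Hm1 : set (vfield -> R) :=
  [set F | (forall a u v, H10v u -> H10v v ->
              F (a *: u + v) = a * F u + F v) /\
           exists K, forall v, H10v v -> `|F v| <= K * L2norm (gradv v)].

(* The quotient is 0 when v = 0, by the convention x / 0 = 0. *)
Definition Hm1_norm (F : vfield -> R) : \bar R :=
  ereal_sup [set (`|F v| / L2norm (gradv v))%:E | v in H10v].

Definition Linfty_norm (m n : nat) (F : E -> 'M[R]_(m, n)) : \bar R :=
  'N[mu]_+oo [(fun x => (fnorm (F x))%:E) \_ Omega].

End spaces.

Section time.
Context {R : realType} {d : nat}.
Variable Omega : set 'rV[R]_d.

Local Notation sfield := ('rV[R]_d -> R).
Local Notation vfield := ('rV[R]_d -> 'rV[R]_d).

Definition LinftyT_norm (V : Type) (N : V -> \bar R) (g : R -> V) : \bar R :=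
  ess_sup (mrestr (@lebesgue_measure R) (measurable_itv `]0%R, +oo[))
    (fun t => N (g t)).

(* L^oo(0, oo; B), for B a separable space with norm N.  Time-dependent
   quantities are evaluated at the discrete times, so an element is given by an
   everywhere defined representative that belongs to B and is bounded by the
   essential supremum of its norm at every t > 0.  Measurability is tested
   against the functionals in D. *)
Definition LinftyT (V : Type) (B : set V) (N : V -> \bar R) (D : set (V -> R))
    (g : R -> V) : Prop :=
  [/\ forall t, 0 < t -> B (g t),
      forall l, D l ->
        measurable_fun (`]0%R, +oo[ : set (measurableTypeR R)) (fun t => l (g t)),
      (LinftyT_norm N g < +oo)%E &
      forall t, 0 < t -> (N (g t) <= LinftyT_norm N g)%E].

Definition L2v_dual : set (vfield -> R) :=
  [set (fun u => ip Omega u phi) | phi in L2v Omega].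

Definition LinftyT_Hkv (k : nat) : (R -> vfield) -> Prop :=
  LinftyT (Hkv Omega k) (fun u => (Hkv_norm Omega k u)%:E) L2v_dual.

Definition LinftyT_Hk (k : nat) : (R -> sfield) -> Prop :=
  LinftyT (Hk Omega k) (fun q => (Hk_norm Omega k q)%:E)
    [set (fun q => ips Omega q phi) | phi in L2 Omega].

Definition LinftyT_Hm1 : (R -> vfield -> R) -> Prop :=
  LinftyT (Hm1 Omega) (Hm1_norm Omega)
    [set (fun F => F v) | v in H10v Omega].

(* g is the weak time derivative of v, v being the representative that is
   continuous from [0, oo) to L^2: v(t) - v(s) is the (weak) integral of g
   over [s, t]. *)
Definition is_tderiv (v g : R -> vfield) : Prop :=
  forall phi, L2v Omega phi -> forall s t, 0 <= s -> s <= t ->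
    (@lebesgue_measure R).-integrable `[s, t]
      (fun r => (ip Omega (g r) phi)%:E) /\
    ip Omega (v t - v s) phi =
      \int[@lebesgue_measure R]_(r in `[s, t]) ip Omega (g r) phi.

(* The momentum equation is an identity in H^-1 for every t > 0. *)
Definition navier_stokes (nu : R) (f : R -> vfield -> R) (w0 : vfield)
    (w wt : R -> vfield) (q : R -> sfield) : Prop :=
  [/\ H10v Omega w0, divfree Omega w0, w 0 = w0, is_tderiv w wt &
    forall t, 0 < t ->
      [/\ H10v Omega (w t), divfree Omega (w t) &
        forall v, H10v Omega v ->
          ip Omega (wt t) v + ip Omega (conv Omega (w t) (w t)) v
          + ip Omega (grad Omega (q t)) v
          + nu * ip Omega (gradv Omega (w t)) (gradv Omega v) = f t v]].

Definition Cw (w wt wtt : R -> vfield) : \bar R :=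
  (LinftyT_norm (Hm1_norm Omega) (fun t v => ip Omega (wtt t) v) ^+ 2
   + LinftyT_norm (fun u => (L2norm Omega u)%:E) wt ^+ 2
     * LinftyT_norm (fun u => (Hkv_norm Omega 3 u)%:E) w ^+ 2
   + LinftyT_norm (fun u => Linfty_norm Omega (gradv Omega u)) w)%E.

End time.

Section interpolant.
Context {R : realType} {d : nat}.
Variable Omega : set 'rV[R]_d.

Local Notation E := 'rV[R]_d.
Local Notation vfield := (E -> E).

Definition conv_hull (m : nat) (V : 'I_m -> E) : set E :=
  [set x | exists c : 'I_m -> R,
     [/\ forall i, 0 <= c i, \sum_i c i = 1 & x = \sum_i c i *: V i]].

(* When F and K are convex this says that F is a (possibly empty) face of K. *)
Definition extreme_in (F K : set E) : Prop :=
  F `<=` K /\ forall x y t, K x -> K y -> 0 < t < 1 ->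
    F (t *: x + (1 - t) *: y) -> F x /\ F y.

Definition diam (K : set E) : R :=
  sup [set fnorm (z.1 - z.2) | z in K `*` K].

(* Conforming mesh of polytopes covering Omega, with maximal element diameter H
   and diameter/inradius ratios bounded by sigma.  The mesh covers Omega rather
   than its closure exactly since Omega need not be a polytope. *)
Definition regular_mesh (sigma H : R) (N : nat) (K : 'I_N -> set E) : Prop :=
  [/\ forall i, exists m (V : 'I_m -> E), K i = conv_hull V,
      forall i, exists c r,
        [/\ 0 < r, [set x | fnorm (x - c) <= r] `<=` K i &
            diam (K i) <= sigma * r],
      forall i j, i != j ->
        [/\ K i <> K j, extreme_in (K i `&` K j) (K i) &
            extreme_in (K i `&` K j) (K j)],
      Omega `<=` \bigcup_i K i /\ forall i, (Omega `&` K i) !=set0 &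
      H = \big[Num.max/0]_i diam (K i)].

Definition polyfun (k : nat) (P : E -> R) : Prop :=
  exists c : {ffun 'I_d -> 'I_k.+1} -> R, forall x,
    P x = \sum_(a : {ffun 'I_d -> 'I_k.+1} | (\sum_i a i <= k)%N)
            c a * \prod_i x ord0 i ^+ a i.

Definition interpolant (k : nat) (sigma CI H : R) (IH : vfield -> vfield) :
    Prop :=
  [/\ exists N (K : 'I_N -> set E), regular_mesh sigma H K /\
        forall phi, H10v Omega phi -> forall i j, exists2 P, polyfun k P &
          {ae lebesgue_rV R d, forall x,
             Omega x -> K i x -> IH phi x ord0 j = P x},
      forall phi, H10v Omega phi -> L2v Omega (IH phi),
      forall a phi psi, H10v Omega phi -> H10v Omega psi ->
        {ae lebesgue_rV R d, forall x,
           Omega x -> IH (a *: phi + psi) x = a *: IH phi x + IH psi x},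
      forall phi, H10v Omega phi ->
        L2norm Omega (IH phi - phi) <= CI * H * L2norm Omega (gradv Omega phi) &
      forall phi, H10v Omega phi ->
        L2norm Omega (IH phi) <= CI * L2norm Omega phi].

End interpolant.

Section algorithm.
Context {R : realType} {d : nat}.
Variable Omega : set 'rV[R]_d.

Local Notation sfield := ('rV[R]_d -> R).
Local Notation vfield := ('rV[R]_d -> 'rV[R]_d).

(* u1, w1, f1 are the values at the new time level, ut0 the projected velocity
   at the old one.  The convective term is required to be a convergent integral
   since \int is a junk value otherwise. *)
Definition cda_step1 (nu dt mu : R) (IH : vfield -> vfield)
    (f1 : vfield -> R) (w1 ut0 u1 : vfield) : Prop :=
  H10v Omega u1 /\ forall v, H10v Omega v ->
    (lebesgue_rV R d).-integrable Omega
      (fun x => (dotm (conv Omega ut0 u1 x) (v x))%:E) /\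
    dt^-1 * ip Omega (u1 - ut0) v + ip Omega (conv Omega ut0 u1) v
    + nu * ip Omega (gradv Omega u1) (gradv Omega v)
    + mu * ip Omega (IH (u1 - w1)) v = f1 v.

Definition cda_step2 (dt : R) (u1 ut1 : vfield) (p1 : sfield) : Prop :=
  [/\ Yspace Omega ut1, L20 Omega p1,
      forall v, Yspace Omega v ->
        dt^-1 * ip Omega (ut1 - u1) v - ips Omega p1 (wdiv Omega v) = 0 &
      forall r, L20 Omega r -> ips Omega (wdiv Omega ut1) r = 0].

Definition cda_projection (nu dt mu : R) (IH : vfield -> vfield)
    (f : R -> vfield -> R) (w0 : vfield) (w : R -> vfield)
    (u ut : nat -> vfield) (p : nat -> sfield) : Prop :=
  [/\ u 0%N = w0, ut 0%N = w0 &
    forall n, cda_step1 nu dt mu IH (f (n.+1%:R * dt)) (w (n.+1%:R * dt))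
                (ut n) (u n.+1) /\
              cda_step2 dt (u n.+1) (ut n.+1) (p n.+1)].

End algorithm.

(* Main.v *)
(* The error e = w - u is tested at time n+1 in the difference of the
   Navier-Stokes equations and Step 1. Since mu >= dt^-2, a term bounded by
   X |e^{n+1}| with X bounded in L^2 is at most mu |e^{n+1}|^2 / 4 + dt^2 X^2, so
   crude bounds suffice: w_t, (w^{n+1} - w^n)/dt and grad q are merely bounded in
   L^2, no cancellation between them is used, and w_tt is not needed. The nudging
   term is at least mu |e|^2 / 2 - nu |grad e|^2 / 4 because mu H^2 C_I^2 <= nu/2.
   Step 2 does not increase the L^2 distance to w^{n+1}, and the discrete Gronwall
   inequality, started from a zero initial error, concludes.

   Two points are less routine. The transport field of Step 1 is only a weakly
   divergence-free L^2 field a, so ((a . grad) e, e) = 0 is obtained by replacing e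
   with a bounded function of e, for which smooth approximations of e converge,
   and then removing the truncation by dominated convergence. And C_w bounds
   grad w only at almost every time; the bound passes to every positive time
   because w is weakly continuous and order bounds survive weak limits. *)
Require Import Defs.
From mathcomp Require Import all_boot all_order all_algebra.
From mathcomp Require Import all_classical all_reals all_analysis.
From mathcomp Require Import measurable_realfun ess_sup_inf simple_functions.
From mathcomp Require Import ring lra.

Set Implicit Arguments.
Unset Strict Implicit.
Unset Printing Implicit Defensive.

Import Order.TTheory GRing.Theory Num.Theory.
Import numFieldNormedType.Exports.

Local Open Scope classical_set_scope.
Local Open Scope ring_scope.

(** * Square integrable functions *)

(** The momentum equation and Step 1 at the same time level are both tested with [e]. Skew-symmetry
    replaces the discrete convection of [u] by that of [w] along the same field, so the convective
    error is [(dw . grad) w + (et . grad) w], with [dw] the increment of [w] over one step and [et]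
    the old projected error. It costs only a sup bound on [grad w] and leaves the viscous term free
    to absorb the defect of the interpolant.

    The constant has to be chosen before [dt], [mu], [H] and the interpolant. Hence the gradient
    bound is read off the essential supremum itself, and the hypothesis on [C_w] certifies that this
    supremum is finite.

    The length comes from weak derivatives being arbitrarily chosen representatives in L^2:
    identities between them hold only almost everywhere and go through uniqueness, that is, through
    density of test functions. Test functions are therefore built explicitly, and their integration
    by parts rests on Fubini for a Lebesgue measure defined one coordinate at a time. *)

Section square_integrable.
Context {R : realType} {d : nat}.
Variable Omega : set 'rV[R]_d.
Hypothesis mO : measurable Omega.

Local Notation E := 'rV[R]_d.
Local Notation mu := (lebesgue_rV R d).
Local Notation L2 := (L2 Omega).
Local Notation ips := (ips Omega).
Local Notation sint f := (mu.-integrable Omega (fun x => (f x)%:E)).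

Implicit Types f g h : E -> R.

Definition nrmL2 (f : E -> R) : R := Num.sqrt (ips f f).
Local Notation nrm := nrmL2.

Lemma L2P (f : E -> R) :
  L2 f <-> measurable_fun Omega f /\ sint (fun x => f x ^+ 2).
Proof.
split=> [Lf|[mf /integrableP[_ fi]]].
  split.
    move: Lf; rewrite /Defs.L2/= inE => /andP[/[!inE]/= mf _].
    exact/(measurable_restrictT _ _).2.
  have /= := Lfun2_integrable_sqr Lf.
  rewrite (_ : (EFin \o _) = (fun x => (f x ^+ 2)%:E) \_ Omega).
    by move=> /(integrable_mkcond _ mO).
  apply/funext => x /=; rewrite !patchE; case: ifPn => // _.
  by rewrite expr0n.
rewrite /Defs.L2/= inE; apply/andP; split; rewrite inE/=.
  exact/(measurable_restrictT _ _).1.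
rewrite /finite_norm unlock /Lnorm poweR_lty//.
move: fi; rewrite [(\int[_]_(x in Omega) _)%E]integral_mkcond; apply: le_lt_trans.
rewrite le_eqVlt; apply/orP; left; apply/eqP; apply: eq_integral => x _ /=.
rewrite !patchE; case: ifPn => _.
  by rewrite -[2]/(2%:R) powR_mulrn// normrX.
by rewrite normr0 powR0.
Qed.

Lemma L2_measurable f : L2 f -> measurable_fun Omega f.
Proof. by move=> /L2P[]. Qed.

Lemma sint_measurable f : sint f -> measurable_fun Omega f.
Proof. by move=> /integrableP[/measurable_EFinP]. Qed.

Lemma ae_le_sint (f g : E -> R) : measurable_fun Omega f ->
  sint g -> {ae mu, forall x, Omega x -> `|f x| <= `|g x|} -> sint f.
Proof.
move=> mf /integrableP[mg gi] fg; apply/integrableP; split.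
  exact/measurable_EFinP.
apply: le_lt_trans gi; apply: ae_ge0_le_integral => //.
- by apply: measurableT_comp => //; exact/measurable_EFinP.
- exact: measurableT_comp.
Qed.

Lemma le_sint (f g : E -> R) : measurable_fun Omega f ->
  sint g -> (forall x, Omega x -> `|f x| <= `|g x|) -> sint f.
Proof. by move=> mf gi fg; apply: (ae_le_sint mf gi); exact: aeW. Qed.

Lemma ae_le_L2 f g : measurable_fun Omega f -> L2 g ->
  {ae mu, forall x, Omega x -> `|f x| <= `|g x|} -> L2 f.
Proof.
move=> mf /L2P[mg gi] fg; apply/L2P; split=> //.
apply: (ae_le_sint _ gi); first exact: measurable_funX.
move: fg; apply: filterS => x fg Ox.
by rewrite !normrX lerXn2r// ?nnegrE// fg.
Qed.

Lemma le_L2 f g : measurable_fun Omega f -> L2 g ->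
  (forall x, Omega x -> `|f x| <= `|g x|) -> L2 f.
Proof. by move=> mf Lg fg; apply: (ae_le_L2 mf Lg); exact: aeW. Qed.

Lemma L2M_sint f g : L2 f -> L2 g -> sint (fun x => f x * g x).
Proof.
move=> /L2P[mf fi] /L2P[mg gi].
apply: (@le_sint _ (fun x => f x ^+ 2 + g x ^+ 2)).
- exact: measurable_funM.
- exact: (integrableD mO fi gi).
- move=> x Ox; rewrite normrM [leRHS]ger0_norm ?addr_ge0 ?sqr_ge0//.
  rewrite -(real_normK (num_real (f x))) -(real_normK (num_real (g x))).
  set a := `|f x|; set b := `|g x|.
  have := sqr_ge0 (a - b); have := sqr_ge0 (a + b).
  nra.
Qed.

Lemma L2D f g : L2 f -> L2 g -> L2 (fun x => f x + g x).
Proof.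
move=> Lf Lg; have [mf fi] := (L2P _).1 Lf; have [mg gi] := (L2P _).1 Lg.
apply/L2P; split; first exact: measurable_funD.
apply: (@le_sint _ (fun x => 2 * f x ^+ 2 + 2 * g x ^+ 2)).
- by apply: measurable_funX; exact: measurable_funD.
- have := integrableD mO (integrableZl mO 2 fi) (integrableZl mO 2 gi).
  exact.
- move=> x Ox; rewrite ger0_norm ?sqr_ge0// [leRHS]ger0_norm.
    by have := sqr_ge0 (f x - g x); nra.
  by rewrite addr_ge0// mulr_ge0// sqr_ge0.
Qed.

Lemma L2Z a f : L2 f -> L2 (fun x => a * f x).
Proof.
move=> /L2P[mf fi]; apply/L2P; split; first exact: measurable_funM.
under eq_fun do rewrite exprMn EFinM.
exact: integrableZl.
Qed.

Lemma L2N f : L2 f -> L2 (fun x => - f x).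
Proof.
by move=> /(L2Z (-1)); under eq_fun do rewrite mulN1r.
Qed.

Lemma L2B f g : L2 f -> L2 g -> L2 (fun x => f x - g x).
Proof. by move=> Lf /L2N; exact: L2D. Qed.

Lemma L20_cst : L2 (fun=> 0).
Proof.
apply/L2P; split; first exact: measurable_cst.
by under eq_fun do rewrite expr0n; exact: integrable0.
Qed.

Lemma L2_sum (I : Type) (s : seq I) (f : I -> E -> R) :
  (forall i, L2 (f i)) -> L2 (fun x => \sum_(i <- s) f i x).
Proof.
move=> Lf; elim: s => [|i s IHs].
  by under eq_fun do rewrite big_nil; exact: L20_cst.
by under eq_fun do rewrite big_cons; exact: L2D.
Qed.

Lemma ipsC f g : ips f g = ips g f.
Proof. by apply: eq_Rintegral => x _; rewrite mulrC. Qed.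

Lemma ipsDl f g h : L2 f -> L2 g -> L2 h ->
  ips (fun x => f x + g x) h = ips f h + ips g h.
Proof.
move=> Lf Lg Lh; rewrite /Defs.ips -RintegralD//; try exact: L2M_sint.
by apply: eq_Rintegral => x _; rewrite mulrDl.
Qed.

Lemma ipsZl a f h : L2 f -> L2 h -> ips (fun x => a * f x) h = a * ips f h.
Proof.
move=> Lf Lh; rewrite /Defs.ips -RintegralZl//; last exact: L2M_sint.
by apply: eq_Rintegral => x _; rewrite mulrA.
Qed.

Lemma ipsNl f h : L2 f -> L2 h -> ips (fun x => - f x) h = - ips f h.
Proof.
move=> Lf Lh; rewrite -mulN1r -ipsZl//.
by congr Defs.ips; apply/funext => x; rewrite mulN1r.
Qed.

Lemma ipsBl f g h : L2 f -> L2 g -> L2 h ->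
  ips (fun x => f x - g x) h = ips f h - ips g h.
Proof. by move=> Lf Lg Lh; rewrite ipsDl ?ipsNl//; exact: L2N. Qed.

Lemma ipsDr f g h : L2 f -> L2 g -> L2 h ->
  ips h (fun x => f x + g x) = ips h f + ips h g.
Proof. by move=> *; rewrite ipsC ipsDl// ![ips h _]ipsC. Qed.

Lemma ipsZr a f h : L2 f -> L2 h -> ips h (fun x => a * f x) = a * ips h f.
Proof. by move=> *; rewrite ipsC ipsZl// ipsC. Qed.

Lemma ipsBr f g h : L2 f -> L2 g -> L2 h ->
  ips h (fun x => f x - g x) = ips h f - ips h g.
Proof. by move=> *; rewrite ipsC ipsBl// ![ips h _]ipsC. Qed.

Lemma ips0l h : ips (fun=> 0) h = 0.
Proof.
rewrite /Defs.ips; under eq_Rintegral do rewrite mul0r.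
by rewrite Rintegral_cst// mul0r.
Qed.

Lemma ips_suml (I : Type) (s : seq I) (f : I -> E -> R) h :
  (forall i, L2 (f i)) -> L2 h ->
  ips (fun x => \sum_(i <- s) f i x) h = \sum_(i <- s) ips (f i) h.
Proof.
move=> Lf Lh; elim: s => [|i s IHs].
  by under eq_fun do rewrite big_nil; rewrite ips0l big_nil.
under eq_fun do rewrite big_cons.
by rewrite ipsDl// ?big_cons ?IHs//; exact: L2_sum.
Qed.

Lemma ips_ge0 f : 0 <= ips f f.
Proof. by apply: Rintegral_ge0 => x _; rewrite -expr2 sqr_ge0. Qed.

Lemma nrm_ge0 f : 0 <= nrm f. Proof. exact: sqrtr_ge0. Qed.

Lemma nrm_sqr f : nrm f ^+ 2 = ips f f.
Proof. by rewrite sqr_sqrtr// ips_ge0. Qed.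

Lemma ips_ae f f' g : L2 f -> L2 f' -> L2 g ->
  {ae mu, forall x, Omega x -> f x = f' x} -> ips f g = ips f' g.
Proof.
move=> Lf Lf' Lg ff'; congr fine; apply: ae_eq_integral => //.
- by apply/measurable_EFinP; apply: measurable_funM; exact: L2_measurable.
- by apply/measurable_EFinP; apply: measurable_funM; exact: L2_measurable.
- by move: ff'; apply: filterS => x /[apply] ->.
Qed.

Lemma le_Rintegral_ae (f g : E -> R) : sint f -> sint g ->
  {ae mu, forall x, Omega x -> f x <= g x} ->
  \int[mu]_(x in Omega) f x <= \int[mu]_(x in Omega) g x.
Proof.
move=> fi gi fg.
(* Replacing [g] by [max(f, g)], which agrees with it almost everywhere, makes the inequality hold
   at every point. *)
have -> : \int[mu]_(x in Omega) g x =
    \int[mu]_(x in Omega) Num.max (f x) (g x).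
  congr fine; apply: ae_eq_integral => //.
  - by have /integrableP[] := gi.
  - by apply/measurable_EFinP; apply: measurable_maxr; exact: sint_measurable.
  - by move: fg; apply: filterS => x fg Ox; rewrite max_r// fg.
apply: le_Rintegral => //.
  apply: (@le_sint _ (fun x => `|f x| + `|g x|)).
  - by apply: measurable_maxr; exact: sint_measurable.
  - exact: (integrableD mO (integrable_abse fi) (integrable_abse gi)).
  - move=> x Ox; rewrite [leRHS]ger0_norm ?addr_ge0//.
    by rewrite maxEle; case: ifP => _; rewrite ?lerDl ?lerDr.
by move=> x _; rewrite le_max lexx.
Qed.

Lemma ips0_ae f : L2 f -> ips f f = 0 ->
  {ae mu, forall x, Omega x -> f x = 0}.
Proof.
move=> Lf ff0; have [mf fi] := (L2P _).1 Lf.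
have /(ae_eq_integral_abs mu mO) : (\int[mu]_(x in Omega) `|(f x ^+ 2)%:E| = 0)%E.
  under eq_integral do rewrite gee0_abs ?lee_fin ?sqr_ge0//.
  have h : (\int[mu]_(x in Omega) (f x ^+ 2)%:E)%E \is a fin_num.
    exact: (integrable_fin_num mO fi).
  rewrite -(fineK h); congr (_%:E); rewrite -[RHS]ff0.
  by congr fine; apply: eq_integral => x _; rewrite expr2.
move=> /(_ _)/wrap[]; first by apply/measurable_EFinP; exact: measurable_funX.
apply: filterS => x + Ox => /(_ Ox)[] /eqP.
by rewrite sqrf_eq0 => /eqP.
Qed.

(** The square norm of [f - t g] is nonnegative at its minimiser [t = (f, g) / (g, g)]; when
    [(g, g) = 0], [g] vanishes almost everywhere. *)
Lemma ips_sqr_le f g : L2 f -> L2 g -> ips f g ^+ 2 <= ips f f * ips g g.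
Proof.
move=> Lf Lg; have [gg0|gg0] := eqVneq (ips g g) 0.
  rewrite (_ : ips f g = 0) ?expr0n ?gg0 ?mulr0//.
  rewrite ipsC -[RHS](ips0l f); apply: ips_ae => //; first exact: L20_cst.
  exact: ips0_ae.
have {}gg0 : 0 < ips g g by rewrite lt_def gg0 ips_ge0.
set t := ips f g / ips g g.
have := ips_ge0 (fun x => f x - t * g x).
have Ltg : L2 (fun x => t * g x) by exact: L2Z.
rewrite ipsBl ?ipsBr ?ipsZl ?ipsZr//; try exact: L2B.
rewrite (ipsC g f) /t.
set a := ips f f; set b := ips f g; set c := ips g g in gg0 *.
rewrite divfK ?gt_eqF// mulrAC subrr subr0 subr_ge0.
by rewrite ler_pdivrMr// -expr2.
Qed.

Lemma cauchy_schwarz f g : L2 f -> L2 g -> `|ips f g| <= nrm f * nrm g.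
Proof.
move=> Lf Lg; rewrite -(ler_pXn2r (n := 2)) ?nnegrE ?mulr_ge0 ?nrm_ge0//.
by rewrite real_normK ?num_real// exprMn !nrm_sqr ips_sqr_le.
Qed.

Lemma nrmD f g : L2 f -> L2 g -> nrm (fun x => f x + g x) <= nrm f + nrm g.
Proof.
move=> Lf Lg; rewrite -(ler_pXn2r (n := 2)) ?nnegrE ?addr_ge0 ?nrm_ge0//.
rewrite nrm_sqr ipsDl ?ipsDr//; try exact: L2D.
rewrite (ipsC g f) sqrrD !nrm_sqr.
have := cauchy_schwarz Lf Lg; have := ler_norm (ips f g); lra.
Qed.

Lemma nrmZ a f : L2 f -> nrm (fun x => a * f x) = `|a| * nrm f.
Proof.
move=> Lf; rewrite /nrmL2 ipsZl// ?ipsZr//; last exact: L2Z.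
by rewrite mulrA -expr2 sqrtrM ?sqr_ge0// sqrtr_sqr.
Qed.

Lemma nrmN f : L2 f -> nrm (fun x => - f x) = nrm f.
Proof.
move=> Lf; have := nrmZ (-1) Lf.
by rewrite normrN1 mul1r; under eq_fun do rewrite mulN1r.
Qed.

Lemma nrmB f g : L2 f -> L2 g -> nrm (fun x => f x - g x) <= nrm f + nrm g.
Proof.
by move=> Lf Lg; rewrite -(nrmN Lg); apply: nrmD => //; exact: L2N.
Qed.

Lemma nrm_ae f g : L2 f -> L2 g ->
  {ae mu, forall x, Omega x -> f x = g x} -> nrm f = nrm g.
Proof.
move=> Lf Lg fg; rewrite /nrmL2 (ips_ae Lf Lg Lf fg) ipsC.
by rewrite (ips_ae Lf Lg Lg fg).
Qed.

Lemma le_nrm f g : L2 f -> L2 g ->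
  {ae mu, forall x, Omega x -> `|f x| <= `|g x|} -> nrm f <= nrm g.
Proof.
move=> Lf Lg fg; rewrite ler_sqrt ?ips_ge0//.
apply: le_Rintegral_ae; [exact: L2M_sint|exact: L2M_sint|].
move: fg; apply: filterS => x fg Ox; rewrite -!expr2.
rewrite -(real_normK (num_real (f x))) -(real_normK (num_real (g x))).
by rewrite lerXn2r// ?nnegrE// fg.
Qed.

(** Dominated convergence for [(f_n - f)^2], with majorant [4 g^2]. One good index is all that the
    density arguments ask for. *)
Lemma dominated_L2 (f_ : (E -> R)^nat) f g : (forall n, measurable_fun Omega (f_ n)) ->
  measurable_fun Omega f -> L2 g ->
  (forall x, Omega x -> f_ ^~ x @ \oo --> f x) ->
  (forall n x, Omega x -> `|f_ n x| <= `|g x|) ->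
  forall eps, 0 < eps -> exists n, nrm (fun x => f_ n x - f x) < eps.
Proof.
move=> mf_ mf /L2P[mg gi] cvg_f f_g eps eps0.
have fg x : Omega x -> `|f x| <= `|g x|.
  move=> Ox; have h : (fun n => `|f_ n x|) @ \oo --> `|f x|.
    by apply: cvg_norm; exact: cvg_f.
  rewrite -(cvg_lim _ h)//; apply: limr_le; first by apply/cvg_ex; exists `|f x|.
  by apply: nearW => n; exact: f_g.
have gi4 : sint (fun x => 4 * g x ^+ 2) by exact: (integrableZl mO 4 gi).
have [] := @dominated_convergence _ _ _ mu _ mO
  (fun n x => ((f_ n x - f x) ^+ 2)%:E) (cst 0%E) _ _ _ _ gi4.
- by move=> n; apply/measurable_EFinP; apply: measurable_funX; exact: measurable_funB.
- exact: measurable_cst.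
- apply: aeW => x Ox; apply: cvg_EFin; first exact: nearW.
  have h : (fun n => f_ n x - f x) @ \oo --> f x - f x.
    by apply: cvgB; [exact: cvg_f|exact: cvg_cst].
  have := @cvgM R _ \oo _ _ _ _ _ h h; rewrite subrr mulr0 => hh.
  by under eq_fun do rewrite expr2; exact: hh.
- apply: aeW => x n Ox; rewrite lee_fin ger0_norm ?sqr_ge0//.
  rewrite -(real_normK (num_real (f_ n x - f x))) -(real_normK (num_real (g x))).
  have := f_g n _ Ox; have := fg _ Ox; have := ler_normB (f_ n x) (f x).
  have := normr_ge0 (f_ n x - f x); set a := `|_ - _|; set b := `|f x|.
  by set c := `|f_ n x|; set e := `|g x|; nra.
move=> _ _; rewrite integral_cst// mul0e => /fine_cvgP[_].
move=> /cvgrPdist_lt /(_ (eps ^+ 2)) /(_ _)/wrap[]; first by rewrite exprn_gt0.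
move=> [n _ /(_ n (leqnn _))/=]; rewrite sub0r normrN => h; exists n.
rewrite -(ltr_pXn2r (n := 2)) ?nnegrE ?nrm_ge0 ?ltW// nrm_sqr.
apply: le_lt_trans h; apply: le_trans (ler_norm _).
rewrite le_eqVlt; apply/orP; left; apply/eqP; congr fine.
Qed.

Lemma sint_sum (I : Type) (s : seq I) (h : I -> E -> R) : (forall i, sint (h i)) ->
  sint (fun x => \sum_(i <- s) h i x).
Proof.
move=> hi; elim: s => [|i s IHs].
  by under eq_fun do rewrite big_nil; exact: integrable0.
by under eq_fun do rewrite big_cons; exact: (integrableD mO (hi i) IHs).
Qed.

Lemma Rintegral_sum (I : Type) (s : seq I) (h : I -> E -> R) : (forall i, sint (h i)) ->
  \int[mu]_(x in Omega) \sum_(i <- s) h i x =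
  \sum_(i <- s) \int[mu]_(x in Omega) h i x.
Proof.
move=> hi; elim: s => [|i s IHs].
  by rewrite big_nil; under eq_Rintegral do rewrite big_nil; rewrite Rintegral_cst// mul0r.
under eq_Rintegral do rewrite big_cons.
by rewrite big_cons (RintegralD mO (hi i) (sint_sum s hi)) IHs.
Qed.

End square_integrable.

(** * Rational boxes and Borel sets of R^d *)

Section rational_boxes.
Context {R : realType} {d : nat}.
Local Notation E := 'rV[R]_d.

Definition obox (c : 'rV[rat]_d * 'rV[rat]_d) : set E :=
  [set x | forall i, ratr (c.1 ord0 i) < x ord0 i < ratr (c.2 ord0 i)].

Definition cbox (c : 'rV[rat]_d * 'rV[rat]_d) : set E :=
  [set x | forall i, ratr (c.1 ord0 i) <= x ord0 i <= ratr (c.2 ord0 i)].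

(** The pairs of rational corners are countable, so they are listed through [pickle]; numbers that
    code no pair give the box [(0, 0)], a harmless repetition. *)
Definition nth_box (k : nat) : 'rV[rat]_d * 'rV[rat]_d :=
  odflt (0, 0) (unpickle k).

Lemma measurable_coordE (A : 'I_d -> set (measurableTypeR R)) :
  (forall i, measurable (A i)) -> measurable [set x : E | forall i, A i (x ord0 i)].
Proof.
move=> mA; rewrite (_ : [set _ | _] = \bigcap_(i in [set: 'I_d]) (rV_coor i @^-1` A i)).
  apply: fin_bigcap_measurable => // i _; rewrite -[X in measurable X]setTI.
  exact: measurable_rV_coor.
by apply/seteqP; split=> [x Ax i _|x Ax i]; exact: Ax.
Qed.

Lemma measurable_obox c : measurable (obox c).
Proof.
rewrite (_ : obox c =
    [set x | forall i, `]ratr (c.1 ord0 i), ratr (c.2 ord0 i)[%classic (x ord0 i)]).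
  apply: (measurable_coordE (A := fun i => `]ratr (c.1 ord0 i), ratr (c.2 ord0 i)[%classic)).
  by move=> i; exact: measurable_itv.
by apply/seteqP; split=> x /= h i; have := h i; rewrite in_itv.
Qed.

Lemma compact_cbox c : compact (cbox c).
Proof.
rewrite (_ : cbox c =
    [set x | forall i, `[ratr (c.1 ord0 i), ratr (c.2 ord0 i)]%classic (x ord0 i)]).
  have h i := @segment_compact R (ratr (c.1 ord0 i)) (ratr (c.2 ord0 i)).
  exact: rV_compact h.
by apply/seteqP; split=> x /= h i; have := h i; rewrite in_itv.
Qed.

Lemma open_rational_box (U : set E) x : open U -> U x ->
  exists k, obox (nth_box k) x /\ cbox (nth_box k) `<=` U.
Proof.
move=> oU Ux; have /nbhs_ballP[e/= e0 eU] : nbhs x U by exact: open_nbhs_nbhs.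
have lo i : exists q : rat, x ord0 i - e < ratr q < x ord0 i.
  have [|q] := @rat_in_itvoo R (x ord0 i - e) (x ord0 i); first by rewrite ltrBlDr ltrDl.
  by rewrite in_itv/= => qP; exists q.
have hi i : exists q : rat, x ord0 i < ratr q < x ord0 i + e.
  have [|q] := @rat_in_itvoo R (x ord0 i) (x ord0 i + e); first by rewrite ltrDl.
  by rewrite in_itv/= => qP; exists q.
have [a aP] := choice lo; have [b bP] := choice hi.
exists (pickle (\row_i a i, \row_i b i)); rewrite /nth_box pickleK/=; split.
  by move=> i /=; rewrite !mxE; have /andP[_ ->] := aP i; have /andP[-> _] := bP i.
move=> y /= yP; apply: eU; split=> // i j; rewrite ord1 /ball/= ltr_norml.
have := yP j; rewrite !mxE; have := aP j; have := bP j.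
by move=> /andP[? ?] /andP[? ?] /andP[? ?]; apply/andP; split; lra.
Qed.

Lemma open_bigcup_box (U : set E) : open U ->
  U = \bigcup_(k in [set k | cbox (nth_box k) `<=` U]) obox (nth_box k).
Proof.
move=> oU; apply/seteqP; split=> [x Ux|x [k /= kU kx]].
  by have [k [kx kU]] := open_rational_box oU Ux; exists k.
by apply: kU => i; have /andP[/ltW -> /ltW ->] := kx i.
Qed.

Lemma open_measurable_rV (U : set E) : open U -> measurable U.
Proof.
move=> /open_bigcup_box ->; apply: bigcup_measurable => k _.
exact: measurable_obox.
Qed.

Lemma continuous_measurable_rV (f : E -> R) : continuous f -> measurable_fun setT f.
Proof.
move=> /continuousP cf; apply: (measurability _ (RGenOpens.measurableE R)).
move=> _ [_ [a [b ->] <-]]; rewrite setTI; apply: open_measurable_rV.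
exact/cf/interval_open.
Qed.

(** The measurable sets are generated by the coordinates. That they are also generated by the open
    sets, thanks to the countable unions of rational boxes, lets a Dynkin argument start from open
    sets. *)
Lemma measurable_rV_open : @measurable _ E = <<s (@open E) >>.
Proof.
apply/seteqP; split; last first.
  apply: smallest_sub; first exact: sigma_algebra_measurable.
  exact: open_measurable_rV.
apply: smallest_sub; first exact: smallest_sigma_algebra.
rewrite -bigcup_seq; apply: bigcup_sub => i _ A [B mB <-] /=.
rewrite setTI.
suff : measurable_fun (setT : set (g_sigma_algebraType (@open E))) (rV_coor i).
  by move=> /(_ measurableT _ mB); rewrite setTI.
apply: (measurability _ (RGenOpens.measurableE R)).
move=> _ [_ [a [b ->] <-]]; rewrite setTI; apply: sub_sigma_algebra.
have /continuousP := @coord_continuous R 1 d ord0 i; apply.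
exact: interval_open.
Qed.

Lemma bounded_finite_measure (A : set E) : bounded_set A -> measurable A ->
  (lebesgue_rV R d A < +oo)%E.
Proof.
move=> [M [Mr MA]] mA; have {}MA := MA (M + 1).
have {MA} AM x : A x -> forall i, - (M + 1) <= x ord0 i <= M + 1.
  move=> Ax i; rewrite -ler_norml.
  have := MA _ x Ax; rewrite ltrDl ltr01 => /(_ isT).
  by apply: le_trans; rewrite [leRHS]/Num.norm/= mx_normrE; apply/bigmax_geP;
    right => /=; exists (ord0, i).
pose B (i : 'I_d) : set (measurableTypeR R) := `[- (M + 1), M + 1]%classic.
have mB i : measurable (B i) by exact: measurable_itv.
have H : (lebesgue_rV R d [set x | forall i, B i (x ord0 i)] \is a fin_num)%E.
  rewrite lebesgue_rV_box//; apply: prode_fin_num => i _.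
  by rewrite /B lebesgue_measure_itv/=; case: ifP.
move: H; rewrite ge0_fin_numE//; apply: le_lt_trans.
apply: le_measure; rewrite ?inE//.
exact: measurable_coordE.
Qed.

End rational_boxes.

(** * Smooth bump functions *)

Section smooth_functions.
Context {R : realType} {d : nat}.
Local Notation E := 'rV[R]_d.
Implicit Types (f g : E -> R).

Local Notation diff f x := (differentiable (f : E -> R^o) x).

(** Smoothness up to a finite order, in a form suited to induction: a derivative of a product or of
    an inverse is again built from sums and products, which the formulation by sequences of
    derivatives in [smooth] does not follow directly. *)
Fixpoint smoothn (n : nat) f : Prop :=
  (forall x, diff f x) /\
  if n is n'.+1 then forall i, smoothn n' (pd i f) else True.

Lemma smoothnP f : smooth f <-> forall n, smoothn n f.
Proof.
split=> [sf n|sf s].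
  elim: n f sf => [|n IHn] f sf; first by split=> // x; exact: (sf [::]).
  split=> [x|i]; first exact: (sf [::]).
  by apply: IHn => s x; have := sf (rcons s i) x; rewrite foldr_rcons.
have {sf} := sf (size s).
elim/last_ind: s f => [|s i IHs] f sf x; first exact: sf.1.
rewrite foldr_rcons; apply: IHs.
by move: sf; rewrite size_rcons => -[_]; exact.
Qed.

Lemma smoothnW n f : smoothn n.+1 f -> smoothn n f.
Proof.
elim: n f => [|n IHn] f [df pf]; split=> // i.
exact: IHn.
Qed.

Lemma pdD i f g : (forall x, diff f x) -> (forall x, diff g x) ->
  pd i (fun x => f x + g x) = fun x => pd i f x + pd i g x.
Proof.
by move=> df dg; apply/funext => x; apply: deriveD; exact: diff_derivable.
Qed.

Lemma pdM i f g : (forall x, diff f x) -> (forall x, diff g x) ->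
  pd i (fun x => f x * g x) = fun x => f x * pd i g x + g x * pd i f x.
Proof.
by move=> df dg; apply/funext => x; apply: deriveM; exact: diff_derivable.
Qed.

Lemma pd_cst i (c : R) : pd i (fun=> c) = (fun=> 0) :> (E -> R).
Proof. by apply/funext => x; exact: (derive_cst (c : R^o)). Qed.

Lemma pdV i f : (forall x, diff f x) -> (forall x, f x != 0) ->
  pd i (fun x => (f x)^-1) = fun x => - (pd i f x * ((f x)^-1 * (f x)^-1)).
Proof.
move=> df f0; apply/funext => x; rewrite /pd deriveV//; last exact: diff_derivable.
by rewrite /GRing.scale/= mulNr mulrC -exprVn expr2.
Qed.

Lemma smoothn_cst n c : smoothn n (fun=> c).
Proof.
elim: n c => [|n IHn] c; split=> //; try by move=> x; exact: differentiable_cst.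
by move=> i; rewrite pd_cst; exact: IHn.
Qed.

Lemma smoothnD n f g : smoothn n f -> smoothn n g -> smoothn n (fun x => f x + g x).
Proof.
elim: n f g => [|n IHn] f g [df pf] [dg pg]; split=> //;
  try by move=> x; exact: differentiableD.
by move=> i; rewrite pdD//; apply: IHn; [exact: pf|exact: pg].
Qed.

Lemma smoothnM n f g : smoothn n f -> smoothn n g -> smoothn n (fun x => f x * g x).
Proof.
elim: n f g => [|n IHn] f g sf sg; have [df pf] := sf; have [dg pg] := sg; split=> //;
  try by move=> x; exact: differentiableM.
move=> i; rewrite pdM//; have Wf := smoothnW sf; have Wg := smoothnW sg.
by apply: smoothnD; apply: IHn => //; [exact: pg|exact: pf].
Qed.

(** The derivative [- f' (1/f)^2] involves [1/f] itself, but only at the previous order, where the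
    induction hypothesis supplies it. *)
Lemma smoothnV n f : (forall x, f x != 0) -> smoothn n f -> smoothn n (fun x => (f x)^-1).
Proof.
move=> f0; elim: n => [|n IHn] sf; have [df pf] := sf; split=> //;
  try by move=> x; exact: differentiableV.
have sV : smoothn n (fun x => (f x)^-1) by apply: IHn; exact: smoothnW.
move=> i; rewrite pdV//.
rewrite (_ : (fun _ => _) = fun x => (-1) * (pd i f x * ((f x)^-1 * (f x)^-1))).
  apply: smoothnM; first exact: smoothn_cst.
  by apply: smoothnM; [exact: pf|exact: smoothnM].
by apply/funext => x; rewrite mulN1r.
Qed.

Lemma smooth_cst c : smooth ((fun=> c) : E -> R).
Proof. by apply/smoothnP => n; exact: smoothn_cst. Qed.

Lemma smoothD f g : smooth f -> smooth g -> smooth (fun x => f x + g x).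
Proof. by move=> /smoothnP sf /smoothnP sg; apply/smoothnP => n; exact: smoothnD. Qed.

Lemma smoothM f g : smooth f -> smooth g -> smooth (fun x => f x * g x).
Proof. by move=> /smoothnP sf /smoothnP sg; apply/smoothnP => n; exact: smoothnM. Qed.

Lemma smoothV f : (forall x, f x != 0) -> smooth f -> smooth (fun x => (f x)^-1).
Proof. by move=> f0 /smoothnP sf; apply/smoothnP => n; exact: smoothnV. Qed.

Lemma smooth_sum (I : Type) (s : seq I) (P : pred I) (f : I -> E -> R) :
  (forall i, P i -> smooth (f i)) -> smooth (fun x => \sum_(i <- s | P i) f i x).
Proof.
move=> sf; elim: s => [|i s IHs].
  by under eq_fun do rewrite big_nil; exact: smooth_cst.
case Pi : (P i); last by under eq_fun do rewrite big_cons Pi.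
by under eq_fun do rewrite big_cons Pi; apply: smoothD => //; exact: sf.
Qed.

Lemma smooth_prod (I : Type) (s : seq I) (f : I -> E -> R) :
  (forall i, smooth (f i)) -> smooth (fun x => \prod_(i <- s) f i x).
Proof.
move=> sf; elim: s => [|i s IHs].
  by under eq_fun do rewrite big_nil; exact: smooth_cst.
by under eq_fun do rewrite big_cons; exact: smoothM.
Qed.

Lemma smooth_diff f x : smooth f -> diff f x.
Proof. by move=> /(_ [::]); exact. Qed.

Lemma smooth_pd i f : smooth f -> smooth (pd i f).
Proof. by move=> sf s x; have := sf (rcons s i) x; rewrite foldr_rcons. Qed.

Lemma smooth_continuous f : smooth f -> continuous f.
Proof. by move=> sf x; apply: differentiable_continuous; exact: smooth_diff. Qed.

End smooth_functions.

(** * Functions on the line that vanish to all orders at 0 *)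

Section flat_function.
Context {R : realType}.
Implicit Types (m : nat) (s : R).

(* The factors [s^-1 ^+ m] make the family closed under differentiation, up to
   linear combinations. *)
Definition flat m s : R := if 0 < s then s^-1 ^+ m * expR (- s^-1) else 0.

Lemma flat_ge0 m s : 0 <= flat m s.
Proof.
rewrite /flat; case: ifPn => // s0; rewrite mulr_ge0 ?expR_ge0//.
by rewrite exprn_ge0// invr_ge0 ltW.
Qed.

Lemma flat_gt0 m s : (0 < flat m s) = (0 < s).
Proof.
rewrite /flat; case: ifPn => [s0|_]; last by rewrite ltxx.
by rewrite mulr_gt0 ?expR_gt0 ?exprn_gt0 ?invr_gt0.
Qed.

(** One term of the exponential series suffices: [exp(1/s) >= (1/s)^(m+2) / (m+2)!]. The two spare
    powers of [s] make the derivative at 0 vanish. *)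
Lemma flat_le m s : flat m s <= (m.+2)`!%:R * s ^+ 2.
Proof.
rewrite /flat; case: ifPn => [s0|_]; last by rewrite mulr_ge0 ?sqr_ge0.
have sV0 : 0 < s^-1 by rewrite invr_gt0.
rewrite expRN ler_pdivrMr ?expR_gt0//.
have := expR_ge1Dxn m.+1 (ltW sV0) => h.
have {}h : s^-1 ^+ m.+2 <= (m.+2)`!%:R * expR s^-1.
  rewrite mulrC -ler_pdivrMr ?ltr0n ?fact_gt0//.
  by apply: le_trans h; rewrite lerDr.
have -> : s^-1 ^+ m = s ^+ 2 * s^-1 ^+ m.+2.
  by rewrite -[m.+2]addn2 exprD mulrCA -exprMn divff ?gt_eqF// expr1n mulr1.
by rewrite [leRHS]mulrAC [leRHS]mulrC ler_wpM2l ?sqr_ge0.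
Qed.

Lemma is_derive_flat_gt0 m s : 0 < s ->
  is_derive s 1 (fun y : R => y^-1 ^+ m * expR (- y^-1) : R^o)
    (s^-1 ^+ m.+2 * expR (- s^-1) - m%:R * (s^-1 ^+ m.+1 * expR (- s^-1))).
Proof.
move=> s0; have sn0 : s != 0 by rewrite gt_eqF.
have dV : is_derive s 1 (fun y : R => y^-1 : R^o) (- s^-1 ^+ 2).
  apply: DeriveDef; first exact: derivableV.
  by rewrite (@deriveV R R id)// derive_id /GRing.scale/= mulr1 exprVn.
have dN : is_derive s 1 (fun y : R => - y^-1 : R^o) (s^-1 ^+ 2).
  by rewrite -[X in is_derive _ _ _ X]opprK; exact: is_deriveN.
have dE : is_derive s 1 (fun y : R => expR (- y^-1) : R^o) (expR (- s^-1) * s^-1 ^+ 2).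
  exact: (@is_derive1_comp R expR (fun y => - y^-1)).
have dX := @is_deriveX _ _ (fun y : R => y^-1) m s 1 _ dV.
have := is_deriveM dX dE; rewrite exprfctE => H.
apply: (is_derive_eq H); rewrite /GRing.scale/=; case: m {dX H} => [|m]; first by rewrite /=; ring.
by rewrite /= !exprS; ring.
Qed.

(** Away from 0 the function is locally given by a single formula. At 0 the quadratic bound makes
    the difference quotient at most [(m+2)! |h|]. *)
Lemma is_derive_flat m s :
  is_derive s 1 (flat m : R -> R^o) (flat m.+2 s - m%:R * flat m.+1 s).
Proof.
have [s0|s0|->] := ltgtP s 0.
- rewrite {2 3}/flat ltNge (ltW s0)/= mulr0 subr0.
  apply: near_eq_is_derive (is_derive_cst (0 : R^o) s 1).
  near=> y; rewrite /flat/= ifF//; apply/negbTE; rewrite -leNgt ltW//.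
  by near: y; exact: lt_nbhsl.
- rewrite {2 3}/flat s0; apply: near_eq_is_derive (is_derive_flat_gt0 m s0).
  by near=> y; rewrite /flat ifT//; near: y; exact: lt_nbhsr.
- rewrite {2 3}/flat ltxx mulr0 subr0.
  have lim0 : (fun h : R => h^-1 *: ((flat m \o shift 0) (h *: 1) - flat m 0 : R^o))
      @ 0^' --> (0 : R^o).
    apply/cvgr0Pnorm_le => e e0; near=> h.
    have h0 : h != 0 by near: h; exact: nbhs_dnbhs_neq.
    rewrite /= addr0 {2}/flat ltxx subr0 /GRing.scale/= mulr1 normrM normfV.
    rewrite mulrC ler_pdivrMr ?normr_gt0// ger0_norm ?flat_ge0//.
    apply: le_trans (flat_le _ _) _; rewrite -(real_normK (num_real h)) expr2 mulrA.
    rewrite ler_wpM2r//.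
    rewrite mulrC -ler_pdivlMr ?ltr0n ?fact_gt0//.
    near: h; apply: dnbhs0_le; rewrite divr_gt0// ltr0n fact_gt0.
  apply: DeriveDef; first by apply/cvg_ex; exists 0.
  exact: cvg_lim lim0.
Unshelve. all: by end_near. Qed.

End flat_function.

Section bump_functions.
Context {R : realType} {d : nat}.
Local Notation E := 'rV[R]_d.
Implicit Types (f g : E -> R).

(** Since [l] has constant partial derivatives, the chain rule turns [flat m (l x)] into a linear
    combination of [flat m.+2 (l x)] and [flat m.+1 (l x)]; the induction on the order of smoothness
    therefore holds for all [m] at once. *)
Lemma smooth_flat_comp (l : E -> R) (c : 'I_d -> R) m :
  (forall x, differentiable (l : E -> R^o) x) ->
  (forall i x, pd i l x = c i) -> smooth (fun x => flat m (l x)).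
Proof.
move=> dl pdl; have dfl k x : differentiable (fun y => flat k (l y) : R^o) x.
  apply: (@differentiable_comp _ _ _ _ (l : E -> R^o) (flat k : R^o -> R^o)) => //.
  by apply/derivable1_diffP; case: (is_derive_flat k (l x)).
apply/smoothnP => n; elim: n m => [|n IHn] m; split=> // i.
have -> : pd i (fun x => flat m (l x)) =
    fun x => c i * (flat m.+2 (l x) + - m%:R * flat m.+1 (l x)).
  apply/funext => x; rewrite /pd deriveE; last exact: dfl.
  have dF : differentiable (flat m : R^o -> R^o) (l x).
    by apply/derivable1_diffP; case: (is_derive_flat m (l x)).
  rewrite (@diff_comp _ _ _ _ (l : E -> R^o) (flat m : R^o -> R^o))//=.
  rewrite (_ : 'd (l : E -> R^o) x (delta_mx ord0 i) = c i); last first.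
    by rewrite -deriveE//; exact: pdl.
  rewrite diff1E// derive1E; have [_ ->] := is_derive_flat m (l x).
  by rewrite mulNr.
apply: smoothnM; first exact: smoothn_cst.
by apply: smoothnD => //; apply: smoothnM => //; exact: smoothn_cst.
Qed.

Definition bump (c : 'rV[rat]_d * 'rV[rat]_d) (x : E) : R :=
  \prod_(i < d) (flat 0 (x ord0 i - ratr (c.1 ord0 i)) *
                 flat 0 (ratr (c.2 ord0 i) - x ord0 i)).

Lemma pd_coord j i x : pd j (fun y : E => y ord0 i) x = (j == i)%:R.
Proof.
rewrite /pd deriveE; last exact: differentiable_coord.
have @f : {linear E -> R^o}.
  by exists (fun y : E => y ord0 i : R^o); do 2![eexists]; do ?[constructor];
     rewrite ?mxE// => ? *; rewrite ?mxE//; move=> ?; rewrite !mxE.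
rewrite (_ : (fun _ => _) = f)// diff_lin; last exact: coord_continuous.
by rewrite /= mxE eqxx eq_sym.
Qed.

Lemma bump_smooth c : smooth (bump c).
Proof.
have dX i x : differentiable (fun y : E => y ord0 i : R^o) x.
  exact: differentiable_coord.
have dC (a : R) x : differentiable ((fun=> a) : E -> R^o) x.
  exact: differentiable_cst.
have dN i x : differentiable (fun y : E => (-1) * y ord0 i : R^o) x.
  exact: differentiableM.
apply: smooth_prod => i; apply: smoothM.
  apply: (@smooth_flat_comp _ (fun j => (j == i)%:R)) => [x|j x].
    exact: differentiableB.
  by rewrite pdD// pd_cst addr0 pd_coord.
apply: (@smooth_flat_comp _ (fun j => - (j == i)%:R)) => [x|j x].
  exact: differentiableB.
rewrite (_ : (fun _ => _) = fun y : E => ratr (c.2 ord0 i) + (-1) * y ord0 i); last first.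
  by apply/funext => y; rewrite mulN1r.
by move: (ratr _) => q; rewrite pdD// pdM// !pd_cst mulr0 addr0 add0r pd_coord mulN1r.
Qed.

Lemma bump_ge0 c x : 0 <= bump c x.
Proof. by apply: prodr_ge0 => i _; rewrite mulr_ge0 ?flat_ge0. Qed.

Lemma bump_gt0 c x : obox c x -> 0 < bump c x.
Proof.
move=> cx; apply: prodr_gt0 => i _; have /andP[l r] := cx i.
by rewrite mulr_gt0// flat_gt0 subr_gt0.
Qed.

Lemma bump_eq0 c x : ~ cbox c x -> bump c x = 0.
Proof.
move=> /existsNP[i /negP]; rewrite negb_and -!ltNge => h.
apply/eqP; rewrite prodf_seq_eq0; apply/hasP; exists i; rewrite ?mem_index_enum//=.
rewrite mulf_eq0; case/orP: h => h; apply/orP; [left|right];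
  by rewrite /flat ifF//; apply/negbTE; rewrite -leNgt subr_le0 ltW.
Qed.

Variable Omega : set E.

Lemma test_funP phi K : smooth phi -> compact K -> K `<=` Omega ->
  (forall x, ~ K x -> phi x = 0) -> test_fun Omega phi.
Proof.
move=> sphi cK KO phi0.
have sK : closure [set x | phi x != 0] `<=` K.
  have clK : closed K by apply: compact_closed => //; exact: norm_hausdorff.
  rewrite ((closure_id K).1 clK); apply: closureS => x /= /eqP.
  by apply: contra_notP => /phi0.
split=> //; first by apply: subclosed_compact sK => //; exact: closed_closure.
exact: subset_trans KO.
Qed.

Lemma test_fun_support phi psi : test_fun Omega phi -> smooth psi ->
  (forall x, phi x = 0 -> psi x = 0) -> test_fun Omega psi.
Proof.
move=> [_ cphi phiO] spsi h; apply: test_funP spsi cphi phiO _ => x nx.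
by apply: h; apply/eqP/negPn/negP => phix; apply: nx; exact: subset_closure.
Qed.

Lemma test_smooth phi : test_fun Omega phi -> smooth phi. Proof. by case. Qed.

Lemma test_fun0 : test_fun Omega (fun=> 0).
Proof.
apply: (@test_funP _ set0) => //; [exact: smooth_cst|exact: compact0].
Qed.

Lemma test_funZ a phi : test_fun Omega phi -> test_fun Omega (fun x => a * phi x).
Proof.
move=> tphi; apply: (test_fun_support tphi).
  by apply: smoothM; [exact: smooth_cst|exact: test_smooth].
by move=> x ->; rewrite mulr0.
Qed.

Lemma test_fun_pd i phi : test_fun Omega phi -> test_fun Omega (pd i phi).
Proof.
move=> tphi; have [sphi cphi phiO] := tphi.
apply: test_funP (smooth_pd i sphi) cphi phiO _ => x nx.
(* The complement of the support is open, so [phi] vanishes near each of its points and so do its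
   derivatives there. *)
have oS : open (~` closure [set x | phi x != 0]) by apply: closed_openC; exact: closed_closure.
have phi0 : \forall y \near x, phi y = 0.
  have : nbhs x (~` closure [set x | phi x != 0]) by exact: open_nbhs_nbhs.
  apply: filterS => y ny; apply/eqP/negPn/negP => phiy; apply: ny.
  exact: subset_closure.
transitivity (pd i ((fun=> 0) : E -> R) x); last by rewrite pd_cst.
exact: near_eq_derive phi0.
Qed.

Lemma test_funD phi psi : test_fun Omega phi -> test_fun Omega psi ->
  test_fun Omega (fun x => phi x + psi x).
Proof.
move=> [sphi cphi phiO] [spsi cpsi psiO].
apply: (@test_funP _ (closure [set x | phi x != 0] `|` closure [set x | psi x != 0])).
- exact: smoothD.
- exact: compactU.
- by move=> x [/phiO|/psiO].
- move=> x /not_orP[nphi npsi].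
  have -> : phi x = 0 by apply/eqP/negPn/negP => h; apply: nphi; exact: subset_closure.
  have -> : psi x = 0 by apply/eqP/negPn/negP => h; apply: npsi; exact: subset_closure.
  by rewrite addr0.
Qed.

Definition bump_sum (U : set E) (n : nat) (x : E) : R :=
  \sum_(k < n | `[< cbox (nth_box k) `<=` U >]) bump (nth_box k) x.

(* A sequence of test functions in [0, 1] that increases to the indicator of an
   open set [U]. *)
Definition bump_approx (U : set E) (n : nat) (x : E) : R :=
  n%:R * bump_sum U n x * (1 + n%:R * bump_sum U n x)^-1.

Lemma bump_sum_ge0 U n x : 0 <= bump_sum U n x.
Proof. by apply: sumr_ge0 => k _; exact: bump_ge0. Qed.

Lemma bump_den_gt0 U n x : 0 < 1 + n%:R * bump_sum U n x.
Proof. by rewrite ltr_pwDl// mulr_ge0 ?bump_sum_ge0. Qed.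

Lemma bump_approx_test U n : U `<=` Omega -> test_fun Omega (bump_approx U n).
Proof.
move=> UO; have sS : smooth (bump_sum U n).
  by apply: smooth_sum => k _; exact: bump_smooth.
have sN : smooth (fun x => n%:R * bump_sum U n x).
  by apply: smoothM => //; exact: smooth_cst.
pose F k : set E := if `[< cbox (nth_box k) `<=` U >] then cbox (nth_box k) else set0.
apply: (@test_funP _ (\bigcup_(k < n) F k)).
- apply: smoothM => //; apply: smoothV; first by move=> x; rewrite gt_eqF ?bump_den_gt0.
  by apply: smoothD => //; exact: smooth_cst.
- rewrite bigcup_mkord; apply: big_ind => [|A B|k _]; [exact: compact0|exact: compactU|].
  by rewrite /F; case: ifP => _; [exact: compact_cbox|exact: compact0].
- by move=> x [k _]; rewrite /F; case: ifPn => // /asboolP kU /kU /UO.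
- move=> x nx; rewrite /bump_approx /bump_sum big1 ?mulr0 ?mul0r// => k kU.
  apply: bump_eq0 => kx; apply: nx; exists k; first exact: (ltn_ord k).
  by rewrite /F kU.
Qed.

Lemma bump_approx_bound U n x : `|bump_approx U n x| <= 1.
Proof.
have h := bump_den_gt0 U n x.
rewrite ger0_norm; first by rewrite ler_pdivrMr// mul1r lerDr.
by rewrite mulr_ge0// ?invr_ge0 ?mulr_ge0 ?bump_sum_ge0// ltW.
Qed.

(** At a point of [U] some bump has a value [t > 0] and belongs to every sum of large enough index.
    The distance to 1 is [1 / (1 + n S)] with [S >= t], hence at most [1 / (n t)]; the factor [n] in
    the construction is there for this. Outside [U] every bump of the sum vanishes. *)
Lemma bump_approx_cvg U x : open U -> bump_approx U ^~ x @ \oo --> (\1_U x : R).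
Proof.
move=> oU; have [Ux|nUx] := pselect (U x); last first.
  rewrite indicE memNset//= (_ : bump_approx U ^~ x = fun=> 0); first exact: cvg_cst.
  apply/funext => n; rewrite /bump_approx /bump_sum big1 ?mulr0 ?mul0r//.
  by move=> k /asboolP kU; apply: bump_eq0 => /kU.
rewrite indicE mem_set//=; have [k [kx kU]] := open_rational_box oU Ux.
set t := bump (nth_box k) x; have t0 : 0 < t by exact: bump_gt0.
apply/cvgrPdist_le => e e0.
near=> n.
have tS : t <= bump_sum U n x.
  have kn : (k < n)%N by near: n; exact: nbhs_infty_gt.
  rewrite /bump_sum (bigD1 (Ordinal kn))/=; last exact/asboolP.
  by rewrite lerDl sumr_ge0// => i _; exact: bump_ge0.
have -> : 1 - bump_approx U n x = (1 + n%:R * bump_sum U n x)^-1.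
  have := bump_den_gt0 U n x; rewrite /bump_approx => h; field.
  by rewrite gt_eqF.
rewrite ger0_norm ?invr_ge0 ?(ltW (bump_den_gt0 _ _ _))//.
rewrite -[e]invrK lef_pV2 ?posrE ?invr_gt0 ?bump_den_gt0//.
apply: (@le_trans _ _ (n%:R * t)).
  rewrite -ler_pdivrMr//; near: n; exact: nbhs_infty_ger.
by rewrite (le_trans (ler_wpM2l _ tS))// lerDr.
Unshelve. all: by end_near. Qed.

End bump_functions.

(** * Density of test functions in L^2 *)

Section density.
Context {R : realType} {d : nat}.
Variable Omega : set 'rV[R]_d.
Hypothesis oO : open Omega.
Hypothesis fO : (lebesgue_rV R d Omega < +oo)%E.

Local Notation E := 'rV[R]_d.
Local Notation mu := (lebesgue_rV R d).
Local Notation L2 := (L2 Omega).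
Local Notation ips := (ips Omega).
Local Notation nrm := (nrmL2 Omega).
Let mO : measurable Omega := open_measurable_rV oO.
Implicit Types f g : E -> R.

Lemma L2_cst c : L2 (fun=> c).
Proof.
apply/(L2P mO); split; first exact: measurable_cst.
apply/integrableP; split; first exact: measurable_cst.
by rewrite integral_cst// lte_mul_pinfty.
Qed.

Lemma bounded_L2 f K : measurable_fun Omega f ->
  (forall x, Omega x -> `|f x| <= K) -> L2 f.
Proof.
move=> mf fK; apply: (le_L2 mO mf (L2_cst K)) => x Ox.
exact: le_trans (fK x Ox) (ler_norm _).
Qed.

Lemma test_measurable phi : test_fun Omega phi -> measurable_fun Omega phi.
Proof.
move=> /test_smooth /smooth_continuous /continuous_measurable_rV.
exact: measurable_funTS.
Qed.

Lemma test_bounded phi : test_fun Omega phi -> exists K, forall x, `|phi x| <= K.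
Proof.
move=> [sphi cphi _].
have := continuous_compact (continuous_subspaceT (smooth_continuous sphi)) cphi.
move=> /compact_bounded [M [_ /(_ (M + 1))]]; rewrite ltrDl ltr01 => /(_ isT) h.
exists (Num.max 0 (M + 1)) => x; rewrite le_max; apply/orP.
have [->|phix] := eqVneq (phi x) 0; first by left; rewrite normr0.
by right; apply: h; exists x => //; exact: subset_closure.
Qed.

Lemma test_L2 phi : test_fun Omega phi -> L2 phi.
Proof.
move=> tphi; have [K phiK] := test_bounded tphi.
by apply: (bounded_L2 (test_measurable tphi)) => x _.
Qed.

(** The L^2 closure of the test functions. It is enlarged in turn to indicators of open sets,
    indicators of measurable sets, simple functions, and finally all of L^2. *)
Definition test_approx f := L2 f /\
  forall eps, 0 < eps -> exists2 phi, test_fun Omega phi & nrm (fun x => f x - phi x) < eps.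

Lemma test_approx_lim f : L2 f ->
  (forall eps, 0 < eps -> exists2 g, test_approx g & nrm (fun x => f x - g x) < eps) ->
  test_approx f.
Proof.
move=> Lf H; split=> // eps eps0; have e20 : 0 < eps / 2 by rewrite divr_gt0.
have [g [Lg /(_ _ e20)[phi tphi gphi]] fg] := H _ e20.
exists phi => //; have Lphi := test_L2 tphi.
rewrite (_ : (fun _ => _) = fun x => (f x - g x) + (g x - phi x)); last first.
  by apply/funext => x; rewrite addrA subrK.
apply: le_lt_trans (nrmD mO (L2B mO Lf Lg) (L2B mO Lg Lphi)) _.
by rewrite [eps]splitr ltrD.
Qed.

Lemma test_approxD f g : test_approx f -> test_approx g ->
  test_approx (fun x => f x + g x).
Proof.
move=> [Lf Hf] [Lg Hg]; split; first exact: L2D.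
move=> eps eps0; have e20 : 0 < eps / 2 by rewrite divr_gt0.
have [phi tphi fphi] := Hf _ e20; have [psi tpsi gpsi] := Hg _ e20.
exists (fun x => phi x + psi x); first exact: test_funD.
rewrite (_ : (fun _ => _) = fun x => (f x - phi x) + (g x - psi x)); last first.
  by apply/funext => x; ring.
apply: le_lt_trans (nrmD mO (L2B mO Lf (test_L2 tphi)) (L2B mO Lg (test_L2 tpsi))) _.
by rewrite [eps]splitr ltrD.
Qed.

Lemma test_approxZ a f : test_approx f -> test_approx (fun x => a * f x).
Proof.
move=> [Lf Hf]; split; first exact: L2Z.
move=> eps eps0; have e0 : 0 < eps / (`|a| + 1) by rewrite divr_gt0// ltr_wpDl.
have [phi tphi fphi] := Hf _ e0; exists (fun x => a * phi x); first exact: test_funZ.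
rewrite (_ : (fun _ => _) = fun x => a * (f x - phi x)); last first.
  by apply/funext => x; ring.
rewrite nrmZ//; last by apply: L2B => //; exact: test_L2.
move: fphi; rewrite ltr_pdivlMr ?ltr_wpDl// => fphi; apply: le_lt_trans fphi.
by rewrite mulrC ler_wpM2l ?nrm_ge0// lerDl.
Qed.

Lemma test_approx0 : test_approx (fun=> 0).
Proof.
split; first exact: L2_cst.
move=> eps eps0; exists (fun=> 0); first exact: test_fun0.
rewrite (_ : (fun _ => _) = fun=> 0); last by apply/funext => x; rewrite subrr.
by rewrite /nrmL2 ips0l// sqrtr0.
Qed.

Lemma test_approx_sum n (f : 'I_n -> E -> R) : (forall i, test_approx (f i)) ->
  test_approx (fun x => \sum_(i < n) f i x).
Proof.
elim: n f => [|n IHn] f Hf.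
  by under eq_fun do rewrite big_ord0; exact: test_approx0.
under eq_fun do rewrite big_ord_recl; apply: test_approxD => //.
exact: IHn.
Qed.

Lemma measurable_indic_L2 A : measurable A -> L2 (\1_A : E -> R).
Proof.
move=> mA; apply: (@bounded_L2 _ 1) => [|x _]; first exact: measurable_indic.
by rewrite indicE; case: (_ \in _); rewrite ?normr1 ?normr0.
Qed.

Lemma test_approx_open U : open U -> test_approx (\1_U : E -> R).
Proof.
move=> oU; have mU := open_measurable_rV oU.
split; first exact: measurable_indic_L2.
move=> eps eps0; have oUO : open (U `&` Omega) by exact: openI.
have UO : U `&` Omega `<=` Omega by move=> ? [].
have [] := @dominated_L2 R d Omega mO (bump_approx (U `&` Omega)) (\1_U) (fun=> 1) _ _ (L2_cst 1) _ _ eps eps0.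
- by move=> n; apply: test_measurable; exact: bump_approx_test.
- exact: measurable_indic.
- move=> x Ox; rewrite (_ : \1_U x = \1_(U `&` Omega) x); first exact: bump_approx_cvg.
  by rewrite !indicE in_setI (mem_set Ox) andbT.
- by move=> n x _; rewrite normr1 bump_approx_bound.
move=> n nP; have tn := bump_approx_test n UO.
exists (bump_approx (U `&` Omega) n) => //.
rewrite -nrmN//; last by apply: L2B; [exact: mO|exact: measurable_indic_L2|exact: test_L2].
by under eq_fun do rewrite opprB.
Qed.

(** Dynkin induction from the pi-system of open sets. For a disjoint union the indicators of the
    partial unions are finite sums of approximable ones, and they converge in L^2 because [Omega]
    has finite measure. *)
Lemma test_approx_indic A : measurable A -> test_approx (\1_A : E -> R).
Proof.
rewrite measurable_rV_open; move: A.
apply: (dynkin_induction (G := @open E)).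
- exact: measurable_rV_open.
- by move=> A B; exact: openI.
- by apply: test_approx_open; exact: openT.
- by move=> A; exact: test_approx_open.
- move=> A mA HA; rewrite (_ : \1_(~` A) = fun x => 1 + (-1) * \1_A x).
    apply: test_approxD; last exact: test_approxZ.
    have := test_approx_open openT; rewrite indicT.
    exact.
  apply/funext => x; rewrite !indicE in_setC; case: (_ \in _) => /=; ring.
- move=> F mF tF HF; apply: test_approx_lim.
    by apply: measurable_indic_L2; exact: bigcup_measurable.
  move=> eps eps0.
  have mS n : measurable (\big[setU/set0]_(i < n) F i) by apply: bigsetU_measurable.
  have [] := @dominated_L2 R d Omega mO (fun n => \1_(\big[setU/set0]_(i < n) F i)) (\1_(\bigcup_k F k)) (fun=> 1) _ _ (L2_cst 1) _ _ eps eps0.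
  + by move=> n; exact: measurable_indic.
  + by apply: measurable_indic; exact: bigcup_measurable.
  + move=> x Ox; have [[k _ Fkx]|nF] := pselect ((\bigcup_k F k) x).
      apply: cvg_near_cst; exists k.+1 => // n /= kn.
      rewrite !indicE !mem_set//; first by exists k.
      by rewrite -bigcup_mkord; exists k.
    rewrite indicE memNset//; apply: cvg_near_cst; apply: nearW => n.
    by rewrite indicE memNset// => xF; apply: nF; exact: bigsetU_bigcup xF.
  + by move=> n x _; rewrite normr1 indicE; case: (_ \in _); rewrite ?normr1 ?normr0.
  move=> n nP; exists (\1_(\big[setU/set0]_(i < n) F i)).
    elim: n {nP} => [|n IHn]; first by rewrite big_ord0 indic0; exact: test_approx0.
    rewrite (_ : \1_ _ = fun x => \1_(\big[setU/set0]_(i < n) F i) x + \1_(F n) x).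
      exact: test_approxD.
    apply/funext => x; rewrite big_ord_recr/= !indicE in_setU.
    case: (boolP (x \in F n)) => [/set_mem xFn|_]; last by rewrite orbF addr0.
    rewrite orbT memNset ?add0r// -bigcup_mkord => -[k /= kn xFk].
    have := (trivIsetP.1 tF) k n I I; rewrite ltn_eqF// => /(_ isT) h.
    by have : set0 x by rewrite -h; split.
  rewrite -nrmN//; last first.
    by apply: L2B; [exact: mO| |]; apply: measurable_indic_L2 => //; exact: bigcup_measurable.
  by under eq_fun do rewrite opprB.
Qed.

Import HBSimple HBNNSimple.

(** The simple functions that increase to [f] are dominated by [f] itself, so they converge to it in
    L^2. *)
Lemma test_approx_nonneg f : L2 f -> (forall x, Omega x -> 0 <= f x) -> test_approx f.
Proof.
move=> Lf f0; have mf := L2_measurable mO Lf.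
have mEf : measurable_fun Omega (EFin \o f) by exact/measurable_EFinP.
have f0' x : Omega x -> (0 <= (EFin \o f) x)%E by move=> /f0; rewrite lee_fin.
pose g n := nnsfun_approx mO mEf n.
apply: test_approx_lim => // eps eps0.
have Lg n : test_approx (g n : E -> R).
  rewrite (funext (fimfunEord (g n))); apply: test_approx_sum => i.
  by apply: test_approxZ; exact: test_approx_indic.
have [] := @dominated_L2 R d Omega mO (fun n => g n : E -> R) f f _ mf Lf _ _ eps eps0.
- by move=> n; exact: measurable_funTS.
- move=> x Ox; have := cvg_nnsfun_approx mO mEf f0' Ox.
  by move=> /fine_cvgP[].
- move=> n x Ox; rewrite !ger0_norm ?f0//.
  by rewrite -lee_fin /g nnsfun_approxE; apply: (le_approx _ f0').
move=> n nP; exists (g n) => //.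
rewrite -nrmN//; last by apply: L2B => //; exact: (Lg n).1.
by under eq_fun do rewrite opprB.
Qed.

Lemma test_dense f : L2 f -> forall eps, 0 < eps ->
  exists2 phi, test_fun Omega phi & nrm (fun x => f x - phi x) < eps.
Proof.
move=> Lf; have mf := L2_measurable mO Lf.
suff [] : test_approx f by [].
rewrite (_ : f = fun x => Num.max (f x) 0 + (-1) * Num.max (- f x) 0).
  apply: test_approxD; last apply: test_approxZ; apply: test_approx_nonneg.
  - apply: (le_L2 mO _ Lf) => [|x Ox]; first exact: measurable_maxr.
    by rewrite maxEle; case: ifP => _; rewrite ?normr0.
  - by move=> x _; rewrite le_max lexx orbT.
  - apply: (le_L2 mO _ Lf) => [|x Ox].
      by apply: measurable_maxr => //; exact: measurable_funN.
    by rewrite maxEle; case: ifP => _; rewrite ?normr0 ?normrN.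
  - by move=> x _; rewrite le_max lexx orbT.
apply/funext => x; rewrite !maxEle oppr_le0; case: (leP (f x) 0) => h; case: leP => h'; lra.
Qed.

(** If [f] had positive norm, some test function would lie closer to it than [|f|], and
    [(f, f) = (f, f - phi) < |f|^2] would follow. All uniqueness statements for weak derivatives and
    divergences reduce to this. *)
Lemma test_orthogonal_ae f : L2 f -> (forall phi, test_fun Omega phi -> ips f phi = 0) ->
  {ae mu, forall x, Omega x -> f x = 0}.
Proof.
move=> Lf f0; apply: (ips0_ae mO) => //; apply/eqP; apply: contraT => nf.
have {}nf : 0 < nrm f by rewrite sqrtr_gt0 lt_def nf ips_ge0.
have [phi tphi fphi] := test_dense Lf nf.
have Lphi := test_L2 tphi.
have : ips f f = ips f (fun x => f x - phi x).
  by rewrite ipsBr// (f0 _ tphi) subr0.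
rewrite -nrm_sqr => h.
have := le_trans (ler_norm _) (cauchy_schwarz mO Lf (L2B mO Lf Lphi)).
rewrite -h expr2 ler_pM2l// leNgt.
by rewrite fphi.
Qed.

End density.

(** * Weak derivatives *)

Section integral_partial_derivative.
Context {R : realType}.

(** A directional derivative sees only the restriction to a line. This transfers derivatives between
    R^(n+1) and its slices, which live in different spaces. *)
Lemma derive_congr (V V' W : normedModType R) (f : V -> W) (g : V' -> W) a b v w :
  (forall h : R, f (h *: v + a) = g (h *: w + b)) ->
  'D_v f a = 'D_w g b /\ (derivable f a v -> derivable g b w).
Proof.
move=> fg; have fab : f a = g b by have := fg 0; rewrite !scale0r !add0r.
have E : (fun h : R => h^-1 *: ((f \o shift a) (h *: v) - f a)) =
         (fun h => h^-1 *: ((g \o shift b) (h *: w) - g b)).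
  by apply/funext => h /=; rewrite fg fab.
by rewrite /derive /derivable E.
Qed.

Definition cube n (K : R) : set 'rV[R]_n := [set x | forall i, `|x ord0 i| <= K].

Lemma rV_cons_continuous n (s : R) : continuous (fun y : 'rV[R]_n => rV_cons (s, y)).
Proof.
move=> y A /nbhs_ballP[e/= e0 eA].
have /filterS : nbhs y (ball y e) by exact: nbhsx_ballx.
apply=> z [_ yz]; apply: eA; split=> // i j; rewrite ord1.
case: (unliftP ord0 j) => [k|] ->; first by rewrite !rV_consS /=; exact: yz.
by rewrite !rV_cons0/=; exact: ballxx.
Qed.

Lemma rV_cons_continuousl n (y : 'rV[R]_n) : continuous (fun s : R => rV_cons (s, y)).
Proof.
move=> s A /nbhs_ballP[e/= e0 eA].
have /filterS : nbhs s (ball s e) by exact: nbhsx_ballx.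
apply=> z sz; apply: eA; split=> // i j; rewrite ord1.
case: (unliftP ord0 j) => [k|] ->; first by rewrite !rV_consS /=; exact: ballxx.
by rewrite !rV_cons0/=; exact: sz.
Qed.

Lemma cube_cons n K (s : R) (y : 'rV[R]_n) :
  cube K (rV_cons (s, y)) <-> `|s| <= K /\ cube K y.
Proof.
split=> [h|[hs hy] i].
  split=> [|i]; first by have := h ord0; rewrite rV_cons0.
  by have := h (lift ord0 i); rewrite rV_consS.
by case: (unliftP ord0 i) => [j|] ->; rewrite ?rV_consS ?rV_cons0//; exact: hy.
Qed.

Lemma bounded_cube n K : bounded_set (cube K : set 'rV[R]_n).
Proof.
exists `|K|; split; first exact: num_real.
move=> x Kx y yK /=; rewrite [leLHS]/Num.norm/= mx_normrE.
apply: bigmax_le => [|[i j] _/=]; first by rewrite ltW// (le_lt_trans _ Kx).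
by rewrite ord1 (le_trans (yK j))// (le_trans (ler_norm _))// ltW.
Qed.

Lemma measurable_cube n K : measurable (cube K : set 'rV[R]_n).
Proof.
rewrite (_ : cube K = [set x | forall i, `[- K, K]%classic (x ord0 i)]).
  apply: (measurable_coordE (A := fun=> `[- K, K]%classic)) => i.
  exact: measurable_itv.
by apply/seteqP; split=> x /= h i; have := h i; rewrite in_itv/= ler_norml.
Qed.

Lemma integrable_cube n (f : 'rV[R]_n -> R) C K : measurable_fun setT f ->
  (forall x, `|f x| <= C) -> (forall x, ~ cube K x -> f x = 0) ->
  (lebesgue_rV R n).-integrable setT (EFin \o f).
Proof.
move=> mf fC fK; have mK := @measurable_cube n K.
rewrite (_ : EFin \o f = (EFin \o f) \_ (cube K)); last first.
  apply/funext => x; rewrite patchE; case: ifPn => //; rewrite notin_setE => /fK.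
  by move=> /= ->.
apply/(integrable_mkcond _ mK); apply/integrableP; split.
  by apply/measurable_EFinP; exact: measurable_funTS.
apply: (@le_lt_trans _ _ (\int[lebesgue_rV R n]_(x in cube K) (cst C%:E x))%E).
  apply: ge0_le_integral => //.
  - by apply: measurableT_comp => //; apply/measurable_EFinP; exact: measurable_funTS.
  - by move=> x _; rewrite /= lee_fin.
rewrite integral_cst// ltey_eq fin_numM// ge0_fin_numE//.
exact: bounded_finite_measure (@bounded_cube n K) mK.
Qed.

(** The measure on R^(n+1) is by construction the image of a product measure under [rV_cons], so
    both orders of integration come from Fubini on the product; boundedness and support in a cube
    give integrability. *)
Lemma lebesgue_rV_Fubini n (f : 'rV[R]_n.+1 -> R) C K : measurable_fun setT f ->
  (forall x, `|f x| <= C) -> (forall x, ~ cube K x -> f x = 0) ->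
  (\int[lebesgue_rV R n.+1]_x (f x)%:E =
    \int[@lebesgue_measure R]_s \int[lebesgue_rV R n]_y (f (rV_cons (s, y)))%:E)%E /\
  (\int[lebesgue_rV R n.+1]_x (f x)%:E =
    \int[lebesgue_rV R n]_y \int[@lebesgue_measure R]_s (f (rV_cons (s, y)))%:E)%E.
Proof.
move=> mf fC fK; have fi := integrable_cube mf fC fK.
have mfc : measurable_fun setT (EFin \o f \o @rV_cons R n).
  by apply: measurableT_comp; [exact/measurable_EFinP|exact: measurable_rV_cons].
have fci : (@lebesgue_measure R \x lebesgue_rV R n)%E.-integrable setT (EFin \o f \o @rV_cons R n).
  apply/integrableP; split => //; move/integrableP: fi => [_]; apply: le_lt_trans.
  rewrite [leRHS](ge0_integral_pushforward (@measurable_rV_cons R n) (@lebesgue_measure R \x lebesgue_rV R n)%E)//.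
  by apply: measurableT_comp => //; exact/measurable_EFinP.
have -> : (\int[lebesgue_rV R n.+1]_x (f x)%:E =
    \int[@lebesgue_measure R \x lebesgue_rV R n]_p (f (rV_cons p))%:E)%E.
  rewrite [LHS](integral_pushforward (@measurable_rV_cons R n) (mu := (@lebesgue_measure R \x lebesgue_rV R n)%E))//.
  exact/measurable_EFinP.
by split; [rewrite -(integral12_prod_meas1 fci)|rewrite -(integral21_prod_meas1 fci)].
Qed.

Lemma integral_derive_compact (g : R -> R) (K : R) : (forall s, derivable g s 1) ->
  continuous (derive1 g : R -> R) -> (forall s, K < `|s| -> g s = 0) ->
  (\int[@lebesgue_measure R]_s ((derive1 g) s)%:E = 0)%E.
Proof.
(* With this choice [b] is positive and exceeds [K] whatever the sign of [K], so [g] vanishes at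
   both endpoints of [[-b, b]] and its derivative vanishes outside. *)
move=> dg cg gK; set b : R := `|K| + 1.
have Kb : K < b by rewrite (le_lt_trans (ler_norm K))// ltrDl.
have b0 : 0 < b by rewrite ltr_wpDl.
have dg0 s : b < `|s| -> (derive1 g) s = 0.
  move=> bs; rewrite derive1E.
  transitivity ('D_1 (cst (0 : R^o)) s); last exact: derive_cst.
  apply: near_eq_derive; near=> y; apply: gK; near: y.
  by apply: (cvgr_gt `|s|); [exact: (@norm_continuous R R^o s)|exact: lt_trans Kb bs].
transitivity (\int[@lebesgue_measure R]_(s in `[(- b)%R, b]) ((derive1 g) s)%:E)%E.
  rewrite [RHS]integral_mkcond; apply: eq_integral => s _; rewrite patchE.
  case: ifPn => //; rewrite notin_setE/= in_itv/= -ler_norml => /negP.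
  by rewrite -ltNge => /dg0 ->.
have cG : continuous g.
  by move=> s; apply/differentiable_continuous/derivable1_diffP.
rewrite (@continuous_FTC2 _ (derive1 g) g).
- by rewrite !gK ?subee// ?normrN gtr0_norm.
- by rewrite (lt_trans _ b0)// oppr_lt0.
- exact: continuous_subspaceT.
- split; [by move=> *; exact: dg| |].
  + by apply: cvg_at_right_filter; exact: cG.
  + by apply: cvg_at_left_filter; exact: cG.
- by [].
Unshelve. all: by end_near. Qed.

(** Induction on the dimension, with the order of integration chosen so that the inner integral is
    zero: for the first coordinate it is a one-dimensional integral handled by the fundamental
    theorem of calculus, for any other it is an instance of the induction hypothesis on a slice.
    Only the derivative along [i] is controlled, since this is what slices inherit. *)
Lemma integral_pd n (chi : 'rV[R]_n -> R) (i : 'I_n) C K :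
  (forall x, derivable (chi : _ -> R^o) x (delta_mx ord0 i)) ->
  continuous (pd i chi) -> (forall x, `|pd i chi x| <= C) ->
  (forall x, ~ cube K x -> chi x = 0) ->
  (\int[lebesgue_rV R n]_x (pd i chi x)%:E = 0)%E.
Proof.
elim: n => [|n IHn] in chi i *; first by case: i.
move=> dchi cpd pdC chiK.
have pdK x : ~ cube K x -> pd i chi x = 0.
  move=> /existsNP[j /negP]; rewrite -ltNge => Kxj.
  have chi0 : \forall y \near x, chi y = 0.
    have : \forall y \near x, K < `|(y : 'rV[R]_n.+1) ord0 j|.
      have cn : (fun y : 'rV[R]_n.+1 => `|y ord0 j|) y @[y --> x] --> `|x ord0 j|.
        exact: (@cvg_norm R R^o _ _ _ _ _ (@coord_continuous R 1 n.+1 ord0 j x)).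
      exact: (cvgr_gt _ cn _ Kxj).
    by apply: filterS => y Ky; apply: chiK => /(_ j); rewrite leNgt Ky.
  transitivity (pd i ((fun=> 0) : 'rV[R]_n.+1 -> R) x); last by rewrite pd_cst.
  exact: near_eq_derive chi0.
have mpd := continuous_measurable_rV cpd.
have [F1 F2] := lebesgue_rV_Fubini mpd pdC pdK.
case: (unliftP ord0 i) => [j ij|i0].
  rewrite F1; apply: integral0_eq => s _.
  have consE h y : rV_cons (s, h *: delta_mx ord0 j + y) =
      h *: delta_mx ord0 i + rV_cons (s, y) :> 'rV[R]_n.+1.
    apply/rowP => k; rewrite [RHS]mxE [X in _ = X + _]mxE [X in _ = _ * X + _]mxE ij.
    case: (unliftP ord0 k) => [l|] ->.
      by rewrite !rV_consS !mxE/= (inj_eq lift_inj).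
    by rewrite !rV_cons0/= mulr0 add0r.
  have pdE y : pd i chi (rV_cons (s, y)) = pd j (fun z => chi (rV_cons (s, z))) y.
    by apply: (derive_congr _).1 => h; rewrite consE.
  under eq_integral do rewrite pdE.
  apply: (IHn (fun z => chi (rV_cons (s, z)))).
  - by move=> y; apply: ((derive_congr _).2 (dchi (rV_cons (s, y)))) => h; rewrite consE.
  - move=> y; rewrite (_ : pd j _ = pd i chi \o (fun y => rV_cons (s, y))).
      by apply: continuous_comp; [exact: rV_cons_continuous|exact: cpd].
    by apply/funext => z /=; rewrite pdE.
  - by move=> y; have := pdC (rV_cons (s, y)); rewrite pdE.
  - by move=> y ny; apply: chiK => /cube_cons[_].
rewrite F2; apply: integral0_eq => y _.
have consE h s : rV_cons (h *: 1 + s, y) =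
    h *: delta_mx ord0 i + rV_cons (s, y) :> 'rV[R]_n.+1.
  apply/rowP => k; rewrite [RHS]mxE [X in _ = X + _]mxE [X in _ = _ * X + _]mxE i0.
  case: (unliftP ord0 k) => [l|] ->.
    by rewrite !rV_consS /= mulr0 add0r.
  by rewrite !rV_cons0.
pose g s := chi (rV_cons (s, y)).
have pdE s : pd i chi (rV_cons (s, y)) = (derive1 g) s.
  by rewrite derive1E; apply: (derive_congr _).1 => h; rewrite -consE.
under eq_integral do rewrite pdE.
apply: (@integral_derive_compact g K).
- by move=> s; apply: ((derive_congr _).2 (dchi (rV_cons (s, y)))) => h; rewrite -consE.
- move=> s; rewrite (_ : (derive1 g) = pd i chi \o (fun s => rV_cons (s, y))).
    by apply: continuous_comp; [exact: rV_cons_continuousl|exact: cpd].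
  by apply/funext => z /=.
- by move=> s Ks; apply: chiK => /cube_cons[]; rewrite leNgt Ks.
Qed.

End integral_partial_derivative.

(** * Uniqueness and calculus of weak derivatives; the spaces H^k and H^1_0 *)

Section weak_derivatives.
Context {R : realType} {d : nat}.
Variable Omega : set 'rV[R]_d.
Hypothesis oO : open Omega.
Hypothesis bO : bounded_set Omega.

Local Notation E := 'rV[R]_d.
Local Notation mu := (lebesgue_rV R d).
Local Notation L2 := (L2 Omega).
Local Notation ips := (ips Omega).
Local Notation nrm := (nrmL2 Omega).
Local Notation test_fun := (test_fun Omega).
Local Notation is_wderiv := (is_wderiv Omega).
Local Notation wderiv := (wderiv Omega).
Local Notation wpd := (wpd Omega).
Local Notation Hk := (Hk Omega).
Local Notation H10 := (H10 Omega).
Let mO : measurable Omega := open_measurable_rV oO.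
Let fO : (lebesgue_rV R d Omega < +oo)%E := bounded_finite_measure bO mO.
Implicit Types (f g u v phi psi : E -> R) (a : 'I_d -> nat).

Lemma test_fun_out phi x : test_fun phi -> ~ Omega x -> phi x = 0.
Proof.
move=> [_ _ phiO] nOx; apply/eqP/negPn/negP => phix; apply: nOx; apply: phiO.
exact: subset_closure.
Qed.

Lemma bounded_sub_cube : exists K : R, Omega `<=` cube K.
Proof.
have [M [Mr MO]] := bO; exists (M + 1) => x Ox i.
have := MO (M + 1) _ x Ox; rewrite ltrDl ltr01 => /(_ isT).
apply: le_trans; rewrite [leRHS]/Num.norm/= mx_normrE.
by apply: (le_trans _ (le_bigmax _ _ (ord0, i))).
Qed.

Lemma integral_test_pd i chi : test_fun chi -> \int[mu]_(x in Omega) pd i chi x = 0.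
Proof.
move=> tchi; have tpd := test_fun_pd i tchi.
have [C pdC] := test_bounded tpd; have [K OK] := bounded_sub_cube.
rewrite Rintegral_mkcond (_ : pd i chi \_ Omega = pd i chi); last first.
  apply/funext => x; rewrite patchE; case: ifPn => //; rewrite notin_setE => nOx.
  by rewrite (test_fun_out tpd).
rewrite /Rintegral (integral_pd (C := C) (K := K))//.
- by move=> x; apply: diff_derivable; exact: smooth_diff (test_smooth tchi).
- exact: smooth_continuous (test_smooth tpd).
- by move=> x nx; apply: (test_fun_out tchi) => /OK.
Qed.

Lemma test_funM phi psi : test_fun phi -> test_fun psi ->
  test_fun (fun x => phi x * psi x).
Proof.
move=> tphi tpsi; apply: (test_fun_support tphi).
  exact: smoothM (test_smooth tphi) (test_smooth tpsi).
by move=> x ->; rewrite mul0r.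
Qed.

Lemma test_ibp i phi psi : test_fun phi -> test_fun psi ->
  ips phi (pd i psi) = - ips (pd i phi) psi.
Proof.
move=> tphi tpsi; apply/eqP; rewrite -addr_eq0; apply/eqP.
rewrite -[RHS](integral_test_pd i (test_funM tphi tpsi)).
have dphi x : differentiable (phi : E -> R^o) x by exact: smooth_diff (test_smooth tphi).
have dpsi x : differentiable (psi : E -> R^o) x by exact: smooth_diff (test_smooth tpsi).
have Lphi := test_L2 oO fO tphi; have Lpsi := test_L2 oO fO tpsi.
have Ldphi := test_L2 oO fO (test_fun_pd i tphi).
have Ldpsi := test_L2 oO fO (test_fun_pd i tpsi).
rewrite pdM// RintegralD//; [|exact: (L2M_sint mO Lphi Ldpsi)|exact: (L2M_sint mO Lpsi Ldphi)].
by congr (_ + _); apply: eq_Rintegral => x _; rewrite mulrC.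
Qed.

Lemma pdm_delta i phi : pdm (fun j => (j == i) : nat) phi = pd i phi.
Proof.
rewrite /pdm; have : i \in enum 'I_d by rewrite mem_enum.
elim: (enum 'I_d) (enum_uniq 'I_d) => [//|j s IHs] /= /andP[js us].
rewrite in_cons => /predU1P[ij|is_]; last first.
  rewrite IHs//; case: eqVneq => // ji; by move: js; rewrite ji is_.
rewrite -{}ij in js *; rewrite eqxx /=; congr pd; elim: s js {us IHs} => [//|k s IHs] /=.
by rewrite in_cons negb_or eq_sym => /andP[/negbTE ki ks]; rewrite ki /= IHs.
Qed.

Lemma pdm0 a phi : (forall i, a i = 0%N) -> pdm a phi = phi.
Proof. by move=> a0; rewrite /pdm; elim: (enum _) => //= i s ->; rewrite a0. Qed.

Lemma test_fun_pdm a phi : test_fun phi -> test_fun (pdm a phi).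
Proof.
move=> tphi; rewrite /pdm; elim: (enum _) => //= i s IHs.
by elim: (a i) => //= n IHn; exact: test_fun_pd.
Qed.

Lemma sum_delta i : (\sum_(j < d) (j == i) = 1)%N.
Proof. by rewrite (bigD1 i)//= eqxx big1// => j /negbTE ->. Qed.

Lemma is_wderiv_delta i u g : is_wderiv (fun j => (j == i) : nat) u g <->
  L2 g /\ forall phi, test_fun phi -> ips u (pd i phi) = - ips g phi.
Proof.
by split=> -[Lg H]; split=> // phi /H; rewrite pdm_delta sum_delta expr1 mulN1r.
Qed.

(** The difference is orthogonal to all test functions. Since [wderiv] is a choice, this is the only
    handle on its values, and linearity and norm comparisons all use it. *)
Lemma is_wderiv_ae a u g h : is_wderiv a u g -> is_wderiv a u h ->
  {ae mu, forall x, Omega x -> g x = h x}.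
Proof.
move=> [Lg Hg] [Lh Hh].
have Lgh : L2 (fun x => g x - h x) by exact: L2B.
have orth phi : test_fun phi -> ips (fun x => g x - h x) phi = 0.
  move=> tphi; have Lphi := test_L2 oO fO tphi; rewrite ipsBl//.
  have := Hg _ tphi; rewrite (Hh _ tphi) => /(mulfI _) ->; rewrite ?subrr//.
  by rewrite signr_eq0.
apply: filterS (test_orthogonal_ae oO fO Lgh orth) => x + Ox => /(_ Ox)/eqP.
by rewrite subr_eq0 => /eqP.
Qed.

Lemma wderivP a u : (exists g, is_wderiv a u g) -> is_wderiv a u (wderiv a u).
Proof. by move=> [g gP]; exact: getPex (ex_intro _ g gP). Qed.

Lemma is_wderivD a u v g h : L2 u -> L2 v -> is_wderiv a u g -> is_wderiv a v h ->
  is_wderiv a (fun x => u x + v x) (fun x => g x + h x).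
Proof.
move=> Lu Lv [Lg Hg] [Lh Hh]; split; first exact: L2D.
move=> phi tphi; have Lphi := test_L2 oO fO tphi.
have Lpd := test_L2 oO fO (test_fun_pdm a tphi).
by rewrite !ipsDl// Hg// Hh// mulrDr.
Qed.

Lemma is_wderivZ a c u g : L2 u -> is_wderiv a u g ->
  is_wderiv a (fun x => c * u x) (fun x => c * g x).
Proof.
move=> Lu [Lg Hg]; split; first exact: L2Z.
move=> phi tphi; have Lphi := test_L2 oO fO tphi.
have Lpd := test_L2 oO fO (test_fun_pdm a tphi).
by rewrite !ipsZl// Hg// mulrCA.
Qed.

Lemma is_wderiv_comb a c u v g h : L2 u -> L2 v -> is_wderiv a u g -> is_wderiv a v h ->
  is_wderiv a (fun x => c * u x + v x) (fun x => c * g x + h x).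
Proof.
by move=> Lu Lv ug vh; apply: is_wderivD => //; [exact: L2Z|exact: is_wderivZ].
Qed.

Lemma is_wderiv0 a u : L2 u -> (forall i, a i = 0%N) -> is_wderiv a u u.
Proof.
move=> Lu a0; split=> // phi _.
by rewrite pdm0// big1 ?expr0 ?mul1r// => i _; rewrite a0.
Qed.

Lemma test_is_wderiv i phi : test_fun phi ->
  is_wderiv (fun j => (j == i) : nat) phi (pd i phi).
Proof.
move=> tphi; apply/is_wderiv_delta; split; first exact/test_L2/test_fun_pd.
by move=> psi tpsi; rewrite test_ibp.
Qed.

Lemma multiindex_le1 a : (\sum_i a i <= 1)%N ->
  (forall i, a i = 0%N) \/ exists i, a = fun j => (j == i) : nat.
Proof.
move=> a1; have [/forallP a0|] := boolP [forall i, a i == 0%N].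
  by left => i; exact/eqP.
rewrite negb_forall => /existsP[i ai0]; right; exists i; apply/funext => j.
move: a1; rewrite (bigD1 i)//=; have [->|ji] := eqVneq j i.
  by move: ai0; case: (a i) => [//|[//|n]].
rewrite (bigD1 j)//=; move: ai0; case: (a i) => [//|n] _; case: (a j) => [//|m].
by rewrite !addSn addnS.
Qed.

(** [wpd] is indexed by a function into the naturals, the Sobolev norms by functions into a finite
    ordinal; this finds the index of a first derivative among the latter. *)
Lemma delta_multiindex k i : exists al : {ffun 'I_d -> 'I_k.+2},
  (fun j => al j : nat) = (fun j => (j == i) : nat) /\ (\sum_j al j <= k.+1)%N.
Proof.
exists [ffun j => inord (j == i)].
have E : (fun j => ([ffun j => inord (j == i)] : {ffun 'I_d -> 'I_k.+2}) j : nat) =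
    (fun j => (j == i) : nat).
  by apply/funext => j; rewrite ffunE inordK//; case: (_ == _).
split=> //; rewrite (eq_bigr (fun j => (j == i) : nat)); first by rewrite sum_delta.
by move=> j _; rewrite -[RHS](congr1 (@^~ j) E).
Qed.

Lemma Hk1P u : Hk 1 u <->
  L2 u /\ forall i, exists g, is_wderiv (fun j => (j == i) : nat) u g.
Proof.
split=> [[Lu Hu]|[Lu Hu]]; split=> //.
  by move=> i; have [al [<- al1]] := delta_multiindex 0 i; exact: Hu.
move=> al al1; have [a0|[i ->]] := multiindex_le1 al1; last exact: Hu.
by exists u; exact: is_wderiv0.
Qed.

Lemma wpdP i u : Hk 1 u ->
  is_wderiv (fun j => (j == i) : nat) u (wpd i u).
Proof. by move=> /Hk1P[_ /(_ i)] /wderivP. Qed.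

Lemma wpd_L2 i u : Hk 1 u -> L2 (wpd i u).
Proof. by move=> /(wpdP i)[]. Qed.

Lemma wpd_test i u phi : Hk 1 u -> test_fun phi -> ips u (pd i phi) = - ips (wpd i u) phi.
Proof. by move=> /(wpdP i)/is_wderiv_delta[_]; exact. Qed.

Lemma wpd_comb_ae i c u v : Hk 1 u -> Hk 1 v ->
  {ae mu, forall x, Omega x -> wpd i (fun y => c * u y + v y) x = c * wpd i u x + wpd i v x}.
Proof.
move=> Hu Hv; have H := is_wderiv_comb c Hu.1 Hv.1 (wpdP i Hu) (wpdP i Hv).
by apply: (is_wderiv_ae _ H); apply: wderivP; exists (fun x => c * wpd i u x + wpd i v x).
Qed.

Lemma Hk_comb k c u v : Hk k u -> Hk k v -> Hk k (fun x => c * u x + v x).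
Proof.
move=> [Lu Hu] [Lv Hv]; split=> [|al alk]; first by apply: L2D => //; exact: L2Z.
have [g gP] := Hu _ alk; have [h hP] := Hv _ alk.
by exists (fun x => c * g x + h x); exact: is_wderiv_comb.
Qed.

Lemma test_Hk1 phi : test_fun phi -> Hk 1 phi.
Proof.
move=> tphi; apply/Hk1P; split=> [|i]; first exact: test_L2.
by exists (pd i phi); exact: test_is_wderiv.
Qed.

Lemma nrm_wderiv_le k (al : {ffun 'I_d -> 'I_k.+1}) u : (\sum_i al i <= k)%N ->
  nrm (wderiv (fun i => al i) u) <= Hk_norm Omega k u.
Proof.
move=> alk; rewrite /nrmL2 /Hk_norm ler_sqrt; last first.
  by apply: sumr_ge0 => ? _; exact: ips_ge0.
rewrite /Hk_sqnorm (bigD1 al)//= lerDl.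
by apply: sumr_ge0 => ? _; exact: ips_ge0.
Qed.

Lemma nrm_wpd_le k i u : nrm (wpd i u) <= Hk_norm Omega k.+1 u.
Proof.
have [al [al_i al1]] := delta_multiindex k i; rewrite /Defs.wpd -al_i.
exact: nrm_wderiv_le.
Qed.

(** The summand of order zero in the Sobolev norm is the norm of a chosen representative, which
    agrees with [u] only almost everywhere. *)
Lemma nrm_Hk_le k u : L2 u -> nrm u <= Hk_norm Omega k u.
Proof.
move=> Lu; pose al : {ffun 'I_d -> 'I_k.+1} := [ffun=> ord0].
have al0 i : al i = 0%N :> nat by rewrite ffunE.
apply: le_trans (@nrm_wderiv_le k al u _); last by rewrite big1.
have H := is_wderiv0 Lu al0.
have H' : is_wderiv (fun i => al i) u (wderiv (fun i => al i) u).
  by apply: wderivP; exists u.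
by rewrite (nrm_ae mO Lu H'.1 (is_wderiv_ae H H')).
Qed.

Lemma H10_approx u : H10 u -> forall eps, 0 < eps -> exists2 phi, test_fun phi &
  nrm (fun x => u x - phi x) < eps /\ forall i, nrm (fun x => wpd i u x - pd i phi x) < eps.
Proof.
move=> [Hu Au] eps eps0; have [phi tphi uphi] := Au _ eps0; exists phi => //.
have Lphi := test_L2 oO fO tphi.
split.
  by apply: le_lt_trans uphi; apply: nrm_Hk_le; exact: L2B Hu.1 _.
move=> i; apply: le_lt_trans uphi; apply: le_trans (nrm_wpd_le 0 i _).
have H : is_wderiv (fun j => (j == i) : nat) (u - phi) (fun x => wpd i u x - pd i phi x).
  have := is_wderiv_comb (-1) Lphi Hu.1 (test_is_wderiv i tphi) (wpdP i Hu).
  have -> : (fun x => -1 * phi x + u x) = u - phi by apply/funext => x; rewrite !fctE; ring.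
  by under [X in is_wderiv _ _ X]eq_fun do rewrite mulN1r addrC.
have H' : is_wderiv (fun j => (j == i) : nat) (u - phi) (wpd i (u - phi)).
  by apply: wderivP; exists (fun x => wpd i u x - pd i phi x).
by rewrite (nrm_ae mO H.1 H'.1 (is_wderiv_ae H H')).
Qed.

Lemma Hk_sqnorm_comb k c u v : Hk k u -> Hk k v ->
  Hk_sqnorm Omega k (fun x => c * u x + v x) <=
    2 * c ^+ 2 * Hk_sqnorm Omega k u + 2 * Hk_sqnorm Omega k v.
Proof.
move=> Hu Hv; rewrite /Hk_sqnorm !mulr_sumr -big_split/=; apply: ler_sum => al alk.
have Pu := wderivP (Hu.2 _ alk); have Pv := wderivP (Hv.2 _ alk).
have P := wderivP ((Hk_comb c Hu Hv).2 _ alk).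
have Q := is_wderiv_comb c Hu.1 Hv.1 Pu Pv.
rewrite -nrm_sqr (nrm_ae mO P.1 Q.1 (is_wderiv_ae P Q)).
set U := wderiv _ u in Pu *; set V := wderiv _ v in Pv *.
have LU : L2 (fun x => c * U x) by apply: L2Z => //; exact: Pu.1.
have h := nrmD mO LU Pv.1; have h0 := nrm_ge0 Omega (fun x => c * U x + V x).
rewrite -/V in h h0 *; rewrite -!nrm_sqr; rewrite nrmZ in h; [|exact: mO|exact: Pu.1].
rewrite -(real_normK (num_real c)).
move: h h0; move: (nrm _) (nrm U) (nrm V) `|c| => n nU nV C h h0.
have := sqr_ge0 (C * nU - nV); rewrite !expr2 => h1.
have := ler_pM h0 h0 h h; nra.
Qed.

Lemma H10_comb_bound (A B C de : R) : 0 <= C -> 0 < de -> B < de ^+ 2 -> A < de ^+ 2 ->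
  2 * C ^+ 2 * A + 2 * B < (de * (2 * (C + 1))) ^+ 2.
Proof.
move=> C0 de0 hB hA; have de2 : 0 < de ^+ 2 by rewrite exprn_gt0.
apply: (@le_lt_trans _ _ (2 * C ^+ 2 * de ^+ 2 + 2 * de ^+ 2)).
  by apply: lerD; apply: ler_wpM2l; do ?[exact: ltW]; rewrite // mulr_ge0 ?sqr_ge0.
rewrite -mulrDl mulrC exprMn ltr_pM2l//.
have := sqr_ge0 C; nra.
Qed.

Lemma H10_comb c u v : H10 u -> H10 v -> H10 (fun x => c * u x + v x).
Proof.
move=> [Hu Au] [Hv Av]; split; first exact: Hk_comb.
(* Each derivative of a combination contributes by [(x + y)^2 <= 2 x^2 + 2 y^2], and [2 c^2 de^2 + 2
   de^2 < (2 (|c| + 1) de)^2 = eps^2]. *)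
move=> eps eps0; pose de := eps / (2 * (`|c| + 1)).
have c0 : 0 < `|c| + 1 by rewrite ltr_wpDl.
have de0 : 0 < de by rewrite divr_gt0// mulr_gt0.
have [phi tphi uphi] := Au _ de0; have [psi tpsi vpsi] := Av _ de0.
exists (fun x => c * phi x + psi x); first by apply: test_funD => //; exact: test_funZ.
have -> : (fun x => c * u x + v x) - (fun x => c * phi x + psi x) =
    (fun x => c * (u - phi) x + (v - psi) x).
  by apply/funext => x; rewrite !fctE; ring.
have HB f g : Hk 1 f -> Hk 1 g -> Hk 1 (f - g).
  move=> Hf Hg; have := Hk_comb (-1) Hg Hf.
  by rewrite (_ : (fun x => _) = f - g)//; apply/funext => x; rewrite !fctE; ring.
have Hup := HB _ _ Hu (test_Hk1 tphi); have Hvp := HB _ _ Hv (test_Hk1 tpsi).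
have sq0 f : 0 <= Hk_sqnorm Omega 1 f by apply: sumr_ge0 => ? _; exact: ips_ge0.
have sq f : Hk_norm Omega 1 f < de -> Hk_sqnorm Omega 1 f < de ^+ 2.
  move=> h; rewrite -(sqr_sqrtr (sq0 f)) -/(Hk_norm Omega 1 f).
  by rewrite ltr_pXn2r// ?nnegrE ?sqrtr_ge0// ltW.
rewrite -(ltr_pXn2r (n := 2))// ?nnegrE ?sqrtr_ge0 ?(ltW eps0)//.
rewrite sqr_sqrtr//; apply: le_lt_trans (Hk_sqnorm_comb c Hup Hvp) _.
have := sq _ uphi; have := sq _ vpsi.
have -> : eps = de * (2 * (`|c| + 1)) by rewrite /de divfK// mulf_neq0// gt_eqF.
rewrite -(real_normK (num_real c)).
exact: (H10_comb_bound (normr_ge0 c) de0).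
Qed.

Lemma small_eq0 (x K : R) : (forall e, 0 < e -> `|x| <= e * K) -> x = 0.
Proof.
move=> H; apply/eqP; rewrite -normr_le0; apply/ler_addgt0Pr => e e0; rewrite add0r.
have K1 : 0 < `|K| + 1 by rewrite ltr_wpDl.
have e1 : 0 < e / (`|K| + 1) by rewrite divr_gt0.
apply: le_trans (H _ e1) _; rewrite -mulrA ler_piMr ?(ltW e0)//.
by rewrite mulrC ler_pdivrMr// mul1r (le_trans (ler_norm K))// lerDl.
Qed.

(** For a test function in place of [u] this is the definition of the weak derivative of [v]. Both
    sides are continuous in [u] for the H^1 norm, in which test functions approximate [u]. *)
Lemma H10_ibp i u v : H10 u -> Hk 1 v -> ips (wpd i u) v = - ips u (wpd i v).
Proof.
move=> Hu Hv; apply/eqP; rewrite -addr_eq0; apply/eqP.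
apply: (@small_eq0 _ (nrm v + nrm (wpd i v))) => e e0.
have [phi tphi [/ltW uphi /(_ i)/ltW duphi]] := H10_approx Hu e0.
have Lphi := test_L2 oO fO tphi; have Lpd := test_L2 oO fO (test_fun_pd i tphi).
have Lu := Hu.1.1; have Ldu := wpd_L2 i Hu.1; have Lv := Hv.1; have Ldv := wpd_L2 i Hv.
have -> : ips (wpd i u) v + ips u (wpd i v) =
    ips (fun x => wpd i u x - pd i phi x) v + ips (fun x => u x - phi x) (wpd i v).
  rewrite !ipsBl//; have := wpd_test i Hv tphi.
  by rewrite (ipsC _ v) (ipsC _ _ phi) => ->; ring.
apply: le_trans (ler_normD _ _) _; rewrite mulrDr.
apply: lerD; apply: le_trans (cauchy_schwarz mO _ _) _ => //; try exact: L2B;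
  by rewrite ler_wpM2r// nrm_ge0.
Qed.

Lemma H10_Hk1 u : H10 u -> Hk 1 u. Proof. by case. Qed.

Lemma H10_L2 u : H10 u -> L2 u. Proof. by move=> [[]]. Qed.

End weak_derivatives.

(** * Vector fields and the projection step *)

Section vector_fields.
Context {R : realType} {d : nat}.
Variable Omega : set 'rV[R]_d.
Hypothesis oO : open Omega.
Hypothesis bO : bounded_set Omega.

Local Notation E := 'rV[R]_d.
Local Notation mu := (lebesgue_rV R d).
Local Notation L2 := (L2 Omega).
Local Notation L2v := (L2v Omega).
Local Notation ips := (ips Omega).
Local Notation ip := (ip Omega).
Local Notation nrm := (nrmL2 Omega).
Local Notation L2norm := (L2norm Omega).
Local Notation test_fun := (test_fun Omega).
Local Notation wpd := (wpd Omega).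
Local Notation Hk := (Hk Omega).
Local Notation H10v := (H10v Omega).
Local Notation gradv := (gradv Omega).
Let mO : measurable Omega := open_measurable_rV oO.
Let fO : (lebesgue_rV R d Omega < +oo)%E := bounded_finite_measure bO mO.

Section matrix_fields.
Variables m n : nat.
Implicit Types F G K : E -> 'M[R]_(m, n).

Definition L2m F := forall i j, L2 (fun x => F x i j).

Lemma dotmE (A B : 'M[R]_(m, n)) : dotm A B = \sum_i \sum_j A i j * B i j.
Proof.
rewrite /dotm /mxtrace; apply: eq_bigr => i _; rewrite mxE.
by apply: eq_bigr => j _; rewrite mxE.
Qed.

Lemma ipE F G : L2m F -> L2m G ->
  ip F G = \sum_i \sum_j ips (fun x => F x i j) (fun x => G x i j).
Proof.
move=> LF LG; have FG i j := L2M_sint mO (LF i j) (LG i j).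
transitivity (\int[mu]_(x in Omega) \sum_i \sum_j F x i j * G x i j).
  by apply: eq_Rintegral => x _; rewrite dotmE.
rewrite (Rintegral_sum mO); last by move=> i; exact: sint_sum.
by apply: eq_bigr => i _; rewrite (Rintegral_sum mO).
Qed.

Lemma L2mD F G : L2m F -> L2m G -> L2m (fun x => F x + G x).
Proof.
move=> LF LG i j; rewrite (_ : (fun _ => _) = fun x => F x i j + G x i j); first exact: L2D.
by apply/funext => x; rewrite mxE.
Qed.

Lemma L2mZ c F : L2m F -> L2m (fun x => c *: F x).
Proof.
move=> LF i j; rewrite (_ : (fun _ => _) = fun x => c * F x i j); first exact: L2Z.
by apply/funext => x; rewrite mxE.
Qed.

Lemma L2mN F : L2m F -> L2m (fun x => - F x).
Proof. by move=> /(L2mZ (-1)); under eq_fun do rewrite scaleN1r. Qed.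

Lemma L2mB F G : L2m F -> L2m G -> L2m (fun x => F x - G x).
Proof. by move=> LF /L2mN; exact: L2mD. Qed.

Lemma dotmC (A B : 'M[R]_(m, n)) : dotm A B = dotm B A.
Proof. by rewrite !dotmE; do 2 (apply: eq_bigr => ? _); rewrite mulrC. Qed.

Lemma ipC F G : ip F G = ip G F.
Proof. by apply: eq_Rintegral => x _; rewrite dotmC. Qed.

Lemma ipDl F G K : L2m F -> L2m G -> L2m K ->
  ip (fun x => F x + G x) K = ip F K + ip G K.
Proof.
move=> LF LG LK; rewrite !ipE//; last exact: L2mD.
rewrite -big_split; apply: eq_bigr => i _; rewrite -big_split; apply: eq_bigr => j _ /=.
by rewrite -ipsDl//; congr Defs.ips; apply/funext => x; rewrite mxE.
Qed.

Lemma ipZl c F K : L2m F -> L2m K -> ip (fun x => c *: F x) K = c * ip F K.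
Proof.
move=> LF LK; rewrite !ipE//; last exact: L2mZ.
rewrite mulr_sumr; apply: eq_bigr => i _; rewrite mulr_sumr; apply: eq_bigr => j _ /=.
by rewrite -ipsZl//; congr Defs.ips; apply/funext => x; rewrite mxE.
Qed.

Lemma ipNl F K : L2m F -> L2m K -> ip (fun x => - F x) K = - ip F K.
Proof.
move=> LF LK; rewrite -mulN1r -ipZl//.
by congr Defs.ip; apply/funext => x; rewrite scaleN1r.
Qed.

Lemma ipBl F G K : L2m F -> L2m G -> L2m K ->
  ip (fun x => F x - G x) K = ip F K - ip G K.
Proof. by move=> LF LG LK; rewrite ipDl ?ipNl//; exact: L2mN. Qed.

Lemma ipZr c F K : L2m F -> L2m K -> ip K (fun x => c *: F x) = c * ip K F.
Proof. by move=> *; rewrite ipC ipZl// ipC. Qed.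

Lemma ipNr F K : L2m F -> L2m K -> ip K (fun x => - F x) = - ip K F.
Proof. by move=> *; rewrite ipC ipNl// ipC. Qed.

Lemma ipBr F G K : L2m F -> L2m G -> L2m K ->
  ip K (fun x => F x - G x) = ip K F - ip K G.
Proof. by move=> *; rewrite ipC ipBl// ![ip K _]ipC. Qed.

Lemma ip_ge0 F : 0 <= ip F F.
Proof.
apply: Rintegral_ge0 => x _; rewrite dotmE.
by do 2 (apply: sumr_ge0 => ? _); rewrite -expr2 sqr_ge0.
Qed.

Lemma L2norm_ge0 F : 0 <= L2norm F. Proof. exact: sqrtr_ge0. Qed.

Lemma L2norm_sqr F : L2norm F ^+ 2 = ip F F.
Proof. by rewrite sqr_sqrtr// ip_ge0. Qed.

Lemma ip_ae F F' K : L2m F -> L2m F' -> L2m K ->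
  {ae mu, forall x, Omega x -> F x = F' x} -> ip F K = ip F' K.
Proof.
move=> LF LF' LK FF'; rewrite !ipE//; do 2 (apply: eq_bigr => ? _).
by apply: (ips_ae mO) => //; move: FF'; apply: filterS => x /[apply] ->.
Qed.

Lemma ip_cauchy_schwarz F G : L2m F -> L2m G -> `|ip F G| <= L2norm F * L2norm G.
Proof.
move=> LF LG; rewrite -(ler_pXn2r (n := 2)) ?nnegrE ?mulr_ge0 ?L2norm_ge0//.
rewrite real_normK ?num_real// exprMn !L2norm_sqr.
have key t : 0 <= ip F F - 2 * t * ip F G + t ^+ 2 * ip G G.
  have := ip_ge0 (fun x => F x - t *: G x).
  have LtG : L2m (fun x => t *: G x) by exact: L2mZ.
  rewrite ipBl ?ipBr ?ipZl ?ipZr//; try exact: L2mB.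
  rewrite (ipC G F) => h; apply: le_trans h _; rewrite le_eqVlt; apply/orP; left.
  by apply/eqP; ring.
have [GG0|GG0] := eqVneq (ip G G) 0.
  rewrite GG0 mulr0; have FG0 : ip F G = 0.
    (* With [(G, G) = 0] the quadratic polynomial in [t] is affine; at this [t] it equals -1. *)
    apply/eqP; apply: contraT => FG0; have := key ((ip F F + 1) / (2 * ip F G)).
    rewrite GG0 mulr0 addr0 (_ : 2 * _ * _ = ip F F + 1); last by field.
    by rewrite opprD addrA subrr add0r oppr_ge0 ler10.
  by rewrite FG0 expr0n.
have {}GG0 : 0 < ip G G by rewrite lt_def GG0 ip_ge0.
have := key (ip F G / ip G G); rewrite (_ : _ - _ + _ = ip F F - ip F G ^+ 2 / ip G G).
  by rewrite subr_ge0 ler_pdivrMr.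
by field; rewrite gt_eqF.
Qed.

Lemma L2normN F : L2m F -> L2norm (fun x => - F x) = L2norm F.
Proof.
move=> LF; have LNF := L2mN LF.
by rewrite /Defs.L2norm (ipNl LF LNF) (ipNr LF LF) opprK.
Qed.

Lemma L2norm_ae F G : L2m F -> L2m G -> {ae mu, forall x, Omega x -> F x = G x} ->
  L2norm F = L2norm G.
Proof.
move=> LF LG FG.
by rewrite /Defs.L2norm (ip_ae LF LG LF FG) ipC (ip_ae LF LG LG FG).
Qed.

Lemma nrm_le_L2norm F i j : L2m F -> nrm (fun x => F x i j) <= L2norm F.
Proof.
move=> LF; rewrite ler_sqrt ?ip_ge0// ipE// (bigD1 i)//= (bigD1 j)//= -addrA lerDl.
by apply: addr_ge0; do ?[apply: sumr_ge0 => ? _]; exact: ips_ge0.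
Qed.

End matrix_fields.

Implicit Types (u v w : E -> E) (phi psi : E -> R).

Lemma L2vP u : L2v u <-> L2m u.
Proof. by split=> [Lu i j|Lu i]; [rewrite ord1; exact: Lu|exact: Lu]. Qed.

Lemma ip_rV u v : L2v u -> L2v v ->
  ip u v = \sum_j ips (fun x => u x ord0 j) (fun x => v x ord0 j).
Proof. by move=> /L2vP Lu /L2vP Lv; rewrite ipE// big_ord1. Qed.

Lemma L2v_row (f : 'I_d -> E -> R) : (forall j, L2 (f j)) -> L2v (fun x => \row_j f j x).
Proof.
by move=> Lf i; rewrite (_ : (fun _ => _) = f i)//; apply/funext => x; rewrite mxE.
Qed.

Lemma ip_row u (f : 'I_d -> E -> R) : L2v u -> (forall j, L2 (f j)) ->
  ip u (fun x => \row_j f j x) = \sum_j ips (fun x => u x ord0 j) (f j).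
Proof.
move=> Lu Lf; rewrite ip_rV//; last exact: L2v_row.
by apply: eq_bigr => j _; congr Defs.ips; apply/funext => x; rewrite mxE.
Qed.

Lemma H10v_L2v u : H10v u -> L2v u.
Proof. by move=> Hu i; exact: H10_L2. Qed.

Lemma H10v_comb c u v : H10v u -> H10v v -> H10v (fun x => c *: u x + v x).
Proof.
move=> Hu Hv i; have := H10_comb oO bO c (Hu i) (Hv i).
by congr (Defs.H10 _ _); apply/funext => x; rewrite !mxE.
Qed.

Lemma H10vB u v : H10v u -> H10v v -> H10v (fun x => u x - v x).
Proof.
by move=> Hu Hv; have := H10v_comb (-1) Hv Hu; under eq_fun do rewrite scaleN1r addrC.
Qed.

Lemma gradv_L2m u : (forall i, Hk 1 (fun x => u x ord0 i)) -> L2m (gradv u).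
Proof.
move=> Hu i j; rewrite (_ : (fun _ => _) = wpd j (fun y => u y ord0 i)); last first.
  by apply/funext => x; rewrite mxE.
by apply: wpd_L2.
Qed.

Lemma gradvB_ae u v : (forall i, Hk 1 (fun x => u x ord0 i)) ->
  (forall i, Hk 1 (fun x => v x ord0 i)) ->
  {ae mu, forall x, Omega x -> gradv (fun y => u y - v y) x = gradv u x - gradv v x}.
Proof.
move=> Hu Hv.
have h i j : {ae mu, forall x, Omega x -> gradv (fun y => u y - v y) x i j =
    (gradv u x - gradv v x) i j}.
  have := wpd_comb_ae oO bO j (-1) (Hv i) (Hu i); apply: filterS => x /[apply].
  rewrite !mxE => H; rewrite addrC -mulN1r -H; congr (Defs.wpd _ _ _ _).
  by apply/funext => y; rewrite !mxE; ring.
have {}h : {ae mu, forall x, forall i j, Omega x -> gradv (fun y => u y - v y) x i j =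
    (gradv u x - gradv v x) i j}.
  apply: filter_forall => i; apply: filter_forall => j; exact: h.
by move: h; apply: filterS => x h Ox; apply/matrixP => i j; exact: h.
Qed.

Lemma is_wdiv_ae u g h : L2v u -> is_wdiv Omega u g -> is_wdiv Omega u h ->
  {ae mu, forall x, Omega x -> g x = h x}.
Proof.
move=> Lu [Lg Hg] [Lh Hh].
have orth phi : test_fun phi -> ips (fun x => g x - h x) phi = 0.
  move=> tphi; have Lphi := test_L2 oO fO tphi; rewrite ipsBl//.
  by have := Hg _ tphi; rewrite (Hh _ tphi) => /oppr_inj ->; rewrite subrr.
have := test_orthogonal_ae oO fO (L2B mO Lg Lh) orth.
by apply: filterS => x + Ox => /(_ Ox)/eqP; rewrite subr_eq0 => /eqP.
Qed.

Lemma wdiv_divfree u phi : L2v u -> divfree Omega u -> L2 phi -> ips (wdiv Omega u) phi = 0.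
Proof.
move=> Lu du Lphi; have H : is_wdiv Omega u (wdiv Omega u).
  exact: (@getPex _ [set g | is_wdiv Omega u g] (ex_intro _ (cst 0) du)).
by rewrite (ips_ae mO H.1 du.1 Lphi (is_wdiv_ae Lu H du)) (ips0l mO).
Qed.

Lemma divfreeP u : L2v u -> divfree Omega u <->
  forall phi, test_fun phi -> \sum_j ips (fun x => u x ord0 j) (pd j phi) = 0.
Proof.
move=> Lu; have tp phi : test_fun phi -> forall j, L2 (pd j phi).
  by move=> tphi j; exact/(test_L2 oO fO)/test_fun_pd.
split=> [[_ du] phi tphi|du].
  by rewrite -(ip_row Lu (tp _ tphi)) du// (ips0l mO) oppr0.
split=> [|phi tphi]; first exact: L20_cst.
by rewrite (ip_row Lu (tp _ tphi)) du// (ips0l mO) oppr0.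
Qed.

Lemma divfreeB u v : L2v u -> L2v v -> divfree Omega u -> divfree Omega v ->
  divfree Omega (fun x => u x - v x).
Proof.
move=> Lu Lv du dv; have LB : L2v (fun x => u x - v x).
  by apply/L2vP/L2mB; exact/L2vP.
apply/divfreeP => // phi tphi.
have := (divfreeP Lu).1 du _ tphi; have := (divfreeP Lv).1 dv _ tphi => hv hu.
rewrite -[RHS]subr0 -[X in _ = X - _]hu -[X in _ = _ - X]hv -sumrB; apply: eq_bigr => j _.
have Lpd := test_L2 oO fO (test_fun_pd j tphi).
by rewrite -ipsBl//; congr Defs.ips; apply/funext => x; rewrite !mxE.
Qed.

(** The divergence term of the normal trace vanishes, so the boundary condition becomes
    orthogonality to the gradients of H^1. *)
Lemma YspaceP u : Yspace Omega u <-> [/\ L2v u, divfree Omega u &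
  forall phi, Hk 1 phi -> ip u (grad Omega phi) = 0].
Proof.
split=> -[Lu du nu]; split=> // phi Hphi; have := nu _ Hphi;
  by rewrite /normal_trace wdiv_divfree// ?addr0//; exact: Hphi.1.
Qed.

Lemma grad_L2v phi : Hk 1 phi -> L2v (grad Omega phi).
Proof. by move=> Hphi; apply: L2v_row => j; exact: wpd_L2. Qed.

Lemma YspaceB u v : Yspace Omega u -> Yspace Omega v -> Yspace Omega (fun x => u x - v x).
Proof.
move=> /YspaceP[Lu du nu] /YspaceP[Lv dv nv]; apply/YspaceP; split.
- by apply/L2vP/L2mB; exact/L2vP.
- exact: divfreeB.
- move=> phi Hphi; rewrite ipBl ?nu ?nv ?subrr//; try exact/L2vP.
  exact/L2vP/grad_L2v.
Qed.

(** The sum of the weak partial derivatives is orthogonal to every test function, hence zero almost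
    everywhere; integration by parts with components in H^1_0 then moves any gradient [grad phi]
    onto it. *)
Lemma H10v_Yspace w : H10v w -> divfree Omega w -> Yspace Omega w.
Proof.
move=> Hw dw; have Lw := H10v_L2v Hw; apply/YspaceP; split=> // phi Hphi.
have Hw1 j := H10_Hk1 (Hw j).
have Ldw j : L2 (wpd j (fun x => w x ord0 j)) by exact: wpd_L2.
have LS : L2 (fun x => \sum_j wpd j (fun x => w x ord0 j) x) by exact: L2_sum.
have S0 : {ae mu, forall x, Omega x -> \sum_j wpd j (fun x => w x ord0 j) x = 0}.
  apply: test_orthogonal_ae => // psi tpsi; have Lpsi := test_L2 oO fO tpsi.
  rewrite ips_suml//; apply/eqP; rewrite -oppr_eq0 -sumrN; apply/eqP.
  rewrite -[RHS]((divfreeP Lw).1 dw _ tpsi); apply: eq_bigr => j _.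
  by rewrite -wpd_test.
rewrite ip_row//; last by move=> j; exact: wpd_L2.
have -> : \sum_j ips (fun x => w x ord0 j) (wpd j phi) =
    - ips (fun x => \sum_j wpd j (fun x => w x ord0 j) x) phi.
  rewrite ips_suml//; last exact: Hphi.1.
  by rewrite -sumrN; apply: eq_bigr => j _; rewrite (H10_ibp oO bO)// opprK.
by rewrite (ips_ae mO LS (L20_cst mO) Hphi.1 S0) (ips0l mO) oppr0.
Qed.

(** The pressure is paired with the divergence of a field of [Y], which is zero. *)
Lemma step2_orthogonal dt u1 ut1 (p1 : E -> R) v : 0 < dt ->
  cda_step2 Omega dt u1 ut1 p1 -> Yspace Omega v -> ip (ut1 - u1) v = 0.
Proof.
move=> dt0 [_ [Lp _] H _] Yv; have [Lv dv _] := (YspaceP v).1 Yv.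
have := H _ Yv; rewrite (ipsC Omega p1) wdiv_divfree// subr0 => /eqP.
by rewrite mulf_eq0 invr_eq0 gt_eqF//= => /eqP.
Qed.

(** The field [w - ut1] lies in [Y], hence is orthogonal to [ut1 - u1]. So
    [|w - ut1|^2 = (w - u1, w - ut1)], and Cauchy-Schwarz concludes. *)
Lemma projection_le dt u1 ut1 (p1 : E -> R) w : 0 < dt -> L2v u1 ->
  cda_step2 Omega dt u1 ut1 p1 -> Yspace Omega w -> L2norm (w - ut1) <= L2norm (w - u1).
Proof.
move=> dt0 Lu1 S2 Yw; have [Yut _ _ _] := S2.
have YB := YspaceB Yw Yut; have := step2_orthogonal dt0 S2 YB.
have [/L2vP Lw _ _] := (YspaceP w).1 Yw; have [/L2vP Lut _ _] := (YspaceP ut1).1 Yut.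
move/L2vP : Lu1 => Lu1.
have LB : L2m (w - ut1) by exact: L2mB.
have LB' : L2m (w - u1) by exact: L2mB.
have -> : ut1 - u1 = fun x => (w - u1) x - (w - ut1) x.
  by apply/funext => x; rewrite !fctE opprB [RHS]addrC addrA subrK.
rewrite -[X in ip _ X]/(w - ut1) ipBl// => /eqP; rewrite subr_eq0 => /eqP H.
have [->|n0] := eqVneq (L2norm (w - ut1)) 0; first exact: L2norm_ge0.
have {}n0 : 0 < L2norm (w - ut1) by rewrite lt_def n0 L2norm_ge0.
rewrite -(ler_pM2r n0) -expr2 L2norm_sqr -H.
exact: le_trans (ler_norm _) (ip_cauchy_schwarz LB' LB).
Qed.

End vector_fields.

(** * Skew-symmetry of the convection term *)

Section truncation.
Context {R : realType}.
Variable c : R.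
Hypothesis c0 : 0 < c.
Implicit Types s t : R.

(* [trunc] is a bounded Lipschitz approximation of [s |-> 2 s], the derivative
   of [s |-> s ^ 2 / (1 + c s ^ 2)]. *)
Definition trunc s : R := 2 * s * ((1 + c * (s * s))^-1 * (1 + c * (s * s))^-1).

Lemma trunc_den_ge1 s : 1 <= 1 + c * (s * s).
Proof. by rewrite lerDl mulr_ge0 ?(ltW c0)// -expr2 sqr_ge0. Qed.

Lemma trunc_den_gt0 s : 0 < 1 + c * (s * s).
Proof. exact: lt_le_trans ltr01 (trunc_den_ge1 s). Qed.

Lemma trunc_den_le1 s : 0 <= (1 + c * (s * s))^-1 <= 1.
Proof.
by rewrite invr_ge0 (ltW (trunc_den_gt0 s)) invf_le1 ?trunc_den_gt0 ?trunc_den_ge1.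
Qed.

Lemma trunc_le s : `|trunc s| <= 2 * `|s|.
Proof.
have /andP[h0 h1] := trunc_den_le1 s.
rewrite /trunc !normrM (ger0_norm h0) [`|2|]ger0_norm// ler_piMr// ?mulr_ge0//.
by rewrite mulr_ile1.
Qed.

Lemma trunc_bound s : `|trunc s| <= 1 + c^-1.
Proof.
have /andP[h0 h1] := trunc_den_le1 s; have d0 := trunc_den_gt0 s.
have cV0 : 0 < c^-1 by rewrite invr_gt0.
(* The product on the right exceeds [1 + s^2], which is at least [2 |s|]. *)
have h : 2 * `|s| <= (1 + c^-1) * (1 + c * (s * s)).
  have -> : (1 + c^-1) * (1 + c * (s * s)) = 1 + c * s ^+ 2 + c^-1 + s ^+ 2.
    by field; rewrite gt_eqF.
  rewrite -(real_normK (num_real s)); move: `|s| (normr_ge0 s) => r r0.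
  have := sqr_ge0 (r - 1); have := mulr_ge0 (ltW c0) (sqr_ge0 r); move: cV0; lra.
rewrite /trunc !normrM (ger0_norm h0) [`|2|]ger0_norm// mulrA.
apply: (@le_trans _ _ (2 * `|s| * (1 + c * (s * s))^-1)).
  by rewrite ler_piMr// mulr_ge0// mulr_ge0.
by rewrite ler_pdivrMr.
Qed.

(** The difference quotient is an explicit fraction. In terms of [x = c s^2], [y = c t^2] and
    [z = c t s], with [|z| <= (x + y) / 2], the claim is a polynomial inequality free of [c]. *)
Lemma trunc_lipschitz s t : `|trunc s - trunc t| <= 6 * `|s - t|.
Proof.
have D0 := trunc_den_gt0 s; have E0 := trunc_den_gt0 t.
have -> : trunc s - trunc t = (s - t) *
    (2 * ((1 + c * (t * t)) ^+ 2 - c * t * (s + t) * (2 + c * (s * s) + c * (t * t))) /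
    ((1 + c * (s * s)) ^+ 2 * (1 + c * (t * t)) ^+ 2)).
  by rewrite /trunc; field; rewrite !gt_eqF.
rewrite normrM mulrC ler_wpM2r// normf_div [`|_ * _ ^+ 2|]ger0_norm; last first.
  by rewrite mulr_ge0// sqr_ge0.
rewrite ler_pdivrMr ?mulr_gt0 ?exprn_gt0//.
have x0 : 0 <= c * (s * s) by rewrite mulr_ge0 ?(ltW c0)// -expr2 sqr_ge0.
have y0 : 0 <= c * (t * t) by rewrite mulr_ge0 ?(ltW c0)// -expr2 sqr_ge0.
have xy : `|c * (t * s)| <= (c * (s * s) + c * (t * t)) / 2.
  rewrite normrM gtr0_norm// -mulrDr -mulrA ler_wpM2l ?(ltW c0)//.
  rewrite ler_norml; have := sqr_ge0 (s - t); have := sqr_ge0 (s + t).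
  by move=> h1 h2; apply/andP; split; nra.
have -> : c * t * (s + t) = c * (t * s) + c * (t * t) by ring.
move: (c * (s * s)) (c * (t * t)) (c * (t * s)) x0 y0 xy {D0 E0} => x y z x0 y0.
rewrite !ler_norml => /andP[z1 z2].
have xy0 := mulr_ge0 x0 y0; have xx0 := sqr_ge0 x; have yy0 := sqr_ge0 y.
have h1 : (1 + x) ^+ 2 * (1 + y) ^+ 2 >= 1 + 2 * x + 2 * y + x ^+ 2 + y ^+ 2 + 4 * x * y.
  have := mulr_ge0 xy0 x0; have := mulr_ge0 xy0 y0; have := mulr_ge0 xy0 xy0.
  by rewrite !expr2; nra.
have s0 : 0 <= 2 + x + y by rewrite !addr_ge0.
have := ler_wpM2r s0 z1; have := ler_wpM2r s0 z2 => h2 h3.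
by apply/andP; split; nra.
Qed.

Lemma trunc_continuous : continuous trunc.
Proof.
move=> s; apply: (@continuousM R R (fun s => 2 * s)).
  by apply: (@continuousM R R (fun=> 2) id); [exact: cst_continuous|exact: id].
have h : {for s, continuous (fun s => (1 + c * (s * s))^-1)}.
  apply: (@continuousV R R (fun s => 1 + c * (s * s))); first by rewrite gt_eqF ?trunc_den_gt0.
  apply: (@continuousD R R^o R (fun=> 1) (fun s => c * (s * s))); first exact: cst_continuous.
  apply: (@continuousM R R (fun=> c) (fun s => s * s)); first exact: cst_continuous.
  by apply: (@continuousM R R id id); exact: id.
exact: (@continuousM R R _ _ _ h h).
Qed.

End truncation.

Section convection.
Context {R : realType} {d : nat}.
Variable Omega : set 'rV[R]_d.
Hypothesis oO : open Omega.
Hypothesis bO : bounded_set Omega.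

Local Notation E := 'rV[R]_d.
Local Notation mu := (lebesgue_rV R d).
Local Notation L2 := (L2 Omega).
Local Notation ips := (ips Omega).
Local Notation nrm := (nrmL2 Omega).
Local Notation test_fun := (test_fun Omega).
Local Notation wpd := (wpd Omega).
Local Notation H10 := (H10 Omega).
Let mO : measurable Omega := open_measurable_rV oO.
Let fO : (lebesgue_rV R d Omega < +oo)%E := bounded_finite_measure bO mO.
Implicit Types (f g e phi : E -> R).

Lemma L2_bounded_mul f g K : measurable_fun Omega f -> (forall x, Omega x -> `|f x| <= K) ->
  L2 g -> L2 (fun x => f x * g x).
Proof.
move=> mf fK Lg; apply: (le_L2 mO _ (L2Z mO K Lg)).
  by apply: measurable_funM => //; exact: L2_measurable Lg.
move=> x Ox; rewrite !normrM ler_wpM2r//; exact: le_trans (fK x Ox) (ler_norm _).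
Qed.

Lemma L2_norm f : L2 f -> L2 (fun x => `|f x|).
Proof.
move=> Lf; apply: (le_L2 mO _ Lf); last by move=> x _; rewrite normr_id.
by apply: measurableT_comp => //; exact: L2_measurable Lf.
Qed.

Lemma nrm_norm f : nrm (fun x => `|f x|) = nrm f.
Proof.
congr Num.sqrt; apply: eq_Rintegral => x _.
by rewrite -normrM ger0_norm// -expr2 sqr_ge0.
Qed.

Section truncated.
Variable c : R.
Hypothesis c0 : 0 < c.

Lemma trunc_measurable f : measurable_fun Omega f -> measurable_fun Omega (fun x => trunc c (f x)).
Proof.
by move=> mf; apply: measurableT_comp => //; exact: (continuous_measurable_fun (trunc_continuous c0)).
Qed.

Lemma L2_trunc_mul f g : L2 f -> L2 g -> L2 (fun x => trunc c (f x) * g x).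
Proof.
move=> Lf; apply: L2_bounded_mul; first exact: trunc_measurable (L2_measurable mO Lf).
by move=> x _; exact: trunc_bound.
Qed.

(** The primitive of the truncation is rational with nonvanishing denominator and vanishes at 0, so
    [phi^2 / (1 + c phi^2)] is again a test function, and its gradient is [trunc(phi) grad phi]. *)
Lemma trunc_test phi : test_fun phi -> exists psi, test_fun psi /\
  forall j, pd j psi = fun x => trunc c (phi x) * pd j phi x.
Proof.
move=> tphi; have sphi := test_smooth tphi.
have d1 x : differentiable (phi : E -> R^o) x by exact: smooth_diff.
have s2 : smooth (fun x => phi x * phi x) by exact: smoothM.
have d2 x : differentiable ((fun x => phi x * phi x) : E -> R^o) x by exact: smooth_diff.
have sc a : smooth ((fun=> a) : E -> R) by exact: smooth_cst.
have dc a x : differentiable ((fun=> a) : E -> R^o) x by exact: smooth_diff.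
have s3 : smooth (fun x => c * (phi x * phi x)) by exact: smoothM.
have d3 x : differentiable ((fun x => c * (phi x * phi x)) : E -> R^o) x by exact: smooth_diff.
have s4 : smooth (fun x => 1 + c * (phi x * phi x)) by exact: smoothD.
have d4 x : differentiable ((fun x => 1 + c * (phi x * phi x)) : E -> R^o) x by exact: smooth_diff.
have n4 x : 1 + c * (phi x * phi x) != 0 by rewrite gt_eqF// trunc_den_gt0.
have s5 := smoothV n4 s4.
have d5 x : differentiable ((fun x => (1 + c * (phi x * phi x))^-1) : E -> R^o) x by exact: smooth_diff.
exists (fun x => phi x * phi x * (1 + c * (phi x * phi x))^-1); split.
  apply: (test_fun_support tphi); first exact: smoothM.
  by move=> x ->; rewrite !mul0r.
move=> j; rewrite pdM// pdV// pdD// pdM// pdM// !pd_cst.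
by apply/funext => x; rewrite /trunc; field.
Qed.

(** With [a] only in L^2, a limit of products is not controlled directly. The truncated products
    stay bounded in L^2, so replacing [a] by a bounded test function [b] costs little; against [b],
    convergence in L^1 suffices, and it follows from the Lipschitz bound and the sup bound of the
    truncation. *)
Lemma trunc_term_lim a e j eps : L2 a -> H10 e -> 0 < eps ->
  \forall de \near (0 : R)^'+, forall phi, test_fun phi ->
    nrm (fun x => e x - phi x) < de -> nrm (fun x => wpd j e x - pd j phi x) < de ->
    `|ips a (fun x => trunc c (e x) * wpd j e x) -
      ips a (fun x => trunc c (phi x) * pd j phi x)| <= eps.
Proof.
move=> La He eps0; have Le := H10_L2 He; have Lde : L2 (wpd j e) by apply: wpd_L2 => //; case: He.
pose N := 1 + c^-1; pose D := nrm (wpd j e).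
have D0 : 0 <= D by exact: nrm_ge0.
have N0 : 0 < N by rewrite /N ltr_wpDr// invr_ge0 ltW.
(* Bounds the L^2 norm of the difference of the two truncated products: [N D] for the first and
   [N (D + 1)] for the second, as [de <= 1]. *)
pose C1 := N * (2 * D + 1).
have C10 : 0 < C1 by rewrite mulr_gt0// ltr_wpDl// mulr_ge0.
have e1 : 0 < eps / 2 / C1 by rewrite !divr_gt0.
have [b tb ab] := test_dense oO fO La e1.
have Lb := test_L2 oO fO tb; have [B bB] := test_bounded tb.
have B0 : 0 <= B by exact: le_trans (normr_ge0 _) (bB 0).
(* The L^1 estimate per unit of [de]: the Lipschitz constant 6 times the norm of the derivative,
   plus the sup bound [N] times the norm of 1. *)
pose C2 := B * (6 * D + N * nrm (fun=> 1)).
have C20 : 0 <= C2.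
  by rewrite mulr_ge0// addr_ge0// mulr_ge0// ?nrm_ge0// ltW.
near=> de => phi tphi ephi dphi.
have de1 : de <= 1 by near: de; exact: nbhs_right_le.
have deC : de * C2 <= eps / 2.
  have : de <= eps / 2 / (C2 + 1).
    near: de; apply: nbhs_right_le; rewrite !divr_gt0//; exact: ltr_wpDl.
  rewrite ler_pdivlMr ?ltr_wpDl//; apply: le_trans.
  by rewrite ler_wpM2l ?lerDl// (le_trans (nrm_ge0 _ _) (ltW ephi)).
have Lphi := test_L2 oO fO tphi; have Ldphi := test_L2 oO fO (test_fun_pd j tphi).
set g := fun x => trunc c (e x) * wpd j e x.
set h := fun x => trunc c (phi x) * pd j phi x.
have Lg : L2 g by exact: L2_trunc_mul.
have Lh : L2 h by exact: L2_trunc_mul.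
have Lgh : L2 (fun x => g x - h x) by exact: L2B.
have -> : ips a g - ips a h =
    ips (fun x => a x - b x) (fun x => g x - h x) + ips b (fun x => g x - h x).
  by rewrite ipsBl// !ipsBr//; ring.
apply: le_trans (ler_normD _ _) _; rewrite [eps]splitr; apply: lerD.
  apply: le_trans (cauchy_schwarz mO (L2B mO La Lb) Lgh) _.
  have nN f k : L2 f -> L2 k -> nrm (fun x => trunc c (f x) * k x) <= N * nrm k.
    move=> Lf Lk; rewrite -[X in X * _](gtr0_norm N0) -(nrmZ mO _ Lk).
    apply: le_nrm => //; [exact: L2_trunc_mul|exact: L2Z|].
    apply: aeW => x Ox; rewrite normrM [leRHS]normrM ler_wpM2r// (gtr0_norm N0).
    exact: trunc_bound.
  have hgh : nrm (fun x => g x - h x) <= C1.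
    apply: le_trans (nrmB mO Lg Lh) _; apply: le_trans (lerD (nN _ _ Le Lde) (nN _ _ Lphi Ldphi)) _.
    rewrite -mulrDr /C1 ler_wpM2l ?(ltW N0)// mulr_natl mulr2n -addrA lerD2l.
    rewrite (_ : pd j phi = fun x => wpd j e x - (wpd j e x - pd j phi x)); last first.
      by apply/funext => x; rewrite opprB addrC subrK.
    apply: le_trans (nrmB mO Lde (L2B mO Lde Ldphi)) _.
    by rewrite lerD2l (le_trans (ltW dphi)).
  apply: le_trans (ler_pM (nrm_ge0 _ _) (nrm_ge0 _ _) (ltW ab) hgh) _.
  by rewrite divfK// gt_eqF.
apply: le_trans deC.
have Lep : L2 (fun x => `|e x - phi x|) by apply: L2_norm; exact: L2B.
have Ldp : L2 (fun x => `|wpd j e x - pd j phi x|) by apply: L2_norm; exact: L2B.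
have Lwn := L2_norm Lde; have L1 := L2_cst oO fO 1.
apply: le_trans (le_normr_Rintegral mO _) _; first exact: (L2M_sint mO Lb Lgh).
apply: (@le_trans _ _ (\int[mu]_(x in Omega)
  (B * 6 * (`|e x - phi x| * `|wpd j e x|) + B * N * (1 * `|wpd j e x - pd j phi x|)))).
  have i1 := integrableZl mO (B * 6) (L2M_sint mO Lep Lwn).
  have i2 := integrableZl mO (B * N) (L2M_sint mO L1 Ldp).
  apply: le_Rintegral => //.
  - exact: (integrable_abse (L2M_sint mO Lb Lgh)).
  - exact: (integrableD mO i1 i2).
  - move=> x Ox; rewrite normrM.
    apply: (@le_trans _ _ (B * (6 * (`|e x - phi x| * `|wpd j e x|) + N * (1 * `|wpd j e x - pd j phi x|)))).
      apply: ler_pM => //; rewrite /g /h.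
      rewrite (_ : _ - _ = (trunc c (e x) - trunc c (phi x)) * wpd j e x +
        trunc c (phi x) * (wpd j e x - pd j phi x)); last by ring.
      apply: le_trans (ler_normD _ _) _; rewrite (normrM (_ - _)) (normrM (trunc _ _)) mul1r mulrA; apply: lerD.
        by rewrite ler_wpM2r// trunc_lipschitz.
      by rewrite ler_wpM2r// trunc_bound.
    by rewrite mulrDr !mulrA.
rewrite RintegralD//; try exact: (integrableZl mO _ (L2M_sint mO Lep Lwn));
  try exact: (integrableZl mO _ (L2M_sint mO L1 Ldp)).
rewrite (RintegralZl _ mO (L2M_sint mO Lep Lwn)) (RintegralZl _ mO (L2M_sint mO L1 Ldp)).
have := le_trans (ler_norm _) (cauchy_schwarz mO Lep Lwn).
have := le_trans (ler_norm _) (cauchy_schwarz mO L1 Ldp).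
rewrite /Defs.ips !nrm_norm => h1 h2.
have k1 : nrm (fun x => e x - phi x) * nrm (wpd j e) <= de * D by rewrite ler_wpM2r// ltW.
have k2 : nrm (fun=> 1) * nrm (fun x => wpd j e x - pd j phi x) <= nrm (fun=> 1) * de.
  by rewrite ler_wpM2l ?nrm_ge0// ltW.
have -> : de * C2 = B * 6 * (de * D) + B * N * (nrm (fun=> 1) * de) by rewrite /C2; ring.
apply: lerD; apply: ler_wpM2l; rewrite ?mulr_ge0 ?(ltW N0)//.
  exact: le_trans h2 k1.
exact: le_trans h1 k2.
Unshelve. all: by end_near. Qed.

(** For a test function the integrand is [a . grad psi] with [psi] a test function, so weak
    divergence-freeness applies. One [de] is taken that serves all components, and the total error
    is at most [d eps]. *)
Lemma convection_trunc (a : E -> E) e : L2v Omega a -> divfree Omega a -> H10 e ->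
  \sum_j ips (fun x => a x ord0 j) (fun x => trunc c (e x) * wpd j e x) = 0.
Proof.
move=> La da He; apply: (@small_eq0 _ _ d%:R) => eps eps0.
have near0 : \forall de \near (0 : R)^'+, forall j phi, test_fun phi ->
    nrm (fun x => e x - phi x) < de -> nrm (fun x => wpd j e x - pd j phi x) < de ->
    `|ips (fun x => a x ord0 j) (fun x => trunc c (e x) * wpd j e x) -
      ips (fun x => a x ord0 j) (fun x => trunc c (phi x) * pd j phi x)| <= eps.
  by apply: filter_forall => j; exact: trunc_term_lim.
have [de [de0 H]] : exists de, 0 < de /\ forall j phi, test_fun phi ->
    nrm (fun x => e x - phi x) < de -> nrm (fun x => wpd j e x - pd j phi x) < de ->
    `|ips (fun x => a x ord0 j) (fun x => trunc c (e x) * wpd j e x) -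
      ips (fun x => a x ord0 j) (fun x => trunc c (phi x) * pd j phi x)| <= eps.
  near (0 : R)^'+ => de; exists de; split.
    by near: de; exact: nbhs_right_gt.
  by near: de.
have [phi tphi [ephi dphi]] := H10_approx oO bO He de0.
have [psi [tpsi psiE]] := trunc_test tphi.
have S0 := (divfreeP oO bO La).1 da _ tpsi.
set S := (X in `|X|); have -> : S = S - 0 by rewrite subr0.
rewrite -S0 /S -sumrB.
apply: le_trans (ler_norm_sum _ _ _) _.
apply: (@le_trans _ _ (\sum_(j < d) eps)); last by rewrite sumr_const card_ord mulr_natr.
by apply: ler_sum => j _; rewrite psiE; exact: H.
Unshelve. all: by end_near. Qed.

End truncated.

(** With [c = 1/(n+1)] the truncations of [e] tend to [2 e] and are bounded by [2 |e|], so [2 |X e|]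
    dominates. Only the whole product [X e] is assumed integrable, not its summands, so the sum over
    [j] is kept together in the limit. *)
Lemma convection_skew (a : E -> E) e : L2v Omega a -> divfree Omega a -> H10 e ->
  mu.-integrable Omega (fun x => ((\sum_j a x ord0 j * wpd j e x) * e x)%:E) ->
  \int[mu]_(x in Omega) ((\sum_j a x ord0 j * wpd j e x) * e x) = 0.
Proof.
move=> La da He ie; have Le := H10_L2 He.
have Lde j : L2 (wpd j e) by apply: wpd_L2 => //; case: He.
set X := fun x => \sum_j a x ord0 j * wpd j e x.
have mX : measurable_fun Omega X.
  apply: measurable_sum => j; apply: measurable_funM.
    exact: L2_measurable (La j).
  exact: L2_measurable (Lde j).
pose c n : R := n.+1%:R^-1.
have c0 n : 0 < c n by rewrite invr_gt0.
have mT n : measurable_fun Omega (fun x => X x * trunc (c n) (e x)).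
  by apply: measurable_funM => //; exact: trunc_measurable (L2_measurable mO Le).
have i2 := integrableZl mO 2 (integrable_abse ie).
have bound n x : `|X x * trunc (c n) (e x)| <= 2 * `|X x * e x|.
  by rewrite normrM [in leRHS]normrM mulrCA ler_wpM2l// trunc_le.
have iT n : mu.-integrable Omega (fun x => (X x * trunc (c n) (e x))%:E).
  apply: (le_sint mO (mT n) i2) => x Ox.
  by rewrite (le_trans (bound n x))// ler_norm.
have T0 n : \int[mu]_(x in Omega) (X x * trunc (c n) (e x)) = 0.
  rewrite -[RHS](convection_trunc (c0 n) La da He).
  transitivity (\int[mu]_(x in Omega) \sum_j a x ord0 j * (trunc (c n) (e x) * wpd j e x)).
    by apply: eq_Rintegral => x _; rewrite /X mulr_suml; apply: eq_bigr => j _; ring.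
  rewrite (Rintegral_sum mO)// => j; apply: L2M_sint => //.
  exact: L2_trunc_mul.
have [] := @dominated_convergence _ _ _ mu _ mO
  (fun n x => (X x * trunc (c n) (e x))%:E) (fun x => (X x * (2 * e x))%:E) _ _ _ _ i2.
- by move=> n; apply/measurable_EFinP.
- apply/measurable_EFinP; apply: measurable_funM => //; apply: measurable_funM => //.
  exact: L2_measurable Le.
- apply: aeW => x Ox; apply: cvg_EFin; first exact: nearW.
  have cn0 : c @ \oo --> (0 : R) by exact: cvg_harmonic.
  have h1 : (fun n => 1 + c n * (e x * e x)) @ \oo --> (1 : R).
    have h : (fun n => 1 + c n * (e x * e x)) @ \oo --> 1 + 0 * (e x * e x).
      by apply: cvgD; [exact: cvg_cst|apply: cvgM; [exact: cn0|exact: cvg_cst]].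
    by move: h; rewrite mul0r addr0.
  have h2 : (fun n => (1 + c n * (e x * e x))^-1) @ \oo --> (1 : R).
    have h : (fun n => (1 + c n * (e x * e x))^-1) @ \oo --> (1^-1 : R).
      by apply: cvgV => //; exact: oner_neq0.
    by move: h; rewrite invr1.
  have h3 : (fun n => X x * trunc (c n) (e x)) @ \oo --> X x * (2 * e x * (1 * 1)).
    apply: cvgM; first exact: cvg_cst.
    by apply: cvgM; [exact: cvg_cst|exact: cvgM].
  by move: h3; rewrite !mulr1.
- by apply: aeW => x n Ox; rewrite lee_fin; exact: bound.
move=> i3 _ cv; have {}cv : ((fun=> 0%E) : nat -> \bar R) @ \oo -->
    (\int[mu]_(x in Omega) (X x * (2 * e x))%:E)%E.
  apply: cvg_trans cv; apply: near_eq_cvg; apply: nearW => n.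
  have := T0 n; rewrite /Rintegral => h.
  rewrite -[0%E]/(0%:E) -h; exact: esym (fineK (integrable_fin_num mO (iT n))).
have I0 : (\int[mu]_(x in Omega) (X x * (2 * e x))%:E = 0)%E.
  by rewrite -(cvg_lim _ cv)//; exact: lim_cst.
have : \int[mu]_(x in Omega) (2 * (X x * e x)) = 0.
  rewrite /Rintegral (_ : (\int[mu]_(x in Omega) (2 * (X x * e x))%:E)%E = 0%E)//.
  by rewrite -[RHS]I0; apply: eq_integral => x _; rewrite mulrCA.
by rewrite RintegralZl// => /eqP; rewrite mulf_eq0 pnatr_eq0/= => /eqP.
Qed.

End convection.

(** * Bounds in time *)

Section time_regularity.
Context {R : realType} {d : nat}.
Variable Omega : set 'rV[R]_d.
Hypothesis oO : open Omega.
Hypothesis bO : bounded_set Omega.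

Local Notation E := 'rV[R]_d.
Local Notation mu := (lebesgue_rV R d).
Local Notation L2 := (L2 Omega).
Local Notation L2v := (L2v Omega).
Local Notation ips := (ips Omega).
Local Notation ip := (ip Omega).
Local Notation nrm := (nrmL2 Omega).
Local Notation L2norm := (L2norm Omega).
Local Notation wpd := (wpd Omega).
Local Notation gradv := (gradv Omega).
Let mO : measurable Omega := open_measurable_rV oO.
Let fO : (lebesgue_rV R d Omega < +oo)%E := bounded_finite_measure bO mO.
Implicit Types (w wt : R -> E -> E).

(** The discrete times form a null set, so what is needed is a bound at every positive time; the
    maximum with 0 makes it nonnegative. *)
Lemma LinftyT_bound (V : Type) (B : set V) (N : V -> R) D (g : R -> V) :
  LinftyT B (fun v => (N v)%:E) D g ->
  exists M, 0 <= M /\ forall t, 0 < t -> B (g t) /\ N (g t) <= M.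
Proof.
move=> [Bg _ fin le]; set S := LinftyT_norm _ _ in fin le.
exists (Num.max 0 (fine S)); split; first by rewrite le_max lexx.
move=> t t0; split; first exact: Bg.
rewrite le_max; apply/orP; right; rewrite -lee_fin fineK ?le//.
by rewrite fin_real// fin andbT (lt_le_trans (ltNyr _) (le t t0)).
Qed.

Lemma Hkv_L2v k (u : E -> E) : Hkv Omega k u -> L2v u.
Proof. by move=> Hu i; have [] := Hu i. Qed.

Lemma Hk_norm_le_Hkv k (u : E -> E) i : Hk_norm Omega k (fun x => u x ord0 i) <= Hkv_norm Omega k u.
Proof.
have h j : 0 <= Hk_sqnorm Omega k (fun x => u x ord0 j).
  by apply: sumr_ge0 => ? _; exact: ips_ge0.
rewrite ler_sqrt; last by apply: sumr_ge0.
by rewrite (bigD1 i)//= lerDl sumr_ge0.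
Qed.

Lemma L2norm_le_Hkv k (u : E -> E) : L2v u -> L2norm u <= Hkv_norm Omega k u.
Proof.
move=> Lu; rewrite ler_sqrt; last first.
  by apply: sumr_ge0 => ? _; apply: sumr_ge0 => ? _; exact: ips_ge0.
rewrite (ip_rV oO)//; apply: ler_sum => i _; rewrite -nrm_sqr.
have h := nrm_Hk_le oO bO k (Lu i).
rewrite -[leRHS]sqr_sqrtr; last by apply: sumr_ge0 => ? _; exact: ips_ge0.
by rewrite ler_pXn2r// ?nnegrE ?nrm_ge0 ?sqrtr_ge0.
Qed.

(** The integral identity is tested with the increment [D] itself, giving
    [|D|^2 <= (t - s) W |D|]. *)
Lemma tderiv_lipschitz w wt W s t : is_tderiv Omega w wt ->
  (forall r, 0 < r -> L2v (wt r) /\ L2norm (wt r) <= W) -> 0 <= s -> s <= t ->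
  L2v (w s) -> L2v (w t) -> L2norm (w t - w s) <= (t - s) * W.
Proof.
move=> dw wtW s0 st Ls Lt; set D := w t - w s.
have LD : L2v D by apply/L2vP/(L2mB oO); exact/L2vP.
have [iD DE] := dw _ LD _ _ s0 st.
have [->|n0] := eqVneq (L2norm D) 0.
  rewrite mulr_ge0 ?subr_ge0//.
  exact: le_trans (L2norm_ge0 _ _) (wtW 1 ltr01).2.
have {}n0 : 0 < L2norm D by rewrite lt_def n0 L2norm_ge0.
rewrite -(ler_pM2r n0) -expr2 L2norm_sqr [leLHS]DE.
(* The left endpoint is removed because [s] may be 0, where [wt] is not controlled. *)
have iD' : (@lebesgue_measure R).-integrable `]s, t] (fun r => (ip (wt r) D)%:E).
  by apply: integrableS iD => //; exact: subset_itv_oc_cc.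
rewrite -Rintegral_itv_obnd_cbnd//.
apply: le_trans (ler_norm _) _; apply: le_trans (le_normr_Rintegral _ iD') _ => //.
apply: (@le_trans _ _ (\int[@lebesgue_measure R]_(r in `]s, t]) (W * L2norm D))).
  apply: le_Rintegral => //.
  - exact: integrable_abse iD'.
  - apply/integrableP; split; first exact: measurable_cst.
    rewrite integral_cst//= lebesgue_measure_itv/=.
    by case: ifP => _; rewrite ?mule0// -EFinB -EFinM ltry.
  - move=> r /=; rewrite in_itv/= => /andP[sr _].
    have [Lr rW] := wtW r (le_lt_trans s0 sr).
    apply: le_trans (ip_cauchy_schwarz oO _ _) _; try exact/L2vP.
    by rewrite ler_wpM2r// L2norm_ge0.
rewrite Rintegral_cst//= lebesgue_measure_itv/= lte_fin.
case: ltgtP st => // [st _|-> _]; last by rewrite mulr0 subrr !mul0r.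
by rewrite mulrC mulrA.
Qed.

Lemma fnorm_ge (m n : nat) (A : 'M[R]_(m, n)) i j : `|A i j| <= fnorm A.
Proof.
rewrite -sqrtr_sqr ler_sqrt dotmE (bigD1 i)//= (bigD1 j)//= -?addrA.
  rewrite -expr2 lerDl addr_ge0//; do ?[apply: sumr_ge0 => ? _]; by rewrite -expr2 sqr_ge0.
rewrite !addr_ge0//; do ?[apply: sumr_ge0 => ? _]; by rewrite -expr2 sqr_ge0.
Qed.

Lemma Linfty_norm_ae (m n : nat) (F : E -> 'M[R]_(m, n)) K :
  (Linfty_norm Omega F <= K%:E)%E ->
  forall i j, {ae mu, forall x, Omega x -> `|F x i j| <= K}.
Proof.
rewrite /Linfty_norm unlock; case: ifPn => [_ /ess_supP FK i j|mu0 _ i j].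
  move: FK; apply: filterS => x /=; rewrite patchE => + Ox.
  rewrite mem_set//= lee_fin ger0_norm ?sqrtr_ge0//; apply: le_trans.
  exact: fnorm_ge.
(* Here the whole space has measure zero and the norm takes its default value, but then everything
   holds almost everywhere. *)
exists setT; split => //; apply/eqP; rewrite -measure_le0.
by rewrite leNgt.
Qed.

(* The weak convergence hypothesis is tested against the positive part of [g - K]. *)
Lemma weak_limit_bound (g : E -> R) K : L2 g ->
  (forall psi, L2 psi -> forall eps, 0 < eps -> exists h,
    [/\ L2 h, {ae mu, forall x, Omega x -> `|h x| <= K} &
      `|ips (fun x => g x - h x) psi| <= eps]) ->
  {ae mu, forall x, Omega x -> `|g x| <= K}.
Proof.
have upper (f : E -> R) : L2 f ->
  (forall psi, L2 psi -> forall eps, 0 < eps -> exists h,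
    [/\ L2 h, {ae mu, forall x, Omega x -> `|h x| <= K} &
      `|ips (fun x => f x - h x) psi| <= eps]) ->
  {ae mu, forall x, Omega x -> f x <= K}.
  move=> Lf H; pose psi x := Num.max (f x - K) 0.
  have LfK : L2 (fun x => f x - K) by apply: L2B => //; exact: L2_cst.
  have Lpsi : L2 psi.
    apply: (le_L2 mO _ LfK) => [|x _].
      by apply: measurable_maxr => //; exact: L2_measurable LfK.
    by rewrite /psi maxEle; case: ifP => _; rewrite ?normr0.
  suff : ips psi psi = 0.
    move=> /(ips0_ae mO Lpsi); apply: filterS => x /[apply] h.
    by rewrite -subr_le0 -h /psi le_max lexx.
  apply: (@small_eq0 _ _ 1) => e e0; rewrite mulr1 ger0_norm ?ips_ge0//.
  have [h [Lh hK hpsi]] := H _ Lpsi _ e0.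
  apply: le_trans hpsi; apply: le_trans (ler_norm _).
  have Lfh : L2 (fun x => f x - h x) by exact: L2B.
  apply: le_Rintegral_ae => //; [exact: L2M_sint|exact: L2M_sint|].
  move: hK; apply: filterS => x hK Ox.
  rewrite /psi maxEle; case: ifPn => [_|]; first by rewrite !mulr0.
  rewrite -ltNge => fK; rewrite ler_wpM2r ?(ltW fK)// lerD2l lerN2.
  exact: le_trans (ler_norm _) (hK Ox).
move=> Lg H; have Lng : L2 (fun x => - g x) by exact: L2N.
have up := upper _ Lg H.
have lo : {ae mu, forall x, Omega x -> - g x <= K}.
  apply: upper => // psi Lpsi e e0; have [h [Lh hK hpsi]] := H _ Lpsi _ e0.
  exists (fun x => - h x); split; first exact: L2N.
    by move: hK; apply: filterS => x; rewrite normrN.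
  rewrite (_ : (fun _ => _) = fun x => - (g x - h x)); last by apply/funext => x; ring.
  by rewrite ipsNl// ?normrN//; exact: L2B.
apply: filterS2 up lo => x up lo Ox.
by rewrite ler_norml up// andbT lerNl lo.
Qed.

(** Every interval [(t, t + de)] has positive measure, so it contains a time [s] at which the bound
    holds. Against a test function [phi], the derivative is moved onto [phi] and the difference
    between the times [t] and [s] is at most [(s - t) W |pd j phi|]. The bound [M], uniform in time,
    extends this to every [psi] in L^2 by density. *)
Lemma gradv_ae_bound w wt M W K : is_tderiv Omega w wt -> 0 <= W -> 0 <= M ->
  (forall r, 0 < r -> L2v (wt r) /\ L2norm (wt r) <= W) ->
  (forall t, 0 < t -> forall i, Hk Omega 1 (fun x => w t x ord0 i)) ->
  (forall t, 0 < t -> forall i j, nrm (wpd j (fun x => w t x ord0 i)) <= M) ->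
  (LinftyT_norm (fun u => Linfty_norm Omega (gradv u)) w <= K%:E)%E ->
  forall t, 0 < t -> forall i j, {ae mu, forall x, Omega x ->
    `|wpd j (fun y => w t y ord0 i) x| <= K}.
Proof.
move=> dw W0 M0 wtW Hw gM /ess_supP[N [mN N0 subN]] t t0 i j.
have good de : 0 < de -> exists s, [/\ t < s, s < t + de &
    forall i j, {ae mu, forall x, Omega x -> `|wpd j (fun y => w s y ord0 i) x| <= K}].
  move=> de0; have : ~ (`]t, t + de[%classic `<=` N).
    move=> tN; have : (lebesgue_measure (`]t, (t + de)%R[%classic : set R) <= 0)%E.
      rewrite -N0; apply: le_measure; rewrite ?inE//.
        by apply: measurableI.
      move=> x tx; split; first exact: tN.
      by move: tx; rewrite /= !in_itv/= andbT => /andP[tx _]; exact: lt_trans tx.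
    rewrite lebesgue_measure_itv/= lte_fin ltrDl de0 -EFinD lee_fin addrAC subrr add0r.
    by rewrite leNgt de0.
  move=> /existsNP[s /not_implyP[]]; rewrite /= in_itv/= => /andP[ts tde] Ns.
  exists s; split=> // i' j'.
  have : (Linfty_norm Omega (gradv (w s)) <= K%:E)%E.
    by apply: contrapT => h; apply: Ns; exact: subN.
  move=> /Linfty_norm_ae /(_ i' j'); apply: filterS => x /[apply].
  by rewrite mxE.
have Ht := Hw _ t0 i; have Lt := wpd_L2 j Ht.
apply: weak_limit_bound => // psi Lpsi e e0.
have e1 : 0 < e / 2 / (2 * M + 1) by rewrite !divr_gt0// ltr_wpDl// mulr_ge0.
have [phi tphi psiphi] := test_dense oO fO Lpsi e1.
have Lphi := test_L2 oO fO tphi; have Ldphi := test_L2 oO fO (test_fun_pd j tphi).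
pose C := W * nrm (pd j phi); have C0 : 0 <= C by rewrite mulr_ge0// nrm_ge0.
have de0 : 0 < e / 2 / (C + 1) by rewrite !divr_gt0// ltr_wpDl.
have [s [ts sde sK]] := good _ de0; have s0 : 0 < s by exact: lt_trans ts.
have Hs := Hw _ s0 i; have Ls := wpd_L2 j Hs.
exists (wpd j (fun x => w s x ord0 i)); split=> //.
have Lts := L2B mO Lt Ls.
have Lw r : 0 < r -> L2v (w r) by move=> r0 i'; have [] := Hw _ r0 i'.
have Lsw : L2m Omega (w s - w t) by apply: (L2mB oO); apply/L2vP; exact: Lw.
set G := fun x => _ - _.
have Gphi : ips G phi = ips (fun x => (w s - w t) x ord0 i) (pd j phi).
  rewrite [LHS]ipsBl//.
  have -> : (fun x => (w s - w t) x ord0 i) = fun x => w s x ord0 i - w t x ord0 i.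
    by apply/funext => x; rewrite !mxE.
  rewrite ipsBl//; [|exact: Lw|exact: Lw].
  by rewrite (wpd_test j Ht tphi) (wpd_test j Hs tphi) opprK addrC.
have -> : ips G psi = ips (fun x => (w s - w t) x ord0 i) (pd j phi) + ips G (fun x => psi x - phi x).
  by rewrite -Gphi [in RHS]ipsBr// addrC subrK.
apply: le_trans (ler_normD _ _) _; rewrite [e]splitr; apply: lerD.
  apply: le_trans (cauchy_schwarz mO (Lsw ord0 i) Ldphi) _.
  apply: (@le_trans _ _ ((s - t) * W * nrm (pd j phi))).
    rewrite ler_wpM2r ?nrm_ge0//; apply: le_trans (nrm_le_L2norm oO ord0 i Lsw) _.
    by apply: (tderiv_lipschitz dw wtW) => //; [exact: ltW|exact: ltW|exact: Lw|exact: Lw].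
  have : (s - t) * (C + 1) <= e / 2.
    by rewrite -ler_pdivlMr ?ltr_wpDl// lerBlDl ltW.
  apply: le_trans; rewrite -mulrA -/C.
  by rewrite ler_wpM2l ?lerDl// subr_ge0 ltW.
apply: le_trans (cauchy_schwarz mO Lts (L2B mO Lpsi Lphi)) _.
apply: (@le_trans _ _ ((2 * M + 1) * (e / 2 / (2 * M + 1)))).
  apply: ler_pM; rewrite ?nrm_ge0 ?(ltW psiphi)//.
  apply: le_trans (nrmB mO Lt Ls) _; apply: le_trans (lerD (gM _ t0 i j) (gM _ s0 i j)) _.
  by rewrite mulr_natl mulr2n lerDl.
by rewrite mulrC divfK// gt_eqF// ltr_wpDl// mulr_ge0.
Qed.

End time_regularity.

(** * The energy estimate *)

Section energy_step.
Context {R : realType} {d : nat}.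
Variable Omega : set 'rV[R]_d.
Hypothesis oO : open Omega.
Hypothesis bO : bounded_set Omega.

Local Notation E := 'rV[R]_d.
Local Notation mu := (lebesgue_rV R d).
Local Notation L2 := (L2 Omega).
Local Notation L2v := (L2v Omega).
Local Notation ip := (ip Omega).
Local Notation nrm := (nrmL2 Omega).
Local Notation L2norm := (L2norm Omega).
Local Notation wpd := (wpd Omega).
Local Notation conv := (Defs.conv Omega).
Local Notation H10v := (H10v Omega).
Local Notation comp u i := (fun x => (u : E -> E) x ord0 i).
Let mO : measurable Omega := open_measurable_rV oO.
Implicit Types (a u v w e : E -> E).

Lemma convE a w x i : conv a w x ord0 i = \sum_j a x ord0 j * wpd j (comp w i) x.
Proof. by rewrite /Defs.conv mxE; apply: eq_bigr => j _; rewrite !mxE. Qed.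

Lemma L2norm_le_sum u : L2v u -> L2norm u <= \sum_i nrm (comp u i).
Proof.
move=> Lu; have S0 : 0 <= \sum_i nrm (comp u i) by apply: sumr_ge0 => i _; exact: nrm_ge0.
rewrite -(ler_pXn2r (n := 2)) ?nnegrE ?L2norm_ge0// L2norm_sqr (ip_rV oO)//.
apply: (@le_trans _ _ (\sum_i nrm (comp u i) * \sum_j nrm (comp u j))).
  apply: ler_sum => i _; rewrite -nrm_sqr expr2 ler_wpM2l ?nrm_ge0//.
  by rewrite (bigD1 i)//= lerDl sumr_ge0// => j _; exact: nrm_ge0.
by rewrite -mulr_suml expr2.
Qed.

Lemma nrm_sum (I : Type) (s : seq I) (f : I -> E -> R) : (forall i, L2 (f i)) ->
  nrm (fun x => \sum_(i <- s) f i x) <= \sum_(i <- s) nrm (f i).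
Proof.
move=> Lf; elim: s => [|i s IHs].
  under eq_fun do rewrite big_nil; rewrite big_nil.
  by rewrite /nrmL2 (ips0l mO) sqrtr0.
under eq_fun do rewrite big_cons; rewrite big_cons.
apply: le_trans (nrmD mO (Lf i) (L2_sum mO s Lf)) _.
by rewrite lerD2l.
Qed.

(** The factor counts the products [a_j wpd_j w_i], each of norm at most [K |a|]. *)
Lemma conv_L2 a w K : 0 <= K -> L2v a ->
  (forall i, Hk Omega 1 (comp w i)) ->
  (forall i j, {ae mu, forall x, Omega x -> `|wpd j (comp w i) x| <= K}) ->
  L2m Omega (conv a w) /\ L2norm (conv a w) <= (d ^ 2)%:R * K * L2norm a.
Proof.
move=> K0 La Hw wK; have Lw i j := wpd_L2 j (Hw i).
have Lp i j : L2 (fun x => a x ord0 j * wpd j (comp w i) x) /\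
    nrm (fun x => a x ord0 j * wpd j (comp w i) x) <= K * L2norm a.
  have ae_le : {ae mu, forall x, Omega x ->
      `|a x ord0 j * wpd j (comp w i) x| <= `|K * a x ord0 j|}.
    have := wK i j; apply: filterS => x wx Ox.
    by rewrite !normrM mulrC (ger0_norm K0) ler_wpM2r// wx.
  have LKa : L2 (fun x => K * a x ord0 j) by apply: L2Z => //; exact: La.
  have L : L2 (fun x => a x ord0 j * wpd j (comp w i) x).
    apply: (ae_le_L2 mO _ LKa ae_le); apply: measurable_funM.
      exact: L2_measurable (La j).
    exact: L2_measurable (Lw i j).
  split=> //; apply: le_trans (le_nrm mO L LKa ae_le) _.
  rewrite (nrmZ mO)// (ger0_norm K0) ler_wpM2l//.
  by apply: (nrm_le_L2norm oO ord0 j); exact/L2vP.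
have cE i : comp (conv a w) i = fun x => \sum_j a x ord0 j * wpd j (comp w i) x.
  by apply/funext => x; rewrite convE.
have Lc : L2v (conv a w).
  by move=> i; rewrite cE; apply: L2_sum => // j; exact: (Lp i j).1.
split; first exact/L2vP.
apply: le_trans (L2norm_le_sum Lc) _.
have -> : (d ^ 2)%:R * K * L2norm a = \sum_(i < d) \sum_(j < d) K * L2norm a.
  by rewrite !sumr_const !card_ord -mulrnA -[RHS]mulr_natl mulrA.
apply: ler_sum => i _; rewrite cE; apply: le_trans (nrm_sum _ _) _.
  by move=> j; exact: (Lp i j).1.
by apply: ler_sum => j _; exact: (Lp i j).2.
Qed.

(** Step 1 asserts integrability of the full scalar product with a test field; fields with a single
    nonzero component extract it for each component of the convection term. *)
Lemma H10v_single u i : H10v u -> H10v (fun x => u x ord0 i *: delta_mx ord0 i).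
Proof.
move=> Hu j; have [<-|ij] := eqVneq i j.
  rewrite (_ : (fun _ => _) = comp u i); first exact: Hu.
  by apply/funext => x; rewrite !mxE !eqxx mulr1.
have := H10_comb oO bO (-1) (Hu i) (Hu i); congr (Defs.H10 _ _).
by apply/funext => x; rewrite !mxE eqxx eq_sym (negbTE ij) mulr0 mulN1r addNr.
Qed.

(** Skew-symmetry is applied to each component of [e = w - u]. Its integrability hypothesis holds
    because the part with [w] is a product of L^2 functions and the part with [u] is integrable by
    assumption. *)
Lemma conv_ip_eq a u w K : 0 <= K -> L2v a -> divfree Omega a -> H10v u -> H10v w ->
  (forall i j, {ae mu, forall x, Omega x -> `|wpd j (comp w i) x| <= K}) ->
  (forall v, H10v v -> mu.-integrable Omega (fun x => (dotm (conv a u x) (v x))%:E)) ->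
  ip (conv a u) (fun x => w x - u x) = ip (conv a w) (fun x => w x - u x).
Proof.
move=> K0 La da Hu Hw wK iu; set e := fun x => w x - u x.
have He : H10v e by exact: H10vB.
have Hu1 i := H10_Hk1 (Hu i); have Hw1 i := H10_Hk1 (Hw i); have He1 i := H10_Hk1 (He i).
have [Lc _] := conv_L2 K0 La Hw1 wK.
have dotE b x : dotm (conv a b x) (e x) = \sum_i conv a b x ord0 i * e x ord0 i.
  by rewrite dotmE big_ord1.
have iui i : mu.-integrable Omega (fun x => (conv a u x ord0 i * e x ord0 i)%:E).
  have := iu _ (H10v_single i He); congr (integrable _ _ _).
  apply/funext => x; congr (_%:E); rewrite dotmE big_ord1 (bigD1 i)//= big1 => [|j ji].
    by rewrite !mxE !eqxx mulr1 addr0.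
  by rewrite !mxE eqxx (negbTE ji) !mulr0.
have iwi i : mu.-integrable Omega (fun x => (conv a w x ord0 i * e x ord0 i)%:E).
  by apply: L2M_sint => //; exact: H10_L2 (He i).
transitivity (\sum_i \int[mu]_(x in Omega) (conv a u x ord0 i * e x ord0 i)).
  by rewrite -(Rintegral_sum mO)//; apply: eq_Rintegral => x _; exact: dotE.
transitivity (\sum_i \int[mu]_(x in Omega) (conv a w x ord0 i * e x ord0 i)); last first.
  by rewrite -(Rintegral_sum mO)//; apply: eq_Rintegral => x _; rewrite dotE.
apply: eq_bigr => i _.
have ae_e : {ae mu, forall x, Omega x -> (\sum_j a x ord0 j * wpd j (comp e i) x) * e x ord0 i =
    conv a w x ord0 i * e x ord0 i - conv a u x ord0 i * e x ord0 i}.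
  have := gradvB_ae oO bO Hw1 Hu1; apply: filterS => x /[apply] h.
  rewrite !convE -mulrBl -sumrB; congr (_ * _); apply: eq_bigr => j _.
  by have /matrixP/(_ i j) := h; rewrite !mxE => ->; rewrite mulrBr.
have mS : measurable_fun Omega (fun x => (\sum_j a x ord0 j * wpd j (comp e i) x) * e x ord0 i).
  apply: measurable_funM; last exact: L2_measurable (H10_L2 (He i)).
  apply: measurable_sum => j; apply: measurable_funM; first exact: L2_measurable (La j).
  by apply: L2_measurable => //; exact: wpd_L2.
have iB := integrableB mO (iwi i) (iui i).
have iS : mu.-integrable Omega (fun x => ((\sum_j a x ord0 j * wpd j (comp e i) x) * e x ord0 i)%:E).
  apply: (ae_le_sint mO mS iB); move: ae_e; apply: filterS => x /[apply] ->.
  by [].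
have S0 := convection_skew oO bO La da (He i) iS.
apply/esym/eqP; rewrite -subr_eq0 -(RintegralB mO (iwi i) (iui i)) -[X in _ == X]S0.
apply/eqP; congr fine; apply: ae_eq_integral => //.
- by have /integrableP[] := iB.
- exact/measurable_EFinP.
- by move: ae_e; apply: filterS => x /[apply] ->.
Qed.

(** Here [a], [b], [g] are the norms of the new error, of the old projected error and of the
    gradient of the new error; [ii] is the nudging product. The interpolation defect [m CI H g a]
    takes [m a^2 / 2] and, as [m (CI H)^2 <= nu / 2], also [nu g^2 / 4]. The remaining [m a^2 / 2]
    is split evenly between the [A0] and [B0 b] terms, which leaves [1/m <= dt^2] in front of their
    squares. With [a b <= (a^2 + b^2) / 2] and a final factor [2 dt], the viscosity keeps
    [3/2 nu dt]. *)
Lemma energy_arith (a b g ie ii rhs nu m dt CI H A0 B0 : R) : 0 <= a -> 0 <= b -> 0 <= g ->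
  0 < nu -> 0 < dt -> 0 < CI -> 0 < m -> dt ^- 2 <= m -> m * H ^+ 2 <= nu / (2 * CI ^+ 2) ->
  ie <= a * b -> a ^+ 2 - CI * H * g * a <= ii -> rhs <= (A0 + B0 * b) * a ->
  dt^-1 * (a ^+ 2 - ie) + nu * g ^+ 2 + m * ii = rhs ->
  a ^+ 2 - b ^+ 2 + 3 / 2 * nu * dt * g ^+ 2 <= 2 * dt ^+ 3 * (A0 ^+ 2 + B0 ^+ 2 * b ^+ 2).
Proof.
move=> a0 b0 g0 nu0 dt0 CI0 m0 mdt mH hie hii hrhs eq.
have h1 : m * (CI * H) ^+ 2 <= nu / 2.
  move: mH; rewrite ler_pdivlMr ?mulr_gt0 ?exprn_gt0// => mH.
  rewrite ler_pdivlMr//; apply: le_trans mH; rewrite le_eqVlt; apply/orP; left.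
  by apply/eqP; ring.
have h2 : m * (CI * H * g * a) <= m * a ^+ 2 / 2 + nu * g ^+ 2 / 4.
  have := mulr_ge0 (ltW m0) (sqr_ge0 (a - CI * H * g)).
  have := ler_wpM2r (sqr_ge0 g) h1; lra.
have h3 : (A0 + B0 * b) * a <= m * a ^+ 2 / 2 + m^-1 * (A0 ^+ 2 + B0 ^+ 2 * b ^+ 2).
  have mV0 : 0 < m^-1 by rewrite invr_gt0.
  have e1 x : x * a <= m * a ^+ 2 / 4 + m^-1 * x ^+ 2.
    have := mulr_ge0 (ltW mV0) (sqr_ge0 (m * a / 2 - x)).
    rewrite (_ : m^-1 * (m * a / 2 - x) ^+ 2 = m * a ^+ 2 / 4 + m^-1 * x ^+ 2 - x * a); last first.
      by field; rewrite gt_eqF.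
    by rewrite subr_ge0.
  by have := e1 A0; have := e1 (B0 * b); rewrite exprMn; lra.
have h4 : m^-1 * (A0 ^+ 2 + B0 ^+ 2 * b ^+ 2) <= dt ^+ 2 * (A0 ^+ 2 + B0 ^+ 2 * b ^+ 2).
  apply: ler_wpM2r; first exact: addr_ge0 (sqr_ge0 _) (mulr_ge0 (sqr_ge0 _) (sqr_ge0 _)).
  by rewrite -[leRHS]invrK lef_pV2 ?posrE ?invr_gt0 ?exprn_gt0.
have h5 := ler_wpM2l (ltW m0) hii.
have h6 : dt^-1 * (a ^+ 2 - b ^+ 2) / 2 <= dt^-1 * (a ^+ 2 - ie).
  have dV0 : 0 < dt^-1 by rewrite invr_gt0.
  by rewrite -mulrA ler_wpM2l ?(ltW dV0)//; have := sqr_ge0 (a - b); nra.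
have h7 : dt^-1 * (a ^+ 2 - b ^+ 2) / 2 + 3 / 4 * nu * g ^+ 2 <=
    dt ^+ 2 * (A0 ^+ 2 + B0 ^+ 2 * b ^+ 2).
  by move: h2 h3 h4 h5 h6 hrhs; rewrite -eq mulrBr; lra.
have dt2 : 0 <= 2 * dt by rewrite mulr_ge0// ltW.
have := ler_wpM2l dt2 h7.
rewrite (_ : 2 * dt * (dt^-1 * _ / 2 + _) =
  a ^+ 2 - b ^+ 2 + 3 / 2 * nu * dt * g ^+ 2); last by field; rewrite gt_eqF.
rewrite (_ : 2 * dt * (dt ^+ 2 * _) = 2 * dt ^+ 3 * (A0 ^+ 2 + B0 ^+ 2 * b ^+ 2))//.
by ring.
Qed.

End energy_step.

(** The scalar form of one time step. The products with [e] are those of the increment of [w]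
    ([idw]), of [w_t] ([iwt]), of the pressure gradient ([iq]), of the convection along the
    increment ([cd]) and along the old error ([ct]). [W] occurs twice in the constant because the
    difference quotient and [w_t] are bounded separately. *)
Lemma energy_balance (R : realType) (a b g nu dt CI m H W Q K c : R)
    (gw gu cw cu cd ct iwt iq idw iee iet ii : R) :
  0 <= a -> 0 <= b -> 0 <= g -> 0 < nu -> 0 < dt -> 0 < CI -> 0 < m ->
  dt ^- 2 <= m -> m * H ^+ 2 <= nu / (2 * CI ^+ 2) ->
  `|idw| <= dt * W * a -> `|iwt| <= W * a -> `|iq| <= Q * a ->
  `|cd| <= c * K * W * a -> `|ct| <= c * K * b * a ->
  iet <= a * b -> a ^+ 2 = iee -> a ^+ 2 - CI * H * g * a <= ii ->
  cw - cu = cd + ct -> gw - gu = g ^+ 2 ->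
  dt^-1 * (idw - iee + iet) + cu + nu * gu + m * - ii = iwt + cw + iq + nu * gw ->
  a ^+ 2 - b ^+ 2 + 3 / 2 * nu * dt * g ^+ 2 <=
    2 * dt ^+ 3 * ((2 * W + Q + c * K * W) ^+ 2 + (c * K) ^+ 2 * b ^+ 2).
Proof.
move=> a0 b0 g0 nu0 dt0 CI0 m0 mdt mH b1 b2 b3 b4 b5 het ee IHge Ecv Eg eq1.
have {}b1 : `|dt^-1 * idw| <= W * a.
  rewrite normrM ger0_norm ?invr_ge0 ?(ltW dt0)// mulrC ler_pdivrMr//.
  by rewrite mulrC mulrA.
apply: (@energy_arith R a b g iet ii (dt^-1 * idw - iwt - iq - cd - ct) nu m dt CI H) => //.
  move: b1 b2 b3 b4 b5; rewrite !ler_norml.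
  move=> /andP[_ b1] /andP[b2 _] /andP[b3 _] /andP[b4 _] /andP[b5 _].
  rewrite [leRHS](_ : _ = W * a + W * a + Q * a + c * K * W * a + c * K * b * a); last by ring.
  lra.
rewrite ee; move: eq1; rewrite mulrDr mulrBr => eq1.
by rewrite -Eg !mulrBr; lra.
Qed.

(** * The error inequality for one time step *)

Section one_step.
Context {R : realType} {d : nat}.
Variable Omega : set 'rV[R]_d.
Hypothesis oO : open Omega.
Hypothesis bO : bounded_set Omega.

Local Notation E := 'rV[R]_d.
Local Notation mu := (lebesgue_rV R d).
Local Notation L2v := (L2v Omega).
Local Notation L2m := (L2m Omega).
Local Notation ip := (ip Omega).
Local Notation L2norm := (L2norm Omega).
Local Notation wpd := (wpd Omega).
Local Notation grad := (grad Omega).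
Local Notation gradv := (gradv Omega).
Local Notation conv := (Defs.conv Omega).
Local Notation H10v := (H10v Omega).
Local Notation comp u i := (fun x => (u : E -> E) x ord0 i).

Lemma energy_step (nu dt m CI H sigma W Q K : R) k (IH : (E -> E) -> E -> E)
    (f1 : (E -> E) -> R) (w0 w1 wt1 ut0 u1 : E -> E) (q1 : E -> R) :
  0 < nu -> 0 < dt -> dt <= 1 -> 0 < CI -> 0 <= W -> 0 <= K ->
  dt ^- 2 <= m -> m * H ^+ 2 <= nu / (2 * CI ^+ 2) ->
  interpolant Omega k sigma CI H IH ->
  cda_step1 Omega nu dt m IH f1 w1 ut0 u1 ->
  (forall v, H10v v -> ip wt1 v + ip (conv w1 w1) v + ip (grad q1) v
     + nu * ip (gradv w1) (gradv v) = f1 v) ->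
  L2v ut0 -> divfree Omega ut0 -> H10v w1 -> L2v w0 -> L2v wt1 -> Hk Omega 1 q1 ->
  L2norm wt1 <= W -> L2norm (w1 - w0) <= dt * W -> L2norm (grad q1) <= Q ->
  (forall i j, {ae mu, forall x, Omega x -> `|wpd j (comp w1 i) x| <= K}) ->
  L2norm (w1 - u1) ^+ 2 - L2norm (w0 - ut0) ^+ 2
    + 3 / 2 * nu * dt * L2norm (gradv (w1 - u1)) ^+ 2 <=
  2 * dt ^+ 3 * ((2 * W + Q + (d ^ 2)%:R * K * W) ^+ 2 +
    ((d ^ 2)%:R * K) ^+ 2 * L2norm (w0 - ut0) ^+ 2).
Proof.
move=> nu0 dt0 dt1 CI0 W0 K0 mdt mH [_ IHL2 _ IHapprox _] [Hu1 step] NS.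
move=> Lut dut Hw1 Lw0 Lwt Hq wtW dwW qQ wK.
have [c cE] : exists c : R, c = (d ^ 2)%:R by eexists.
have c0 : 0 <= c by rewrite cE.
have m0 : 0 < m by apply: lt_le_trans mdt; rewrite invr_gt0 exprn_gt0.
(* The differences get opaque names: unfolding them makes unification very slow. *)
have [e eE] : exists e : E -> E, e = w1 - u1 by eexists.
have [et etE] : exists et : E -> E, et = w0 - ut0 by eexists.
have [phi phiE] : exists phi : E -> E, phi = u1 - w1 by eexists.
have [dw dwE] : exists dw : E -> E, dw = w1 - w0 by eexists.
rewrite -eE -etE -cE; rewrite -dwE in dwW.
have He : H10v e by rewrite eE; exact: H10vB.
have Hphi : H10v phi by rewrite phiE; exact: H10vB.
have H10m u : H10v u -> L2m u by move=> Hu; apply/L2vP; exact: H10v_L2v.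
have [Lw1 Lu1 Le Lphi] : [/\ L2m w1, L2m u1, L2m e & L2m phi] by split; exact: H10m.
have LIH : L2m (IH phi) by apply/L2vP; exact: IHL2.
have {}Lut' : L2m ut0 by exact/L2vP.
have {}Lw0 : L2m w0 by exact/L2vP.
have {}Lwt : L2m wt1 by exact/L2vP.
have Lq : L2m (grad q1) by apply/L2vP; exact: grad_L2v.
have Let : L2m et by rewrite etE; exact: L2mB.
have Ldw : L2m dw by rewrite dwE; exact: L2mB.
have Hk1 u : H10v u -> forall i, Hk Omega 1 (comp u i) by move=> Hu i; exact: H10_Hk1.
have Lg u : H10v u -> L2m (gradv u) by move=> Hu; apply: gradv_L2m => //; exact: Hk1.
have [Lge Lgp Lgw Lgu] : [/\ L2m (gradv e), L2m (gradv phi), L2m (gradv w1) & L2m (gradv u1)].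
  by split; exact: Lg.
have cv (a : E -> E) (La : L2m a) := conv_L2 oO K0 ((L2vP Omega a).2 La) (Hk1 _ Hw1) wK.
have [[Lcw _] [Lcu _] [Lcd Bcd] [Lct Bct]] := And4 (cv _ Lw1) (cv _ Lut') (cv _ Ldw) (cv _ Let).
rewrite -cE in Bcd Bct.
have ephi : e = fun x => - phi x by rewrite eE phiE; apply/funext => x; rewrite !fctE opprB.
have ge : {ae mu, forall x, Omega x -> gradv e x = gradv w1 x - gradv u1 x}.
  by have h := gradvB_ae oO bO (Hk1 _ Hw1) (Hk1 _ Hu1); rewrite eE; exact h.
have gphi : L2norm (gradv phi) = L2norm (gradv e).
  have gp : {ae mu, forall x, Omega x -> gradv phi x = - gradv e x}.
    have : {ae mu, forall x, Omega x -> gradv phi x = gradv u1 x - gradv w1 x}.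
      by have h := gradvB_ae oO bO (Hk1 _ Hu1) (Hk1 _ Hw1); rewrite phiE; exact h.
    by apply: filterS2 ge => x h1 h2 Ox; rewrite h1// h2// opprB.
  by rewrite (L2norm_ae oO Lgp (L2mN oO Lge) gp) (L2normN oO Lge).
have en : L2norm e = L2norm phi by rewrite ephi (L2normN oO Lphi).
have eq1 := (step _ He).2; have eq2 := NS _ He.
(* From here on the convecting field acts on [w1], whose gradient is bounded, and no longer on
   [u1]. *)
have convu : ip (conv ut0 u1) e = ip (conv ut0 w1) e.
  rewrite eE; apply: (conv_ip_eq oO bO K0 Lut dut Hu1 Hw1 wK) => v Hv.
  exact: (step _ Hv).1.
have Ede : ip (u1 - ut0) e = ip dw e - ip e e + ip et e.
  have -> : u1 - ut0 = fun x => (dw x - e x) + et x.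
    by rewrite dwE eE etE; apply/funext => x; rewrite !fctE; apply/rowP => i; rewrite !mxE; ring.
  by rewrite (ipDl oO (L2mB oO Ldw Le) Let Le) (ipBl oO Ldw Le Le).
have Ecv : ip (conv w1 w1) e - ip (conv ut0 w1) e = ip (conv dw w1) e + ip (conv et w1) e.
  rewrite -(ipDl oO Lcd Lct Le) -(ipBl oO Lcw Lcu Le).
  suff -> : (fun x => conv w1 w1 x - conv ut0 w1 x) = fun x => conv dw w1 x + conv et w1 x by [].
  apply/funext => x; rewrite /Defs.conv -mulmxBl -mulmxDl.
  have -> : w1 x - ut0 x = dw x + et x by rewrite dwE etE !fctE addrA subrK.
  by [].
have Eg : ip (gradv w1) (gradv e) - ip (gradv u1) (gradv e) = L2norm (gradv e) ^+ 2.
  rewrite L2norm_sqr -(ipBl oO Lgw Lgu Lge); apply: (ip_ae oO (L2mB oO Lgw Lgu) Lge Lge).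
  by move: ge; apply: filterS => x /[apply] ->.
(* The interpolant acts on [phi = u1 - w1 = - e], so the nudging term tested with [e] is minus the
   product of [IH phi] with [phi]. *)
have EIH : ip (IH (u1 - w1)) e = - ip (IH phi) phi.
  by rewrite -phiE ephi (ipNr oO Lphi LIH).
have IHge : L2norm e ^+ 2 - CI * H * L2norm (gradv e) * L2norm e <= ip (IH phi) phi.
  have [r rE] : exists r : E -> E, r = IH phi - phi by eexists.
  have Lr : L2m r by rewrite rE; exact: L2mB.
  have E1 : ip (IH phi) phi = L2norm phi ^+ 2 + ip r phi.
    have -> : IH phi = fun x => phi x + r x.
      by apply/funext => x; rewrite rE !fctE addrCA subrr addr0.
    by rewrite L2norm_sqr -(ipDl oO Lphi Lr Lphi).
  have := ip_cauchy_schwarz oO Lr Lphi; rewrite ler_norml => /andP[h _].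
  have h2 := ler_wpM2r (L2norm_ge0 Omega phi) (IHapprox _ Hphi).
  rewrite -rE gphi in h2; rewrite en E1 lerD2l lerNl.
  by apply: le_trans h2; rewrite lerNl.
have e0 := L2norm_ge0 Omega e.
have bnd F C : L2m F -> L2norm F <= C -> `|ip F e| <= C * L2norm e.
  move=> LF FC; apply: le_trans (ip_cauchy_schwarz oO LF Le) _.
  by rewrite ler_wpM2r.
have b1 := bnd _ _ Ldw dwW.
have b2 := bnd _ _ Lwt wtW; have b3 := bnd _ _ Lq qQ.
have cK0 : 0 <= c * K by rewrite mulr_ge0.
(* The increment of [w] is at most [dt W], hence at most [W] since [dt <= 1]. *)
have {}Bcd : L2norm (conv dw w1) <= c * K * W.
  apply: (le_trans Bcd); apply: (ler_wpM2l cK0); apply: (le_trans dwW).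
  by rewrite ler_piMl.
have b4 := bnd _ _ Lcd Bcd.
have b5 := bnd _ _ Lct Bct.
have het : ip et e <= L2norm e * L2norm et.
  by rewrite mulrC; exact: le_trans (ler_norm _) (ip_cauchy_schwarz oO Let Le).
have ee := L2norm_sqr Omega e.
have t0 := L2norm_ge0 Omega et; have g0 := L2norm_ge0 Omega (gradv e).
rewrite Ede EIH convu -eq2 in eq1.
exact: (energy_balance e0 t0 g0 nu0 dt0 CI0 m0 mdt mH b1 b2 b3 b4 b5 het ee IHge Ecv Eg eq1).
Qed.

End one_step.

(** * The discrete Gronwall inequality *)

Section discrete_gronwall.
Context {R : realType}.

(** Without the dissipation, induction gives [b n <= A dt^3 n (1 + B dt)^n]; since [M dt = T], this
    is at most [A T exp(B T) dt^2] up to index [M]. Reinserting this bound in the recursion and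
    telescoping controls the accumulated dissipation. *)
Lemma discrete_gronwall (b g : nat -> R) (A B kappa dt T : R) (M : nat) :
  0 <= A -> 0 <= B -> 0 <= kappa -> 0 < dt -> dt <= 1 -> T = M%:R * dt ->
  (forall n, 0 <= b n) -> (forall n, 0 <= g n) -> b 0%N = 0 ->
  (forall n, b n.+1 + kappa * dt * g n.+1 <= (1 + B * dt) * b n + A * dt ^+ 3) ->
  kappa * (dt * \sum_(1 <= n < M.+1) g n.+1) <=
    (A + B * T * (A * T * expR (B * T)) + A * T) * dt ^+ 2.
Proof.
move=> A0 B0 k0 dt0 dt1 TM b0 g0 b00 step.
have Bd0 : 0 <= B * dt by rewrite mulr_ge0// ltW.
have q1 : 1 <= 1 + B * dt by rewrite lerDl.
have q0 : 0 <= 1 + B * dt by rewrite addr_ge0.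
have dt3 : 0 <= A * dt ^+ 3 by rewrite mulr_ge0// exprn_ge0// ltW.
have kg n : 0 <= kappa * dt * g n by rewrite !mulr_ge0// ltW.
have bn n : b n <= A * dt ^+ 3 * n%:R * (1 + B * dt) ^+ n.
  elim: n => [|n IHn]; first by rewrite b00 mulr0 mul0r.
  have h1 : b n.+1 <= (1 + B * dt) * b n + A * dt ^+ 3.
    by apply: le_trans (step n); rewrite lerDl.
  apply: le_trans h1 _; apply: le_trans (lerD (ler_wpM2l q0 IHn) (lexx _)) _.
  rewrite [leRHS](_ : _ = (1 + B * dt) * (A * dt ^+ 3 * n%:R * (1 + B * dt) ^+ n) +
    A * dt ^+ 3 * (1 + B * dt) ^+ n.+1); last by rewrite -(natr1 n) (exprS (1 + B * dt)); ring.
  by rewrite lerD2l ler_peMr// exprn_ege1.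
have T0 : 0 <= T by rewrite TM mulr_ge0// ltW.
have qM : (1 + B * dt) ^+ M <= expR (B * T).
  have -> : B * T = M%:R * (B * dt) by rewrite TM; ring.
  by rewrite expRM_natl lerXn2r ?nnegrE ?expR_ge0// expR_ge1Dx.
have bM n : (n <= M)%N -> b n <= A * T * expR (B * T) * dt ^+ 2.
  move=> nM; apply: le_trans (bn n) _.
  apply: (@le_trans _ _ (A * dt ^+ 3 * M%:R * expR (B * T))).
    apply: ler_pM; [exact: mulr_ge0|exact: exprn_ge0|by rewrite ler_wpM2l// ler_nat|].
    by apply: le_trans qM; exact: ler_weXn2l.
  by rewrite TM le_eqVlt; apply/orP; left; apply/eqP; ring.
pose G := B * dt * (A * T * expR (B * T) * dt ^+ 2) + A * dt ^+ 3.
(* The sum involves [g 2] to [g M.+1], so the telescoping starts from [b 1] and needs the previous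
   bound exactly up to [b M]. *)
have tele m : (m <= M)%N -> b m.+1 + kappa * (dt * \sum_(1 <= n < m.+1) g n.+1) <= b 1%N + m%:R * G.
  elim: m => [|m IHm] mM; first by rewrite big_nil !mulr0 mul0r.
  rewrite big_nat_recr//= -natr1 !mulrDr mulrDl mul1r.
  have h1 := step m.+1; have h2 := IHm (ltnW mM).
  have h3 := ler_wpM2l Bd0 (bM m.+1 mM).
  move: h1 h2 h3; rewrite /G mulrDl mul1r mulrA; lra.
have h := tele M (leqnn M).
(* The step of index 0 starts from a zero error; it produces the isolated [A] in the final
   constant. *)
have b1 : b 1%N <= A * dt ^+ 2.
  have := step 0%N; rewrite b00 mulr0 add0r => h1.
  apply: (@le_trans _ _ (A * dt ^+ 3)); first by apply: le_trans h1; rewrite lerDl.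
  by rewrite ler_wpM2l// exprS ler_piMl// exprn_ge0// ltW.
have MG : M%:R * G = (B * T * (A * T * expR (B * T)) + A * T) * dt ^+ 2.
  by rewrite /G TM; ring.
have := b0 M.+1; move: h b1; rewrite MG; lra.
Qed.

End discrete_gronwall.

(** * Finiteness of the data entering the constant *)

Section main_constants.
Context {R : realType} {d : nat}.
Variable Omega : set 'rV[R]_d.
Hypothesis oO : open Omega.
Hypothesis bO : bounded_set Omega.
Local Notation L2norm := (L2norm Omega).

Lemma L2norm_grad_le (q : 'rV[R]_d -> R) M : Hk Omega 1 q -> Hk_norm Omega 1 q <= M ->
  L2norm (grad Omega q) <= d%:R * M.
Proof.
move=> Hq qM; apply: le_trans (L2norm_le_sum oO (grad_L2v Hq)) _.
rewrite (_ : d%:R * M = \sum_(j < d) M); last by rewrite sumr_const card_ord mulr_natl.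
apply: ler_sum => j _; apply: le_trans qM.
rewrite (_ : (fun x => grad Omega q x ord0 j) = wpd Omega j q); first exact: nrm_wpd_le.
by apply/funext => x; rewrite mxE.
Qed.

Lemma L2norm_subrr (u : 'rV[R]_d -> 'rV[R]_d) : L2v Omega u -> L2norm (u - u) = 0.
Proof.
move=> /L2vP Lu; have LB := L2mB oO Lu Lu.
by rewrite /Defs.L2norm [ip _ _ _](ipBl oO Lu Lu LB) subrr sqrtr0.
Qed.

(** The first two summands are nonnegative, so they cannot cancel an infinite third one, and a
    finite total forces it to be finite. *)
Lemma Cw_grad_bound (w wt wtt : R -> 'rV[R]_d -> 'rV[R]_d) (m : R) :
  (Cw Omega w wt wtt <= m%:E)%E ->
  (LinftyT_norm (fun u => Linfty_norm Omega (gradv Omega u)) w < +oo)%E.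
Proof.
rewrite /Cw; set a := LinftyT_norm _ _; set b := LinftyT_norm _ _.
set c := LinftyT_norm _ _; set k := LinftyT_norm _ _.
apply: contraTT; rewrite -leNgt leye_eq -ltNge => /eqP ->.
rewrite addey ?ltry// gt_eqF//; apply: lt_le_trans (ltNyr 0) _.
exact: adde_ge0 (sqre_ge0 _) (mule_ge0 (sqre_ge0 _) (sqre_ge0 _)).
Qed.

End main_constants.

(** * Error estimate *)

Theorem theorem3p17 (R : realType) (d : nat) (hd : d = 2%N \/ d = 3%N)
    (Omega : set 'rV[R]_d) (hOmega : lipschitz_domain Omega)
    (nu : R) (hnu : 0 < nu)
    (f : R -> ('rV[R]_d -> 'rV[R]_d) -> R)
    (hf : LinftyT_Hm1 Omega f)
    (w0 : 'rV[R]_d -> 'rV[R]_d)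
    (w wt wtt : R -> 'rV[R]_d -> 'rV[R]_d)
    (q : R -> 'rV[R]_d -> R)
    (hNS : navier_stokes Omega nu f w0 w wt q)
    (hwtt : is_tderiv Omega wt wtt)
    (hwreg : LinftyT_Hkv Omega 3 w)
    (hwtreg : LinftyT_Hkv Omega 1 wt)
    (hwttreg : LinftyT_Hkv Omega 1 wtt)
    (hqreg : LinftyT_Hk Omega 1 q)
    (T : R) (hT : 0 < T)
    (k : nat) (sigma CI : R) (hCI : 0 < CI) :
  exists C : R,
    forall (dt mu H : R)
      (IH : ('rV[R]_d -> 'rV[R]_d) -> ('rV[R]_d -> 'rV[R]_d))
      (u ut : nat -> 'rV[R]_d -> 'rV[R]_d)
      (p : nat -> 'rV[R]_d -> R) (M : nat),
    0 < dt -> dt <= 1 ->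
    interpolant Omega k sigma CI H IH ->
    dt ^- 2 <= mu ->
    (Cw Omega w wt wtt <= mu%:E)%E ->
    mu * H ^+ 2 <= nu / (2 * CI ^+ 2) ->
    T = M%:R * dt ->
    cda_projection Omega nu dt mu IH f w0 w u ut p ->
    let e := fun n : nat => w (n%:R * dt) - u n in
    Num.sqrt (dt * \sum_(1 <= n < M.+1)
                     L2norm Omega (gradv Omega (e n.+1)) ^+ 2) <= C * dt.
Proof.
have [oO _ bO _ _] := hOmega.
have [Hw0 dw0 w00 dwt NS] := hNS.
have [W [W0 wtW]] := LinftyT_bound hwtreg.
have [M3 [M30 wM]] := LinftyT_bound hwreg.
have [Q [Q0 qQ]] := LinftyT_bound hqreg.
set S := LinftyT_norm (fun v => Linfty_norm Omega (gradv Omega v)) w.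
have [Sfin|Sinf] := pselect (S < +oo)%E; last first.
  (* If the supremum is infinite, no real [mu] satisfies the hypothesis on [C_w], so any constant
     will do. *)
  by exists 0 => dt mu H IH u ut p M _ _ _ _ /Cw_grad_bound.
pose K := Num.max 0 (fine S).
have K0 : 0 <= K by rewrite le_max lexx.
have SK : (S <= K%:E)%E.
  have [->|SNy] := eqVneq S -oo%E; first exact: leNye.
  rewrite -[S]fineK; first by rewrite lee_fin le_max lexx orbT.
  by rewrite fin_numE SNy lt_eqF.
have Lwt t : 0 < t -> L2v Omega (wt t) /\ L2norm Omega (wt t) <= W.
  move=> t0; have [Hwt wtWt] := wtW _ t0; have L := Hkv_L2v Hwt.
  by split=> //; apply: le_trans wtWt; exact: L2norm_le_Hkv.
have Hw t : 0 < t -> H10v Omega (w t) by move=> /NS[].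
have Lw t : 0 <= t -> L2v Omega (w t).
  rewrite le_eqVlt => /predU1P[<-|/Hw]; first by rewrite w00; exact: H10v_L2v.
  exact: H10v_L2v.
have wK t : 0 < t -> forall i j, {ae lebesgue_rV R d, forall x, Omega x ->
    `|wpd Omega j (fun y => w t y ord0 i) x| <= K}.
  apply: (gradv_ae_bound oO bO dwt W0 M30 Lwt _ _ SK) => r r0 i.
    exact: H10_Hk1 (Hw r r0 i).
  move=> j; apply: le_trans (nrm_wpd_le Omega 2 j _) _.
  exact: le_trans (Hk_norm_le_Hkv Omega 3 (w r) i) (wM r r0).2.
(* [A0] and [B0] are the coefficients of the one-step inequality, the pressure gradient being
   bounded by [d Q]; [D] is the Gronwall constant. They depend only on [d], [nu], [T] and the
   solution. *)
pose B0 := (d ^ 2)%:R * K; pose A0 := 2 * W + d%:R * Q + B0 * W.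
pose A := 2 * A0 ^+ 2; pose B := 2 * B0 ^+ 2; pose kappa := 3 / 2 * nu.
pose D := A + B * T * (A * T * expR (B * T)) + A * T.
have kappa0 : 0 < kappa by rewrite mulr_gt0.
have A00 : 0 <= A by rewrite mulr_ge0// sqr_ge0.
have B00 : 0 <= B by rewrite mulr_ge0// sqr_ge0.
exists (Num.sqrt (D / kappa)) => dt mu H IH u ut p M dt0 dt1 hIH hmu _ hH TM [u0 ut0 alg] /=.
pose e n := w (n%:R * dt) - u n.
have t0 n : 0 < n.+1%:R * dt by rewrite mulr_gt0.
have tge n : 0 <= n%:R * dt by rewrite mulr_ge0// ltW.
have utP n : L2v Omega (ut n) /\ divfree Omega (ut n).
  case: n => [|n]; first by rewrite ut0; split=> //; exact: H10v_L2v.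
  by have [_ [/(YspaceP oO bO)[]]] := alg n.
pose b n := L2norm Omega (w (n%:R * dt) - ut n) ^+ 2.
pose g n := L2norm Omega (gradv Omega (e n)) ^+ 2.
have step n : b n.+1 + kappa * dt * g n.+1 <= (1 + B * dt) * b n + A * dt ^+ 3.
  have [S1 S2] := alg n; have [Lut dut] := utP n; have [_ dw NSv] := NS _ (t0 n).
  have [LwtW wtWn] := Lwt _ (t0 n); have [Hq qQn] := qQ _ (t0 n).
  have wdt : L2norm Omega (w (n.+1%:R * dt) - w (n%:R * dt)) <= dt * W.
    have nn : n%:R * dt <= n.+1%:R * dt by rewrite ler_wpM2r ?(ltW dt0)// ler_nat.
    have := tderiv_lipschitz oO dwt Lwt (tge n) nn (Lw _ (tge n)) (Lw _ (tge n.+1)).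
    by rewrite -mulrBl -natr1 addrAC subrr add0r mul1r.
  have := energy_step oO bO hnu dt0 dt1 hCI W0 K0 hmu hH hIH S1 NSv Lut dut (Hw _ (t0 n))
    (Lw _ (tge n)) LwtW Hq wtWn wdt (L2norm_grad_le oO Hq qQn) (wK _ (t0 n)).
  have pr : b n.+1 <= L2norm Omega (w (n.+1%:R * dt) - u n.+1) ^+ 2.
    rewrite lerXn2r ?nnegrE ?L2norm_ge0//; apply: (projection_le oO bO dt0 _ S2).
      exact: H10v_L2v S1.1.
    by have h := H10v_Yspace oO bO (Hw _ (t0 n)) dw; exact h.
  have b0 : 0 <= b n by rewrite sqr_ge0.
  (* The old error enters with the factor [dt^3]; as [dt <= 1], it is relaxed to the factor [dt] of
     the Gronwall recursion. *)
  have dt3 : B * (dt ^+ 3 * b n) <= B * (dt * b n).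
    by rewrite ler_wpM2l// ler_wpM2r// exprS ler_piMr ?(ltW dt0)// exprn_ile1// ltW.
  move: pr dt3; rewrite -/(b n) -/(g n.+1) -/B0 -/A0 /kappa /A /B.
  move: (b n.+1) (b n) (g n.+1) (L2norm _ _ ^+ 2) => b1 bn g1 a1; lra.
have bge0 n : 0 <= b n by rewrite sqr_ge0.
have gge0 n : 0 <= g n by rewrite sqr_ge0.
have b0 : b 0%N = 0.
  rewrite /b mul0r w00 ut0 L2norm_subrr ?expr0n//; exact: H10v_L2v.
have := discrete_gronwall A00 B00 (ltW kappa0) dt0 dt1 TM bge0 gge0 b0 step.
rewrite -/D => bound.
have D0 : 0 <= D.
  have AT0 := mulr_ge0 A00 (ltW hT); have BT0 := mulr_ge0 B00 (ltW hT).
  exact: addr_ge0 (addr_ge0 A00 (mulr_ge0 BT0 (mulr_ge0 AT0 (expR_ge0 _)))) AT0.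
have Dk : 0 <= D / kappa by rewrite divr_ge0// ltW.
have -> : Num.sqrt (D / kappa) * dt = Num.sqrt (D / kappa * dt ^+ 2).
  by rewrite [RHS]sqrtrM// sqrtr_sqr ger0_norm// ltW.
rewrite ler_sqrt; last by rewrite mulr_ge0 ?sqr_ge0.
by rewrite mulrAC ler_pdivlMr// mulrC.
Qed.
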